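(* Let $L$ be a link diagram in $S^2$ and let $U$ be an unknot encircling $n$ strands of $L$, so that $L = \mathbf{1}_n \cup L''$, where $\mathbf{1}_n$ is the trivial braid on these $n$ strands inside a disc $D'$ and $L''=L\cap D''$ lies in the complementary disc. For $m\ge 0$ let $L_m$ be the link obtained from $L$ by replacing $\mathbf{1}_n$ with $\Delta^{2m}$, where $\Delta^2=(\sigma_1\cdots\sigma_{n-1})^n\in B_n$ is the full right twist, and leaving $L''$ unchanged (equivalently, $L_m$ is obtained from $L$ by $-1/m$ surgery on $U$). Then the Mahler measure $M(V_{L_m}(t))$ of the Jones polynomial of $L_m$ converges, as $m\to\infty$, to the Mahler measure of a $2$-variable polynomial.
   Context: For a nonzero Laurent polynomial $f\in\mathbb{C}[z_1^{\pm1},\ldots,z_s^{\pm1}]$, its Mahler measure is $M(f)=\exp\int_0^1\cdots\int_0^1\log|f(e^{2\pi i\theta_1},\ldots,e^{2\pi i\theta_s})|\,d\theta_1\cdots d\theta_s$ (with $\exp(-\infty)=0$); it is multiplicative, so it extends to rational functions, and multiplying by a monomial (including fractional powers of $t$ appearing in Jones polynomials) does not change it. $V_L(t)$ denotes the Jones polynomial of $L$. *)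

(* Defs.v *)
From HB Require Import structures.
From mathcomp Require Import all_boot all_order all_algebra.
From mathcomp Require Import all_classical all_reals all_analysis.
From mathcomp Require Import Rstruct Rstruct_topology.

Set Implicit Arguments.
Unset Strict Implicit.
Unset Printing Implicit Defensive.

Import Order.TTheory GRing.Theory Num.Theory.
Import numFieldNormedType.Exports.
Local Open Scope ring_scope.

(* Oriented link / tangle diagrams as Morse words.                          *)
(* A diagram is read top to bottom; at each height there are k points on a  *)
(* horizontal line, numbered 0..k-1 from left to right.  Each point carries *)
(* the orientation of the strand through it (true = oriented downwards).    *)
(*  - Cup i d   : a local minimum creating two new points at positions i,   *)
(*                i+1 (oriented d and ~~d);                                 *)
(*  - Cap i     : a local maximum joining the points at positions i, i+1;   *)
(*  - Cross i b : a crossing between the strands at positions i and i+1;    *)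
(*                b = true : the strand going from top position i to bottom *)
(*                position i+1 passes over (the braid generator sigma_(i+1))*)
(*                b = false: it passes under (sigma_(i+1)^-1).              *)
(* Every link diagram in S^2 is planar isotopic to such a Morse diagram.    *)

Inductive layer := Cup of nat & bool | Cap of nat | Cross of nat & bool.

Definition step_or (s : seq bool) (l : layer) : option (seq bool) :=
  match l with
  | Cup i d => if (i <= size s)%N then Some (take i s ++ [:: d; ~~ d] ++ drop i s)
               else None
  | Cap i => if (i.+1 < size s)%N && (nth false s i != nth false s i.+1)
             then Some (take i s ++ drop i.+2 s) else None
  | Cross i _ => if (i.+1 < size s)%N
                 then Some (take i s ++ [:: nth false s i.+1; nth false s i]
                                 ++ drop i.+2 s)
                 else None
  end.

Fixpoint run_or (w : seq layer) (s : seq bool) : option (seq bool) :=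
  match w with
  | [::] => Some s
  | l :: w' => if step_or s l is Some s' then run_or w' s' else None
  end.

Definition link_diagram (w : seq layer) : Prop := run_or w [::] = Some [::].

(* sign of a crossing: positive iff (over direction) x (under direction) > 0 *)
Definition crossing_sign (b d1 d2 : bool) : int :=
  if b != (d1 == d2) then 1 else -1.

Fixpoint writhe_aux (w : seq layer) (s : seq bool) : int :=
  match w with
  | [::] => 0
  | l :: w' =>
    let sgn := if l is Cross i b
               then crossing_sign b (nth false s i) (nth false s i.+1) else 0 in
    sgn + (if step_or s l is Some s' then writhe_aux w' s' else 0)
  end.

Definition writhe (w : seq layer) : int := writhe_aux w [::].

(* Laurent polynomials in A with integer coefficients: (p, k) represents    *)
(* p(A) * A^(-k).                                                            *)

Definition lpoly := ({poly int} * nat)%type.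

Definition ladd (f g : lpoly) : lpoly :=
  let m := maxn f.2 g.2 in (f.1 * 'X^(m - f.2) + g.1 * 'X^(m - g.2), m).
Definition lmul (f g : lpoly) : lpoly := (f.1 * g.1, f.2 + g.2).
Definition lexp (f : lpoly) (n : nat) : lpoly := iter n (lmul f) (1, 0%N).
Definition lmono (a b : nat) : lpoly := ('X^a, b).
(* the loop value  d = -A^2 - A^(-2) *)
Definition lloop : lpoly := (- 'X^4 - 1, 2%N).
(* (-A^3)^(-w) *)
Definition lwrithe (w : int) : lpoly :=
  match w with
  | Posz n => ((-1) ^+ n, (3 * n)%N)
  | Negz n => ((-1) ^+ n.+1 * 'X^(3 * n.+1), 0%N)
  end.

(* Kauffman bracket by the state sum.  For loop counting, every current     *)
(* point carries the label of the arc through it (each label occurs twice). *)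

Record lstate := LState { labels : seq nat; fresh : nat; nloops : nat }.

Definition ucup (i : nat) (st : lstate) : lstate :=
  LState (take i (labels st) ++ [:: fresh st; fresh st] ++ drop i (labels st))
         (fresh st).+1 (nloops st).

Definition ucap (i : nat) (st : lstate) : lstate :=
  let ls := labels st in
  let x := nth 0%N ls i in let y := nth 0%N ls i.+1 in
  let ls' := take i ls ++ drop i.+2 ls in
  if x == y then LState ls' (fresh st) (nloops st).+1
  else LState [seq (if z == y then x else z) | z <- ls'] (fresh st) (nloops st).

Definition uhoriz (i : nat) (st : lstate) : lstate := ucup i (ucap i st).

(* Sum over all states of the remaining crossings of A^(#A - #B) d^(loops-1);
   a, b count the A- and B-smoothings chosen so far.  For the crossing
   Cross i true (over strand from north-west to south-east) the A-smoothing
   (joining the regions swept by rotating the over strand counterclockwise)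
   is the horizontal one; for Cross i false it is the vertical one. *)
Fixpoint bracket_aux (w : seq layer) (st : lstate) (a b : nat) : lpoly :=
  match w with
  | [::] => lmul (lmono a b) (lexp lloop (nloops st).-1)
  | Cup i _ :: w' => bracket_aux w' (ucup i st) a b
  | Cap i :: w' => bracket_aux w' (ucap i st) a b
  | Cross i o :: w' =>
      ladd (bracket_aux w' (if o then uhoriz i st else st) a.+1 b)
           (bracket_aux w' (if o then st else uhoriz i st) a b.+1)
  end.

(* Kauffman bracket <D>, normalised by <O> = 1 *)
Definition kbracket (w : seq layer) : lpoly := bracket_aux w (LState [::] 0 0) 0 0.

(* Jones polynomial V_D = (-A^3)^(-w(D)) <D>, as a Laurent polynomial in A,
   where A = t^(-1/4). *)
Definition jones (w : seq layer) : lpoly := lmul (lwrithe (writhe w)) (kbracket w).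

(* For theta real, p(e^{2 pi i theta}) has real part Re and imaginary part  *)
(* Im below, and log|p| = ln(Re^2 + Im^2) / 2.                               *)

Local Notation RR := Rdefinitions.R.

Definition abs2_1 (p : {poly int}) (th : RR) : RR :=
  (\sum_(k < size p) (p`_k)%:~R * cos (2 * pi * k%:R * th)) ^+ 2
  + (\sum_(k < size p) (p`_k)%:~R * sin (2 * pi * k%:R * th)) ^+ 2.

Definition mahler1 (p : {poly int}) : RR :=
  if p == 0 then 0 else
  expR (\int[lebesgue_measure]_(th in `[0, 1]%classic) (ln (abs2_1 p th) / 2)).

(* Mahler measure of a Laurent polynomial p(A) A^(-k): the monomial A^(-k)
   does not change it. *)
Definition lmahler (f : lpoly) : RR := mahler1 f.1.

(* Two-variable polynomials in x, y: P = \sum_j (P`_j)(x) y^j *)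
Definition abs2_2 (P : {poly {poly int}}) (th : RR * RR) : RR :=
  (\sum_(j < size P) \sum_(k < size P`_j)
      ((P`_j)`_k)%:~R * cos (2 * pi * (k%:R * th.1 + j%:R * th.2))) ^+ 2
  + (\sum_(j < size P) \sum_(k < size P`_j)
      ((P`_j)`_k)%:~R * sin (2 * pi * (k%:R * th.1 + j%:R * th.2))) ^+ 2.

Definition mahler2 (P : {poly {poly int}}) : RR :=
  if P == 0 then 0 else
  expR (\int[(@lebesgue_measure RR \x @lebesgue_measure RR)%E]_(th in
           (`[0, 1]%classic `*` `[0, 1]%classic)) (ln (abs2_2 P th) / 2)).

Definition full_twist (n : nat) : seq layer :=
  flatten (nseq n [seq Cross j true | j <- iota 0 n.-1]).

(* the trivial braid 1_n in the disc D', closed off: on 2n points, the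
   point i (strand a_(i+1)) is joined to the point 2n-1-i (strand b_(i+1)). *)
Definition nested_caps (n : nat) : seq layer := [seq Cap i | i <- rev (iota 0 n)].

(* L = L'' ++ nested_caps n ;  L_m = L'' ++ Delta^(2m) ++ nested_caps n *)
Definition twisted (L'' : seq layer) (n m : nat) : seq layer :=
  L'' ++ flatten (nseq m (full_twist n)) ++ nested_caps n.

(* Main.v *)
Require Import Defs.
From HB Require Import structures.
From mathcomp Require Import all_boot all_order all_algebra.
From mathcomp Require Import all_classical all_reals all_analysis measurable_realfun.
From mathcomp Require Import complex zify.

(** Write the Kauffman bracket as a state sum.  On the planar matchings of the
    twisted strands, a crossing acts as [A^-1 + A U_i] where the [U_i] satisfy the
    Temperley-Lieb relations, and the full twist is annihilated by a product of
    factors [x - lambda_k] whose roots are distinct powers of [A].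
    Hence the bracket of [L_m] is a combination of the [lambda_k ^ m], with
    coefficients that are polynomials in [A] divided by products of factors
    [A^b - 1].  These denominators and all monomials have Mahler measure 1, so
    that the Mahler measure of [V_(L_m)] is that of [Q (A, A^m)], for a fixed
    polynomial [Q] in two variables.

    It remains to prove Lawton's limit [M (Q (x, x^m)) -> M (Q)].  Cutting the
    logarithm off at [ln (|Q|^2 + eps)] gives a Lipschitz function on the torus,
    whose integral along the closed geodesics [(t, m t)] tends to the integral
    over the torus.  The error of the cut-off is uniform in [m] since
    [ln (|p|^2 + eta)] is bounded in [L^2] of the circle, uniformly in [eta] and
    in all [p] with a given number of monomials, bounded coefficients and leading
    coefficient at least 1: this follows by induction on the number of monomials,
    as a nonzero real trigonometric polynomial of degree [n] has at most [2 n]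
    zeros in a period. *)

Set Implicit Arguments.
Unset Strict Implicit.
Unset Printing Implicit Defensive.

Import Order.TTheory GRing.Theory Num.Theory.
Import numFieldNormedType.Exports.
Local Open Scope ring_scope.

(** * Full twists in the Temperley-Lieb algebra *)

(** The annihilating product comes from a filtration: the ideals generated by [k] parallel hooks
    decrease with [k], and on each successive quotient the full twist is a scalar, since [k] arcs
    untwist into curls while the crossings among the remaining strands act as [A^-1]. These scalars
    are distinct powers of [A], so solving the recurrence divides only by differences of such
    powers.

    The obstacle in the limit is that [ln |Q|] is unbounded near the zeros of [Q], while the degree
    of [Q (x, x^m)] grows with [m]. A polynomial of degree [n] is therefore compared with its
    derivative divided by [2 pi n]: the variation argument costs a factor of order [n], one for each
    monotone piece, and the two factors cancel. Each differentiation removes a monomial, so the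
    number of steps depends on [Q] alone, and integrality keeps the leading coefficient at least 1
    to the end. The bound is in [L^2] so that, as in Chebyshev's inequality, the region where [|p|]
    is small contributes an error that vanishes with the cut-off. *)

Section TemperleyLieb.
Variables (B : pzRingType) (a b : B) (U : nat -> B).
Hypotheses (ab1 : a * b = 1) (ba1 : b * a = 1).
Hypotheses (aU : forall i, a * U i = U i * a) (bU : forall i, b * U i = U i * b).
Hypothesis UU : forall i, U i * U i = - (a * a * U i) - b * b * U i.
Hypothesis UUpU : forall i, U i * U i.+1 * U i = U i.
Hypothesis UpUUp : forall i, U i.+1 * U i * U i.+1 = U i.+1.
Hypothesis UC : forall i j, (i.+1 < j)%N -> U i * U j = U j * U i.

Definition tlcross i := a + b * U i.
Local Notation s := tlcross.

Lemma tlcross_a i : a * s i = s i * a.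
Proof. by rewrite mulrDr mulrDl -mulrA -aU !mulrA ab1 ba1. Qed.

Lemma tlcross_b i : b * s i = s i * b.
Proof. by rewrite mulrDr mulrDl ab1 ba1 -!mulrA bU. Qed.

(** First Reidemeister move: the curl costs [- b ^+ 3], because the loop value cancels the term in
    [a]. *)
Lemma mul_tlcross_U i : s i * U i = - (b ^+ 3 * U i).
Proof.
rewrite mulrDl -mulrA UU mulrDr !mulrN !mulrA ba1 mul1r addrA subrr add0r.
by rewrite !exprS expr0 mulr1 !mulrA.
Qed.

Lemma tlcrossC i j : (i.+1 < j)%N -> s i * s j = s j * s i.
Proof.
move=> ij; rewrite /s !mulrDl !mulrDr -!addrA; congr (_ + _).
rewrite addrCA; congr (_ + _); first by rewrite -mulrA -aU !mulrA ab1 ba1.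
congr (_ + _); first by rewrite -mulrA -aU !mulrA ab1 ba1.
by rewrite -!mulrA; congr (_ * _); rewrite !mulrA -!bU -!mulrA UC.
Qed.

Lemma tlcross_UC i j : (i.+1 < j)%N -> s j * U i = U i * s j.
Proof. by move=> ij; rewrite /s mulrDl mulrDr aU -mulrA -UC // !mulrA bU. Qed.

Let addr_cancel (x y z : B) : x + (- x - y) + (z + y) = z.
Proof. by rewrite [x + _]addrA subrr add0r addrC addrK. Qed.

(* Both Reidemeister-type slides use that the loop value cancels
   [a^2 + b^2]. *)
Lemma tlcross_slide i : s i * s i.+1 * U i = U i.+1 * U i.
Proof.
rewrite /s mulrDr !mulrDl.
rewrite (_ : b * U i * (b * U i.+1) * U i = b * b * U i); last first.
  rewrite -[b * U i * _]mulrA [U i * _]mulrA -bU -!mulrA; congr (_ * (_ * _)).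
  by rewrite mulrA UUpU.
rewrite (_ : b * U i * a * U i = - (a * a * U i) - b * b * U i); last first.
  by rewrite -[b * U i * a]mulrA -aU mulrA ba1 mul1r UU.
rewrite [a * (b * _)]mulrA ab1 mul1r.
exact: addr_cancel.
Qed.

Lemma tlcross_slide' i : s i.+1 * s i * U i.+1 = U i * U i.+1.
Proof.
rewrite /s mulrDr !mulrDl.
rewrite (_ : b * U i.+1 * (b * U i) * U i.+1 = b * b * U i.+1); last first.
  rewrite -[b * U i.+1 * _]mulrA [U i.+1 * _]mulrA -bU -!mulrA; congr (_ * (_ * _)).
  by rewrite mulrA UpUUp.
rewrite (_ : b * U i.+1 * a * U i.+1 = - (a * a * U i.+1) - b * b * U i.+1); last first.
  by rewrite -[b * U i.+1 * a]mulrA -aU mulrA ba1 mul1r UU.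
rewrite [a * (b * _)]mulrA ab1 mul1r.
exact: addr_cancel.
Qed.


Lemma U_tlcross_slide i : U i.+1 * (s i * s i.+1) = U i.+1 * U i.
Proof.
rewrite /s mulrDl !mulrDr.
rewrite (_ : U i.+1 * (b * U i * (b * U i.+1)) = b * b * U i.+1); last first.
  rewrite !mulrA -bU -[_ * U i * b]mulrA -bU !mulrA -[b * U i.+1 * b]mulrA -bU.
  by rewrite -!mulrA [U i.+1 * _]mulrA UpUUp.
rewrite (_ : U i.+1 * (a * (b * U i.+1)) = - (a * a * U i.+1) - b * b * U i.+1);
  last by rewrite [a * _]mulrA ab1 mul1r UU.
rewrite (_ : U i.+1 * (b * U i * a) = U i.+1 * U i); last first.
  by rewrite -[b * _ * _]mulrA -aU [b * _]mulrA ba1 mul1r.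
rewrite (_ : U i.+1 * (a * a) = a * a * U i.+1); last by rewrite mulrA -aU -mulrA -aU mulrA.
exact: addr_cancel.
Qed.

(** Third Reidemeister move. Resolving the last crossing on the left side and the first on the right
    side gives [a * (s i * s i.+1) + b * (U i.+1 * U i)] both times, by [tlcross_slide] and
    [U_tlcross_slide]. *)
Lemma tlcross_braid i : s i * s i.+1 * s i = s i.+1 * s i * s i.+1.
Proof.
transitivity (a * (s i * s i.+1) + b * (U i.+1 * U i)); last first.
  rewrite -mulrA -U_tlcross_slide; change (a * (s i * s i.+1) + b * (U i.+1 * (s i * s i.+1)) =
    (a + b * U i.+1) * (s i * s i.+1)).
  by rewrite [RHS]mulrDl -[b * U i.+1 * _]mulrA.
rewrite -tlcross_slide; change (s i * s i.+1 * (a + b * U i) =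
  a * (s i * s i.+1) + b * (s i * s i.+1 * U i)).
rewrite mulrDr; congr (_ + _); first by rewrite -mulrA -tlcross_a mulrA -tlcross_a mulrA.
by rewrite mulrA -[_ * _ * b]mulrA -tlcross_b mulrA -tlcross_b !mulrA.
Qed.

Definition delta k := \prod_(i <- iota 0 k) s i.

Lemma deltaS k : delta k.+1 = delta k * s k.
Proof. by rewrite /delta -addn1 iotaD big_cat /= big_seq1. Qed.

Lemma delta_far j k : (k < j)%N -> s j * delta k = delta k * s j.
Proof.
elim: k => [|k IH] kj; first by rewrite /delta big_nil mulr1 mul1r.
by rewrite deltaS mulrA IH 1?ltnW // -!mulrA (tlcrossC kj).
Qed.

Lemma delta_shift i k : (i.+1 < k)%N -> s i.+1 * delta k = delta k * s i.
Proof.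
elim: k => // k IH; rewrite ltnS leq_eqVlt => /orP[/eqP <-|ik].
  by rewrite !deltaS -mulrA mulrA delta_far // -!mulrA; congr (_ * _); rewrite !mulrA tlcross_braid.
by rewrite deltaS mulrA IH // -!mulrA (tlcrossC ik).
Qed.

Fixpoint down i j := if j is j'.+1 then s i * down i.-1 j' else 1.

Lemma down_delta i j k : (j <= i)%N -> (i < k)%N ->
  down i j * delta k = delta k * down i.-1 j.
Proof.
elim: j i => [|j IH] i ji ik /=; first by rewrite mulr1 mul1r.
case: i ji ik => // i ji ik; rewrite -mulrA IH //=; last exact: ltnW.
by rewrite mulrA delta_shift // mulrA.
Qed.

(** Peels the last strand off the twist: in [delta k.+1 = delta k * s k] the crossing [s k] joins a
    descending word, which moves right through each further factor [delta k.+1] with its indices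
    lowered by one. *)
Lemma delta_exp k j : (j <= k.+1)%N -> delta k.+1 ^+ j = delta k ^+ j * down k j.
Proof.
elim: j => [|j IH] jk; first by rewrite !expr0 mulr1.
rewrite exprSr IH 1?ltnW // -mulrA down_delta // deltaS [RHS]/= exprSr.
by rewrite -!mulrA.
Qed.

(** A Jucys-Murphy element of the braid group: strand [o + k + 1] goes once around the strands [o],
    ..., [o + k]. *)
Definition encircle o k := iteri k (fun i x => s (o + i).+1 * x * s (o + i).+1) (s o * s o).

Lemma encircleS o k :
  encircle o k.+1 = s (o + k).+1 * encircle o k * s (o + k).+1.
Proof. by []. Qed.

Lemma encircleE k : down k k.+1 * delta k.+1 = encircle 0 k.
Proof.
elim: k => [|k IH]; first by rewrite /= mulr1 /delta big_seq1.
have -> : down k.+1 k.+2 = s k.+1 * down k k.+1 by [].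
by rewrite deltaS mulrA -[s k.+1 * _ * delta _]mulrA IH /= add0n.
Qed.

(** The full twist on [n] strands starting at position [o]. As a product of Jucys-Murphy elements it
    lets an arc be pulled through one factor at a time. *)
Definition twist o n := \prod_(i <- iota 0 n.-1) encircle o i.

Lemma twistS o n : twist o n.+2 = twist o n.+1 * encircle o n.
Proof. by rewrite /twist -[n.+2.-1]addn1 iotaD big_cat /= big_seq1. Qed.

Lemma delta_twist n : delta n ^+ n.+1 = twist 0 n.+1.
Proof.
elim: n => [|n IH]; first by rewrite /delta /twist !big_nil expr1n.
by rewrite exprSr delta_exp // -mulrA encircleE IH twistS.
Qed.

(** A strand that goes around both ends of an arc slides off it. *)
Lemma encircle_U1 o : encircle o 1 * U o = U o.
Proof.
rewrite /encircle /= addn0 -!mulrA.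
by rewrite [s o * (s o.+1 * _)]mulrA tlcross_slide mulrA [_ * (_ * _)]mulrA tlcross_slide' UUpU.
Qed.

Lemma encircle_U o k : encircle o k.+2 * U o = U o * encircle o.+2 k.
Proof.
elim: k => [|k IH]; last first.
  rewrite encircleS -mulrA tlcross_UC; last by rewrite ltnS -addSnnS leq_addr.
  rewrite mulrA -[_ * _ * U o]mulrA IH.
  rewrite mulrA tlcross_UC; last by rewrite ltnS -addSnnS leq_addr.
  by rewrite encircleS !addSn !addnS !mulrA.
rewrite encircleS addn1 -mulrA tlcross_UC // mulrA -[_ * _ * U o]mulrA.
by rewrite encircle_U1 tlcross_UC // -mulrA.
Qed.

Lemma encircle_U0 o : encircle o 0 * U o = b ^+ 6 * U o.
Proof.
rewrite /encircle /= -mulrA mul_tlcross_U mulrN mulrA.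
have -> : s o * b ^+ 3 = b ^+ 3 * s o by apply: commrX; rewrite /GRing.comm tlcross_b.
by rewrite -mulrA mul_tlcross_U mulrN opprK mulrA -exprD.
Qed.

(** The two strands joined by the arc turn their mutual twist into two curls, worth [b ^+ 3] each up
    to sign. All other strands either slide off the arc or no longer see it. *)
Lemma twist_U o n : twist o n.+2 * U o = b ^+ 6 * (U o * twist o.+2 n).
Proof.
elim: n => [|n IH]; first by rewrite /twist /= big_seq1 big_nil mulr1 encircle_U0.
case: n IH => [|n] IH.
  by rewrite twistS -mulrA encircle_U1 IH.
by rewrite twistS -mulrA encircle_U mulrA IH twistS !mulrA.
Qed.

(** Generator of the ideal of diagrams with at most [n - 2k] through strands; these ideals filter
    the algebra. *)
Definition parallel_U k := \prod_(i <- iota 0 k) U i.*2.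

Lemma parallel_US k : parallel_U k.+1 = parallel_U k * U k.*2.
Proof. by rewrite /parallel_U -addn1 iotaD big_cat /= big_seq1. Qed.

Lemma parallel_UC k j : (k.*2 <= j)%N -> U j.+1 * parallel_U k = parallel_U k * U j.+1.
Proof.
elim: k => [|k IH] kj; first by rewrite /parallel_U big_nil mulr1 mul1r.
have kj' : (k.*2.+1 < j)%N by rewrite -doubleS.
rewrite parallel_US mulrA IH; last by rewrite ltnW // ltnW.
by rewrite -!mulrA (@UC k.*2 j.+1) // ltnW.
Qed.

Lemma comm_twist o n x : GRing.comm x b -> (forall i, (o <= i)%N -> GRing.comm x (U i)) ->
  GRing.comm x a -> GRing.comm x (twist o n).
Proof.
move=> xb xU xa; have xs i : (o <= i)%N -> GRing.comm x (s i).
  by move=> oi; apply: commrD => //; apply: commrM => //; apply: xU.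
rewrite /twist; apply: (big_ind (fun y => GRing.comm x y)) => [|y z|i _].
- exact: commr1.
- exact: commrM.
elim: i => [|i IH]; first by apply: commrM; apply: xs.
by rewrite encircleS; do !apply: commrM => //; apply: xs; rewrite -addnS leq_addr.
Qed.

Lemma twist_parallel_U n k :
  twist 0 (k.*2 + n) * parallel_U k = b ^+ (6 * k) * (parallel_U k * twist k.*2 n).
Proof.
elim: k n => [|k IH] n; first by rewrite /parallel_U big_nil mulr1 mul1r muln0 mul1r.
rewrite parallel_US mulrA (_ : (k.+1.*2 + n = k.*2 + n.+2)%N); last by rewrite doubleS !addSn !addnS.
have bP : GRing.comm (b ^+ 6) (parallel_U k).
  by apply: commr_prod => i _; apply: commr_sym; apply: commrX; rewrite /GRing.comm bU.
have bb : b ^+ 6 * b ^+ (6 * k) = b ^+ (6 * k) * b ^+ 6 by rewrite -!exprD addnC.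
rewrite IH mulnS exprD bb; move: (b ^+ 6) (b ^+ (6 * k)) bP (twist_U k.*2 n) => c e bP tU.
by rewrite -!mulrA tU doubleS; congr (_ * _); rewrite !mulrA bP.
Qed.

(** Modulo the next ideal every crossing acts as [a], so only the length and the range of the word
    matter later. *)
Lemma twist_word o n : exists2 w : seq nat,
  twist o n = \prod_(i <- w) s i & (size w == n * n.-1)%N && all (fun i => o <= i < o + n.-1)%N w.
Proof.
have enc k : exists2 w : seq nat, encircle o k = \prod_(i <- w) s i &
    (size w == k.+1.*2)%N && all (fun i => o <= i < o + k.+1)%N w.
  elim: k => [|k [w wE /andP[/eqP sw aw]]].
    exists [:: o; o]; first by rewrite big_cons big_seq1.
    by rewrite /= addn1 leqnn ltnSn.
  exists ((o + k).+1 :: rcons w (o + k).+1).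
    by rewrite encircleS wE big_cons -cats1 big_cat big_seq1 -mulrA.
  rewrite /= size_rcons sw all_rcons; apply/and4P; split; [lia|lia|lia|].
  by apply: sub_all aw => i; lia.
elim: n => [|[|n] IH]; try by exists [::]; rewrite ?/twist ?big_nil.
have [w wE /andP[/eqP sw aw]] := IH; have [v vE /andP[/eqP sv av]] := enc n.
exists (w ++ v); first by rewrite big_cat -wE -vE twistS.
rewrite size_cat sw sv all_cat /=; apply/and3P; split; first by nia.
  by apply: sub_all aw => i; lia.
by apply: sub_all av => i; lia.
Qed.

Lemma commr_twist_s0 n : GRing.comm (twist 0 n.+2) (s 0).
Proof.
apply: commr_sym; apply: commr_prod => i _; elim: i => [|i IH].
  by apply: commrM.
case: i IH => [|i] IH.
  rewrite encircleS [encircle 0 0]/encircle /GRing.comm /= !add0n !mulrA tlcross_braid -!mulrA.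
  by congr (_ * _); congr (_ * _); rewrite !mulrA tlcross_braid.
rewrite encircleS; do !apply: commrM => //; by rewrite /GRing.comm tlcrossC.
Qed.

Lemma tlcross_inv i : s i * (b + a * U i) = 1.
Proof.
rewrite mulrDr -tlcross_b mulrA -tlcross_a.
rewrite -[a * s i * _]mulrA mul_tlcross_U {1}/s mulrDr ba1 -addrA mulrN.
rewrite (_ : a * (b ^+ 3 * U i) = b * (b * U i)) ?subrr ?addr0 //.
by rewrite !exprS expr0 mulr1 !mulrA ab1 mul1r.
Qed.

Lemma delta_reg k x y : x * delta k = y * delta k -> x = y.
Proof.
elim: k x y => [|k IH] x y; first by rewrite /delta big_nil !mulr1.
rewrite deltaS !mulrA => /(congr1 (fun z => z * (b + a * U k))).
by rewrite -!mulrA tlcross_inv !mulr1; apply: IH.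
Qed.

(** Centrality of the full twist. It commutes with [s 0] by the braid relation and with [delta] as a
    power of it; conjugation by the cancellable element [delta] carries [s i] to [s i.+1]. *)
Lemma commr_twist_s n i : (i < n.-1)%N -> GRing.comm (twist 0 n) (s i).
Proof.
case: n => [|[|n]] //= ; elim: i => [|i IH] ilt; first exact: commr_twist_s0.
have dT : twist 0 n.+2 * delta n.+1 = delta n.+1 * twist 0 n.+2.
  by rewrite -delta_twist -exprSr -exprS.
apply: (@delta_reg n.+1); rewrite -mulrA delta_shift // mulrA dT -mulrA IH 1?ltnW //.
by rewrite mulrA -delta_shift // -mulrA -dT mulrA.
Qed.

Lemma commr_twist_a o n : GRing.comm (twist o n) a.
Proof. by apply/commr_sym/comm_twist; rewrite /GRing.comm ?ab1 ?ba1. Qed.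

Lemma commr_twist_b o n : GRing.comm (twist o n) b.
Proof. by apply/commr_sym/comm_twist; rewrite /GRing.comm ?ab1 ?ba1. Qed.

Lemma commr_twist_U n i : (i < n.-1)%N -> GRing.comm (twist 0 n) (U i).
Proof.
move=> ilt; have -> : U i = a * (s i - a).
  by rewrite /s addrAC subrr add0r mulrA ab1 mul1r.
apply: commrM; first exact: commr_twist_a.
by apply: commrB; [exact: commr_twist_s | exact: commr_twist_a].
Qed.

(** The scalar of the full twist on the [k]-th quotient of the filtration: [b ^+ 6] for each of the
    [k] arcs, and [a] for each of the [(n - 2k) (n - 2k - 1)] crossings among the other strands. *)
Definition twist_eigen n k := b ^+ (6 * k) * a ^+ ((n - k.*2) * (n - k.*2).-1).

(** The factor for [k] stands rightmost, where it meets [parallel_U k] and carries it into the next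
    ideal. *)
Fixpoint twist_ann n r k :=
  if r is r'.+1 then twist_ann n r' k.+1 * (twist 0 n - twist_eigen n k) else 1.

Lemma commr_twist_ann n r k i : (i < n.-1)%N -> GRing.comm (U i) (twist_ann n r k).
Proof.
move=> ilt; elim: r k => [|r IH] k; first exact: commr1.
apply: commrM; first exact: IH.
apply: commrB; first by apply: commr_sym; exact: commr_twist_U.
by apply: commrM; apply: commrX; rewrite /GRing.comm ?aU ?bU.
Qed.

(** Expanding each crossing as [a + b * U j], the terms with some [U j] lie in the next ideal and
    are killed, which leaves [a ^+ size w]. *)
Lemma twist_ann_word n r k w :
  twist_ann n r k.+1 * parallel_U k.+1 = 0 ->
  all (fun i => k.*2 <= i < n.-1)%N w ->
  twist_ann n r k.+1 * (parallel_U k * (\prod_(i <- w) s i - a ^+ size w)) = 0.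
Proof.
move=> annE.
(* For [j = 2k] this is the hypothesis on [parallel_U k.+1]. It spreads to the right through
   [U j.+1 = U j.+1 * U j * U j.+1], as the annihilator commutes with the hooks. *)
have annU j : (k.*2 <= j < n.-1)%N -> twist_ann n r k.+1 * (parallel_U k * U j) = 0.
  case/andP => kj; have [d ->] : exists d, j = (k.*2 + d)%N by exists (j - k.*2)%N; lia.
  elim: d {j kj} => [|d IH] dn; first by rewrite addn0 -parallel_US.
  have -> : parallel_U k * U (k.*2 + d.+1) =
      U (k.*2 + d).+1 * ((parallel_U k * U (k.*2 + d)) * U (k.*2 + d).+1).
    by rewrite addnS -{1}(UpUUp (k.*2 + d)) !mulrA -parallel_UC ?leq_addr.
  have dn' : ((k.*2 + d).+1 < n.-1)%N by rewrite -addnS.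
  rewrite mulrA -(commr_twist_ann _ _ dn') -mulrA [twist_ann _ _ _ * _]mulrA.
  by rewrite IH ?mul0r ?mulr0 //; lia.
elim: w => [|j w IH] /=; first by rewrite big_nil subrr !mulr0.
case/andP=> /annU jU /IH {}IH; rewrite big_cons exprS.
have -> : s j * \prod_(i <- w) s i - a * a ^+ size w =
    a * (\prod_(i <- w) s i - a ^+ size w) + U j * (b * \prod_(i <- w) s i).
  by rewrite {1}/s mulrDl mulrBr addrAC mulrA bU.
rewrite [parallel_U k * (_ + _)]mulrDr [LHS]mulrDr [parallel_U k * (U j * _)]mulrA [X in _ + X]mulrA jU mul0r addr0.
have Pa : parallel_U k * a = a * parallel_U k.
  by apply: commr_sym; apply: commr_prod => i _; rewrite /GRing.comm aU.
rewrite [parallel_U k * _]mulrA Pa -mulrA mulrA.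
have -> : twist_ann n r k.+1 * a = a * twist_ann n r k.+1.
  elim: r (k.+1) {IH annE annU jU} => [|r IH] l /=; first by rewrite mulr1 mul1r.
  rewrite mulrA -IH -!mulrA; congr (_ * _); apply: commr_sym; apply: commrB.
    exact/commr_sym/commr_twist_a.
  by apply: commrM; apply: commrX; rewrite /GRing.comm ?ab1 ?ba1.
by rewrite -mulrA IH mulr0.
Qed.

Lemma twist_sub_eigen n k : (k.*2 <= n)%N ->
  (twist 0 n - twist_eigen n k) * parallel_U k = b ^+ (6 * k) *
  (parallel_U k * (twist k.*2 (n - k.*2) - a ^+ ((n - k.*2) * (n - k.*2).-1))).
Proof.
move=> kn; rewrite mulrBl /twist_eigen -{1}(subnKC kn) twist_parallel_U -mulrA !mulrBr.
congr (_ - _ * _); apply: commr_sym; apply: commrX; apply: commr_sym; apply: commr_prod => i _.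
by rewrite /GRing.comm aU.
Qed.

(** Descending induction along the filtration. For [k = n./2] at most one strand is left over and
    there is nothing to twist; otherwise the factor for [k] produces an element that the remaining
    factors kill by [twist_ann_word]. *)
Lemma twist_ann_parallel n r k : (r + k = n./2)%N ->
  twist_ann n r.+1 k * parallel_U k = 0.
Proof.
elim: r k => [|r IH] k rk; rewrite [twist_ann _ _ _]/= -mulrA.
all: rewrite twist_sub_eigen; last by move: (odd_double_half n); lia.
  have [->|->] : (n - k.*2 = 0 \/ n - k.*2 = 1)%N by move: (odd_double_half n); case: odd; lia.
    by rewrite /twist big_nil subrr !mulr0.
  by rewrite /twist big_nil subrr !mulr0.
have bA : GRing.comm b (twist_ann n r.+1 k.+1).
  elim: r.+1 k.+1 {IH rk} => [|q IH] l /=; first exact: commr1.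
  apply: commrM; first exact: IH.
  apply: commrB; first exact/commr_sym/commr_twist_b.
  by apply: commrM; apply: commrX; rewrite /GRing.comm ?ab1 ?ba1.
rewrite mulrA; have -> : twist_ann n r.+1 k.+1 * b ^+ (6 * k) = b ^+ (6 * k) * twist_ann n r.+1 k.+1.
  by apply: commrX; apply: commr_sym.
have [w -> /andP[/eqP <- aw]] := twist_word k.*2 (n - k.*2).
rewrite -mulrA twist_ann_word ?mulr0 //; first by apply: IH; lia.
by apply: sub_all aw => i; lia.
Qed.

Lemma twist_annihilated n : twist_ann n n./2.+1 0 = 0.
Proof.
by have := @twist_ann_parallel n n./2 0 (addn0 _); rewrite /parallel_U big_nil mulr1.
Qed.

Lemma full_twistE n : delta n.-1 ^+ n = twist 0 n.
Proof. by case: n => [|n]; [rewrite /twist big_nil | exact: delta_twist]. Qed.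

End TemperleyLieb.

(** * Arc patterns and hook operators *)

(** The previous section asks only for a ring, so the hooks can act as additive maps on all
    functions of arc patterns, without a basis of planar matchings. *)
Record endo (M : zmodType) := Endo { endo_fun :> M -> M; endoB : zmod_morphism endo_fun }.

Section EndoRing.
Variable M : zmodType.
Implicit Types f g h : endo M.

Lemma endoP f g : (forall x, f x = g x) -> f = g.
Proof.
case: f g => [f fB] [g gB] /= /funext fg; rewrite fg in fB *.
by congr Endo; apply: Prop_irrelevance.
Qed.

HB.instance Definition _ := gen_eqMixin (endo M).
HB.instance Definition _ := gen_choiceMixin (endo M).

Fact endo0_subproof : zmod_morphism (fun _ : M => 0 : M).
Proof. by move=> x y; rewrite subr0. Qed.
Fact endo1_subproof : zmod_morphism (@id M).
Proof. by []. Qed.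
Fact endoN_subproof f : zmod_morphism (fun x => - f x).
Proof. by move=> x y; rewrite endoB opprB addrC opprK. Qed.
Fact endoD_subproof f g : zmod_morphism (fun x => f x + g x).
Proof. by move=> x y; rewrite !endoB opprD addrACA. Qed.
Fact endoM_subproof f g : zmod_morphism (fun x => f (g x)).
Proof. by move=> x y; rewrite !endoB. Qed.

Definition endo0 := Endo endo0_subproof.
Definition endo1 := Endo endo1_subproof.
Definition endo_opp f := Endo (@endoN_subproof f).
Definition endo_add f g := Endo (@endoD_subproof f g).
Definition endo_mul f g := Endo (@endoM_subproof f g).

Fact endo_addA : associative endo_add.
Proof. by move=> f g h; apply: endoP => x /=; rewrite addrA. Qed.
Fact endo_addC : commutative endo_add.
Proof. by move=> f g; apply: endoP => x /=; rewrite addrC. Qed.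
Fact endo_add0 : left_id endo0 endo_add.
Proof. by move=> f; apply: endoP => x /=; rewrite add0r. Qed.
Fact endo_addN : left_inverse endo0 endo_opp endo_add.
Proof. by move=> f; apply: endoP => x /=; rewrite addNr. Qed.
HB.instance Definition _ :=
  GRing.isZmodule.Build (endo M) endo_addA endo_addC endo_add0 endo_addN.

Lemma endo_zero f : f 0 = 0.
Proof. by rewrite -{1}(subrr 0) endoB subrr. Qed.

Lemma endoD f x y : f (x + y) = f x + f y.
Proof. by rewrite -{1}(opprK y) endoB -(sub0r y) endoB endo_zero sub0r opprK. Qed.

Fact endo_mulA : associative endo_mul.
Proof. by move=> f g h; apply: endoP. Qed.
Fact endo_mul1 : left_id endo1 endo_mul.
Proof. by move=> f; apply: endoP. Qed.
Fact endo_1mul : right_id endo1 endo_mul.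
Proof. by move=> f; apply: endoP. Qed.
Fact endo_mulDl : left_distributive endo_mul +%R.
Proof. by move=> f g h; apply: endoP. Qed.
Fact endo_mulDr : right_distributive endo_mul +%R.
Proof. by move=> f g h; apply: endoP => x /=; rewrite endoD. Qed.
HB.instance Definition _ := GRing.Zmodule_isPzRing.Build (endo M)
  endo_mulA endo_mul1 endo_1mul endo_mulDl endo_mulDr.

Lemma mul_endoE f g x : (f * g) x = f (g x). Proof. by []. Qed.
Lemma add_endoE f g x : (f + g) x = f x + g x. Proof. by []. Qed.
Lemma opp_endoE f x : (- f) x = - f x. Proof. by []. Qed.

End EndoRing.

Definition label_rel (f : nat -> nat) : nat -> nat -> bool := fun x y => f x == f y.

(** A labelling up to renaming: only the relation of carrying the same label is kept, so that
    patterns with different label names are equal as terms. *)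
Record arcs := Arcs {
  prel : nat -> nat -> bool;
  arcsP : exists f, prel = label_rel f }.

Definition arcs_of f := Arcs (ex_intro _ f (erefl (label_rel f))).

Lemma arcs_ofP p : exists f, p = arcs_of f.
Proof.
by case: p => e [f fE]; exists f; subst e; congr Arcs; apply: Prop_irrelevance.
Qed.

Lemma eq_arcs f g :
  (forall x y, (f x == f y) = (g x == g y)) <-> arcs_of f = arcs_of g.
Proof.
split=> [fg|[fg] x y]; last by have := congr1 (fun h => h x y) fg.
have E : label_rel f = label_rel g by apply/funext => x; apply/funext => y; exact: fg.
rewrite /arcs_of; move: (ex_intro _ _ _) (ex_intro _ _ _); rewrite E => p1 p2.
by congr Arcs; apply: Prop_irrelevance.
Qed.

(** Joins the two arcs that end at [i] and [i.+1] and places a new arc there. Its label 0 is new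
    because all other labels become successors. *)
Definition relabel i (f : nat -> nat) x :=
  if (x == i) || (x == i.+1) then 0%N
  else (if f x == f i.+1 then f i else f x).+1.

Definition hook i p := arcs_of (relabel i (sval (cid (arcs_ofP p)))).

Lemma hookE i f : hook i (arcs_of f) = arcs_of (relabel i f).
Proof.
rewrite /hook; case: cid => g /= /eq_arcs fg; apply/eq_arcs => x y.
rewrite /relabel; case: (_ || _); case: (_ || _) => //; rewrite !eqSS -!fg.
by case: (f x == _); case: (f y == _); rewrite ?eqxx ?fg.
Qed.

Ltac innermost_if :=
  match goal with |- context [if ?c then _ else _] =>
    lazymatch c with
    | context [if _ then _ else _] => fail
    | _ => let h := fresh in destruct c eqn:h
    end
  end.

Ltac label_cases :=
  rewrite /relabel; repeat (innermost_if; rewrite ?eqSS //=; try by lia); rewrite ?eqSS //=; lia.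

Lemma hook_idem i p : hook i (hook i p) = hook i p.
Proof.
have [f ->] := arcs_ofP p; rewrite !hookE; apply/eq_arcs => x y.
label_cases.
Qed.

Lemma hook_up i p : hook i (hook i.+1 (hook i p)) = hook i p.
Proof.
have [f ->] := arcs_ofP p; rewrite !hookE; apply/eq_arcs => x y.
by have [->|?] := eqVneq x i.+2; have [->|?] := eqVneq y i.+2; label_cases.
Qed.

Lemma hook_down i p : hook i.+1 (hook i (hook i.+1 p)) = hook i.+1 p.
Proof.
have [f ->] := arcs_ofP p; rewrite !hookE; apply/eq_arcs => x y.
by have [->|?] := eqVneq x i; have [->|?] := eqVneq y i; label_cases.
Qed.

Lemma merge_eq (a b v w : nat) :
  ((if v == b then a else v) == (if w == b then a else w)) =
  (v == w) || ((v == a) || (v == b)) && ((w == a) || (w == b)).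
Proof.
by case: (eqVneq v b) => [->|?]; case: (eqVneq w b) => [->|?];
  rewrite ?eqxx ?orbT ?andbT ?orbF ?andbF //; lia.
Qed.

Lemma relabel_eq i f x y : (relabel i f x == relabel i f y) =
  if (x == i) || (x == i.+1) then (y == i) || (y == i.+1) else
  ~~ ((y == i) || (y == i.+1)) &&
  ((f x == f y) || ((f x == f i) || (f x == f i.+1)) && ((f y == f i) || (f y == f i.+1))).
Proof.
rewrite /relabel; case: ((x == i) || _); case: ((y == i) || _) => //=.
by rewrite eqSS merge_eq.
Qed.

Lemma hookC i j p : (i.+1 < j)%N -> hook i (hook j p) = hook j (hook i p).
Proof.
move=> ij; have [f ->] := arcs_ofP p; rewrite !hookE; apply/eq_arcs => x y.
rewrite !relabel_eq; have [ji ji1 j1i j1i1] : [/\ j == i = false, j == i.+1 = false,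
  j.+1 == i = false & j.+1 == i.+1 = false] by split; lia.
have [ij' ij1 i1j i1j1] : [/\ i == j = false, i == j.+1 = false,
  i.+1 == j = false & i.+1 == j.+1 = false] by split; lia.
rewrite ji ji1 j1i j1i1 ij' ij1 i1j i1j1 /=.
have disj z : ((z == i) || (z == i.+1)) && ((z == j) || (z == j.+1)) = false by lia.
move: (disj x) (disj y).
case: ((x == i) || _); case: ((x == j) || _) => //= _;
case: ((y == i) || _); case: ((y == j) || _) => //= _; rewrite ?andbF //.
move: (f x) (f y) (f i) (f j) (f i.+1) (f j.+1) => X Y A C B D.
by repeat (match goal with |- context [?u == ?v] => case: (eqVneq u v) => [?|?]; [subst|] end;
  rewrite ?eqxx ?orbT ?andbT ?orbF ?andbF //=).
Qed.

(** * State sums *)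

(** The shift by one reserves 0 for the positions beyond the end, so that they never agree with an
    actual arc. *)
Definition lab (l : seq nat) x := nth 0%N (map succn l) x.

Definition pat st := arcs_of (lab (labels st)).

(** The parity condition survives the merging of labels, and it forces the last two points of a
    diagram to carry the same label. *)
Definition wf st := all (fun x => x < fresh st)%N (labels st) &&
  all (fun x => ~~ odd (count_mem x (labels st))) (labels st).

Lemma lab_take_drop l i x : (i.+1 < size l)%N ->
  lab (take i l ++ drop i.+2 l) x = lab l (if (x < i)%N then x else x.+2).
Proof.
move=> il; rewrite /lab map_cat nth_cat size_map size_takel; last by lia.
case: ifP => xi; rewrite ?map_take ?map_drop ?nth_take ?nth_drop //.
by congr nth; lia.
Qed.

Definition merge (x y z : nat) := if z == y then x else z.

Lemma ucapE i st : ucap i st =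
  LState (map (merge (nth 0%N (labels st) i) (nth 0%N (labels st) i.+1))
     (take i (labels st) ++ drop i.+2 (labels st))) (fresh st)
    (nloops st + (nth 0%N (labels st) i == nth 0%N (labels st) i.+1)).
Proof.
rewrite /ucap; case: eqP => [e|_]; last by rewrite addn0.
rewrite addn1 map_id_in // => z _; rewrite /merge e; by case: eqP.
Qed.

Lemma lab_nth l i : (i < size l)%N -> lab l i = (nth 0%N l i).+1.
Proof. by move=> il; rewrite /lab (nth_map 0%N). Qed.

Lemma lab_out l i : (size l <= i)%N -> lab l i = 0%N.
Proof. by move=> il; rewrite /lab nth_default ?size_map. Qed.

Lemma lab_ucap i st x : (i.+1 < size (labels st))%N ->
  let l := labels st in
  lab (labels (ucap i st)) x = merge (lab l i) (lab l i.+1) (lab l (if (x < i)%N then x else x.+2)).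
Proof.
move=> il l; rewrite ucapE /= -/l -lab_take_drop // !(lab_nth (l := l)) //; last exact: ltnW.
move: (take i l ++ _) => l'; have [xl|xl] := ltnP x (size l').
  rewrite !lab_nth ?size_map // (nth_map 0%N) // /merge eqSS; by case: ifP.
by rewrite !lab_out ?size_map.
Qed.

Lemma size_ucap i st : (i.+1 < size (labels st))%N ->
  size (labels (ucap i st)) = (size (labels st) - 2)%N.
Proof. by move=> il; rewrite ucapE size_map size_cat size_drop size_takel; lia. Qed.

Lemma size_ucup i st : (i <= size (labels st))%N ->
  size (labels (ucup i st)) = (size (labels st)).+2.
Proof. by move=> il; rewrite /= size_cat /= size_drop size_takel; lia. Qed.

Lemma lab_ucup i st x : (i <= size (labels st))%N ->
  lab (labels (ucup i st)) x =
  if (x == i) || (x == i.+1) then (fresh st).+1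
  else lab (labels st) (if x < i then x else x - 2)%N.
Proof.
move=> il; rewrite /lab /= !map_cat nth_cat size_map size_takel //.
have [xi|xi] := ltnP x i; first by rewrite map_take nth_take // !ifF //; lia.
case: ifP => [/orP[] /eqP ->|xi']; rewrite ?subnn ?subSnn //.
rewrite (_ : (x - i = (x - i - 2).+2)%N); last by lia.
by rewrite /= map_drop nth_drop; congr nth; lia.
Qed.

Lemma nloops_ucap i st : (i.+1 < size (labels st))%N ->
  nloops (ucap i st) = (nloops st + prel (pat st) i i.+1)%N.
Proof.
by move=> il; rewrite ucapE /= /label_rel !lab_nth ?eqSS //; exact: ltnW.
Qed.

Lemma wfP st : reflect ((forall x : nat, x \in labels st -> (x < fresh st)%N) /\
  (forall x : nat, ~~ odd (count_mem x (labels st)))) (wf st).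
Proof.
apply: (iffP andP) => [[/allP h1 /allP h2]|[h1 h2]]; split=> //; try exact/allP.
  move=> x; have [/h2//|nx] := boolP (x \in labels st).
  by have /count_memPn -> := nx.
Qed.

Lemma mem_take_drop (l : seq nat) i j x : x \in take i l ++ drop j l -> x \in l.
Proof. by rewrite mem_cat => /orP[/mem_take|/mem_drop]. Qed.

Lemma wf_ucup i st : wf st -> wf (ucup i st).
Proof.
case/wfP => h1 h2; apply/wfP; split=> x /=.
  rewrite !mem_cat !inE => /or4P[/mem_take/h1|/eqP->|/eqP->|/mem_drop/h1]; lia.
move: (h2 x); rewrite -{1}(cat_take_drop i (labels st)) !count_cat /=.
by case: (fresh st == x) => /=; lia.
Qed.

Lemma count_mem_take_drop (l : seq nat) i x : (i.+1 < size l)%N ->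
  count_mem x l = ((nth 0%N l i == x) + (nth 0%N l i.+1 == x) +
    count_mem x (take i l ++ drop i.+2 l))%N.
Proof.
move=> il; rewrite -[in LHS](cat_take_drop i l) (drop_nth 0%N); last exact: ltnW.
by rewrite (drop_nth 0%N il) !count_cat /=; lia.
Qed.

Lemma count_map_merge x y z l : count_mem z (map (merge x y) l) =
  if z == y then (if x == y then count_mem y l else 0%N)
  else (count_mem z l + (x == z) * count_mem y l)%N.
Proof.
elim: l => [|u l IH] /=; first by rewrite muln0 !if_same.
rewrite IH /merge; case: (eqVneq u y) => [?|?]; case: (eqVneq z y) => [?|?];
  case: (eqVneq x y) => [?|?]; subst => //=; rewrite ?eqxx; try lia.
all: by case: eqP => //=; lia.
Qed.

Lemma wf_ucap i st : (i.+1 < size (labels st))%N -> wf st -> wf (ucap i st).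
Proof.
move=> il /wfP[h1 h2]; rewrite ucapE; apply/wfP; split=> z /=.
  case/mapP => u /mem_take_drop/h1 ut ->; rewrite /merge; case: ifP => // _.
  by apply: h1; apply: mem_nth; exact: ltnW.
have C u := count_mem_take_drop u il.
rewrite count_map_merge; move: (h2 z) (h2 (nth 0%N (labels st) i.+1)) (h2 (nth 0%N (labels st) i)).
rewrite !C !eqxx; move: (nth _ _ i) (nth _ _ i.+1) (_ ++ _) => x y l {C}.
case: (eqVneq z y) => [?|?]; case: (eqVneq x y) => [?|?]; subst; rewrite ?eqxx //=;
  try lia.
all: by case: (eqVneq x z) => [?|?]; subst; rewrite ?eqxx //=; lia.
Qed.

Lemma pat_uhoriz i st : (i.+1 < size (labels st))%N -> wf st ->
  pat (uhoriz i st) = hook i (pat st).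
Proof.
move=> il /wfP[h1 _]; rewrite hookE; apply/eq_arcs => x y.
have ils : (i <= size (labels (ucap i st)))%N by rewrite size_ucap //; lia.
have fr z : merge (lab (labels st) i) (lab (labels st) i.+1) (lab (labels st) z) == (fresh st).+1 = false.
  rewrite /merge; have lt z' : (lab (labels st) z' == (fresh st).+1) = false.
    have [zl|zl] := ltnP z' (size (labels st)); last by rewrite lab_out.
    by rewrite lab_nth // eqSS; apply/ltn_eqF/h1/mem_nth.
  by case: ifP.
have E z : lab (labels (uhoriz i st)) z = if (z == i) || (z == i.+1) then (fresh st).+1
    else merge (lab (labels st) i) (lab (labels st) i.+1) (lab (labels st) z).
  rewrite lab_ucup // (_ : fresh (ucap i st) = fresh st); last by rewrite ucapE.
  case: ifP => // zi; rewrite lab_ucap //; congr merge; congr lab.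
  by case: (ltnP z i) => h; [rewrite h | rewrite ifF]; lia.
rewrite !E /relabel; case: ((x == i) || _); case: ((y == i) || _); rewrite ?eqxx //.
  by rewrite eq_sym fr.
Qed.

Lemma size_uhoriz i st : (i.+1 < size (labels st))%N ->
  size (labels (uhoriz i st)) = size (labels st).
Proof. by move=> il; rewrite size_ucup size_ucap //; lia. Qed.

Lemma wf_uhoriz i st : (i.+1 < size (labels st))%N -> wf st -> wf (uhoriz i st).
Proof. by move=> il wfst; apply/wf_ucup/wf_ucap. Qed.

Lemma nloops_uhoriz i st : (i.+1 < size (labels st))%N ->
  nloops (uhoriz i st) = (nloops st + prel (pat st) i i.+1)%N.
Proof. exact: nloops_ucap. Qed.

(** The strand counts of [run_or] without the orientations, which the bracket ignores. *)
Fixpoint fits (w : seq layer) (k k' : nat) : bool :=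
  match w with
  | [::] => k == k'
  | Cup i _ :: w' => (i <= k)%N && fits w' k.+2 k'
  | Cap i :: w' => (i.+1 < k)%N && fits w' (k - 2) k'
  | Cross i _ :: w' => (i.+1 < k)%N && fits w' k k'
  end.

Lemma fits_run w s s' : run_or w s = Some s' -> fits w (size s) (size s').
Proof.
elim: w s => [|l w IH] s /=; first by case=> ->.
case: l => [i d|i|i b] /=; case: ifP => // c.
- by move/IH; rewrite size_cat /= size_drop size_takel // !addnS subnKC.
- case/andP: c => c _; move/IH; rewrite c /= size_cat /= size_drop size_takel; last by lia.
  by congr fits; lia.
- move/IH; rewrite size_cat /= size_drop size_takel; last by lia.
  by congr fits; lia.
Qed.

Lemma fits_cat w1 w2 k k'' : fits (w1 ++ w2) k k'' -> exists2 k', fits w1 k k' & fits w2 k' k''.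
Proof.
elim: w1 k => [|l w1 IH] k /=; first by exists k.
by case: l => [i d|i|i b] /andP[-> /IH].
Qed.

Lemma cat_fits w1 w2 k k' k'' : fits w1 k k' -> fits w2 k' k'' -> fits (w1 ++ w2) k k''.
Proof.
elim: w1 k => [|l w1 IH] k /=; first by move/eqP => ->.
by case: l => [i d|i|i b] /andP[-> h] /(IH _ h).
Qed.

Local Notation K := {fraction {poly int}}.

Record arcfun := ArcFun { arcfun_val :> arcs -> K }.

Section ArcFunctions.
Implicit Types F G H : arcfun.

Lemma arcfunP F G : (forall p, F p = G p) -> F = G.
Proof. by case: F G => [F] [G] /= FG; congr ArcFun; apply/funext. Qed.

HB.instance Definition _ := gen_eqMixin arcfun.
HB.instance Definition _ := gen_choiceMixin arcfun.

Definition arcfun0 := ArcFun (fun=> 0).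
Definition arcfun_opp F := ArcFun (fun p => - F p).
Definition arcfun_add F G := ArcFun (fun p => F p + G p).

Fact arcfun_addA : associative arcfun_add.
Proof. by move=> F G H; apply/arcfunP => p; apply: addrA. Qed.
Fact arcfun_addC : commutative arcfun_add.
Proof. by move=> F G; apply/arcfunP => p; apply: addrC. Qed.
Fact arcfun_add0 : left_id arcfun0 arcfun_add.
Proof. by move=> F; apply/arcfunP => p; apply: add0r. Qed.
Fact arcfun_addN : left_inverse arcfun0 arcfun_opp arcfun_add.
Proof. by move=> F; apply/arcfunP => p; apply: addNr. Qed.
HB.instance Definition _ :=
  GRing.isZmodule.Build arcfun arcfun_addA arcfun_addC arcfun_add0 arcfun_addN.

Lemma add_arcfunE F G p : (F + G) p = F p + G p. Proof. by []. Qed.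
Lemma opp_arcfunE F p : (- F) p = - F p. Proof. by []. Qed.
Definition arcfunE := (add_arcfunE, opp_arcfunE).

End ArcFunctions.

(** * Hook operators and the recurrence satisfied by the bracket *)

Section StateSum.
Variable al : K.
Hypothesis al0 : al != 0.
Let d := - al ^+ 2 - al ^- 2.

(** The weight [t] of the number of loops is a parameter: with [d ^+ k] closing a loop is
    multiplication by [d], whereas the bracket needs [d ^+ k.-1]. *)
Fixpoint state_sum (t : nat -> K) (w : seq layer) (st : lstate) : K :=
  match w with
  | [::] => t (nloops st)
  | Cup i _ :: w' => state_sum t w' (ucup i st)
  | Cap i :: w' => state_sum t w' (ucap i st)
  | Cross i o :: w' =>
      al * state_sum t w' (if o then uhoriz i st else st)
      + al^-1 * state_sum t w' (if o then st else uhoriz i st)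
  end.

(** The final cap joins two points with the same label and so closes a loop. The value at 0 loops,
    where [k.-1] truncates, never occurs. *)
Lemma state_sum_last t1 t2 c w st : (forall k, t1 k.+1 = c * t2 k.+1) ->
  wf st -> fits w (size (labels st)) 2 ->
  state_sum t1 (w ++ [:: Cap 0]) st = c * state_sum t2 (w ++ [:: Cap 0]) st.
Proof.
move=> t12; elim: w st => [|l w IH] st /= wfst.
  move/eqP=> s2; rewrite (_ : nloops (ucap 0 st) = (nloops st).+1) ?t12 //.
  suff e : nth 0%N (labels st) 0 == nth 0%N (labels st) 1 by rewrite ucapE /= e addn1.
  move/wfP: wfst => [_]; case: (labels st) s2 => [|x [|y [|]]] //= _ /(_ x).
  by rewrite eqxx eq_sym; case: eqP.
case: l => [i o|i|i o] /andP[iw fw].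
- by apply: IH; [exact: wf_ucup | rewrite size_ucup].
- by apply: IH; [exact: wf_ucap | rewrite size_ucap].
have H : state_sum t1 (w ++ [:: Cap 0]) (uhoriz i st) = c * state_sum t2 (w ++ [:: Cap 0]) (uhoriz i st).
  by apply: IH; [exact: wf_uhoriz | rewrite size_uhoriz].
by case: o; rewrite H IH // mulrDr; congr (_ + _); exact: mulrCA.
Qed.

(** The part above the twists expands into a linear combination that is the same for every [m]. *)
Lemma state_sum_closed (A : (nat -> K) -> Prop) t (W : nat -> seq layer) k :
  (forall c g c' g', A g -> A g' -> A (fun m => c * g m + c' * g' m)) ->
  (forall st, wf st -> size (labels st) = k -> A (fun m => state_sum t (W m) st)) ->
  forall w st, wf st -> fits w (size (labels st)) k ->
  A (fun m => state_sum t (w ++ W m) st).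
Proof.
move=> Alin AW; elim=> [|l w IH] st /= wfst; first by move/eqP; exact: AW.
case: l => [i o|i|i o] /andP[iw fw].
- by apply: IH; [exact: wf_ucup | rewrite size_ucup].
- by apply: IH; [exact: wf_ucap | rewrite size_ucap].
have wfu := wf_uhoriz iw wfst.
by case: o; apply: Alin; apply: IH; rewrite ?size_uhoriz.
Qed.

Lemma state_sum_caps l st1 st2 k : fits (map Cap l) (size (labels st1)) k ->
  size (labels st1) = size (labels st2) -> pat st1 = pat st2 ->
  exists X, state_sum (fun k => d ^+ k) (map Cap l) st1 = d ^+ nloops st1 * X /\
            state_sum (fun k => d ^+ k) (map Cap l) st2 = d ^+ nloops st2 * X.
Proof.
elim: l st1 st2 => [|i l IH] st1 st2 /=; first by move=> _ _ _; exists 1; rewrite !mulr1.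
case/andP=> iw fw s12 p12; have iw2 : (i.+1 < size (labels st2))%N by rewrite -s12.
have [|||X [-> ->]] := IH (ucap i st1) (ucap i st2); rewrite ?size_ucap // ?s12 //.
  apply/eq_arcs => x y; move: p12 => /eq_arcs p12.
  by rewrite !lab_ucap // /merge !merge_eq !p12.
exists (d ^+ prel (pat st2) i i.+1 * X).
by rewrite !nloops_ucap // p12 !exprD !mulrA.
Qed.

Local Notation M := arcfun.

Definition scal_fun (c : K) (F : M) : M := ArcFun (fun p => c * F p).
(** The hook acts on functionals of patterns, so the topmost crossing of a diagram becomes the
    outermost operator. The factor [d] records the loop closed when [i] and [i.+1] lie on the same
    arc. *)
Definition hook_fun i (F : M) : M :=
  ArcFun (fun p => (if prel p i i.+1 then d else 1) * F (hook i p)).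

Fact scal_funB c : zmod_morphism (scal_fun c).
Proof. by move=> F G; apply/arcfunP => p; rewrite /scal_fun /= ?arcfunE mulrBr. Qed.
Fact hook_funB i : zmod_morphism (hook_fun i).
Proof. by move=> F G; apply/arcfunP => p; rewrite /hook_fun /= ?arcfunE mulrBr. Qed.

Definition scal c : endo M := Endo (scal_funB c).
Definition hook_op i : endo M := Endo (hook_funB i).

Lemma scalE c F p : scal c F p = c * F p. Proof. by []. Qed.
Lemma hook_opE i F p :
  hook_op i F p = (if prel p i i.+1 then d else 1) * F (hook i p).
Proof. by []. Qed.
Let opE := (scalE, hook_opE).

Lemma scalM c c' : scal c * scal c' = scal (c * c').
Proof. by apply: endoP => F; apply/arcfunP => p; rewrite mul_endoE !opE mulrA. Qed.
Lemma scal1 : scal 1 = 1.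
Proof. by apply: endoP => F; apply/arcfunP => p; rewrite scalE mul1r. Qed.
Lemma scalX c n : scal c ^+ n = scal (c ^+ n).
Proof. by elim: n => [|n IH]; rewrite ?scal1 // !exprS IH scalM. Qed.
Lemma scal_hookC c i : scal c * hook_op i = hook_op i * scal c.
Proof.
apply: endoP => F; apply/arcfunP => p; rewrite !mul_endoE !opE.
exact: mulrCA.
Qed.

Lemma hook_prel i p : prel (hook i p) i i.+1.
Proof.
have [f ->] := arcs_ofP p.
by rewrite hookE /= /label_rel /relabel !eqxx !orbT.
Qed.

Lemma hook_prelS i p : prel (hook i p) i.+1 i.+2 = false.
Proof.
have [f ->] := arcs_ofP p.
by rewrite hookE /= /label_rel relabel_eq eqxx orbT; lia.
Qed.

Lemma hookS_prel i p : prel (hook i.+1 p) i i.+1 = false.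
Proof.
have [f ->] := arcs_ofP p.
by rewrite hookE /= /label_rel relabel_eq eqxx /= ifF //; lia.
Qed.

Lemma hook_opU i : hook_op i * hook_op i =
  - (scal al^-1 * scal al^-1 * hook_op i) - scal al * scal al * hook_op i.
Proof.
apply: endoP => F; apply/arcfunP => p.
rewrite add_endoE !opp_endoE !mul_endoE ?arcfunE !opE hook_prel hook_idem.
rewrite mulrCA; move: (_ * F _) => y.
by rewrite /d mulrBl mulNr -exprVn !expr2 -!mulrA addrC.
Qed.

Lemma hook_op_up i : hook_op i * hook_op i.+1 * hook_op i = hook_op i.
Proof.
apply: endoP => F; apply/arcfunP => p.
by rewrite !mul_endoE !opE hook_prelS hookS_prel !mul1r hook_up.
Qed.

Lemma hook_op_down i : hook_op i.+1 * hook_op i * hook_op i.+1 = hook_op i.+1.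
Proof.
apply: endoP => F; apply/arcfunP => p.
by rewrite !mul_endoE !opE hook_prelS hookS_prel !mul1r hook_down.
Qed.

Lemma hook_prelC i j p : (i.+1 < j)%N ->
  (if prel p i i.+1 then d else 1) * (if prel (hook i p) j j.+1 then d else 1) =
  (if prel p j j.+1 then d else 1) * (if prel (hook j p) i i.+1 then d else 1).
Proof.
move=> ij; have [f ->] := arcs_ofP p; rewrite !hookE /= /label_rel !relabel_eq.
have [ji ji1 j1i j1i1] : [/\ j == i = false, j == i.+1 = false,
  j.+1 == i = false & j.+1 == i.+1 = false] by split; lia.
have [ij' ij1 i1j i1j1] : [/\ i == j = false, i == j.+1 = false,
  i.+1 == j = false & i.+1 == j.+1 = false] by split; lia.
rewrite ji ji1 j1i j1i1 ij' ij1 i1j i1j1 /=.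
move: (f i) (f i.+1) (f j) (f j.+1) => A B C D.
repeat (match goal with |- context [?u == ?v] => case: (eqVneq u v) => [?|?]; [subst|] end;
  rewrite ?eqxx ?orbT ?andbT ?orbF ?andbF //=); rewrite ?mulr1 ?mul1r //.
all: by match goal with H : is_true (?u != ?u) |- _ => rewrite eqxx in H end.
Qed.

Lemma hook_opC i j : (i.+1 < j)%N -> hook_op i * hook_op j = hook_op j * hook_op i.
Proof.
move=> ij; apply: endoP => F; apply/arcfunP => p.
by rewrite !mul_endoE !opE !mulrA hook_prelC // (hookC _ ij).
Qed.

Local Notation cross := (tlcross (scal al^-1) (scal al) hook_op).

Lemma state_sum_cross t (Phi : M) N W w st :
  (forall st, wf st -> size (labels st) = N ->
     state_sum t W st = d ^+ nloops st * Phi (pat st)) ->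
  all (fun i => i.+1 < N)%N w -> wf st -> size (labels st) = N ->
  state_sum t ([seq Cross i true | i <- w] ++ W) st =
  d ^+ nloops st * (\prod_(i <- w) cross i) Phi (pat st).
Proof.
move=> PhiE; elim: w st => [|i w IH] st /=; first by rewrite big_nil; move=> _; exact: PhiE.
case/andP=> iN wN wfst sN; have iN' : (i.+1 < size (labels st))%N by rewrite sN.
rewrite !IH ?size_uhoriz //; last exact: wf_uhoriz.
rewrite big_cons mul_endoE add_endoE mul_endoE ?arcfunE !opE.
rewrite pat_uhoriz // nloops_uhoriz // exprD -/(prel (pat st) i i.+1).
move: (\prod_(j <- w) _) => G; rewrite mulrDr [LHS]addrC.
congr (_ + _); first exact: mulrCA.
rewrite -mulrA mulrCA; congr (_ * (_ * (_ * _))).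
by case: (prel _ _ _).
Qed.

(** The value at a pattern is computed from any state that has it, with the loop count reset to 0;
    [state_sum_caps] shows that the choice of state is immaterial. Patterns of no state get the
    value 0. *)
Lemma cap_functional l N : fits (map Cap l) N 0 -> exists Phi : M,
  forall st, wf st -> size (labels st) = N ->
    state_sum (fun k => d ^+ k) (map Cap l) st = d ^+ nloops st * Phi (pat st).
Proof.
move=> fl; pose ex p := exists2 st, size (labels st) = N & pat st = p.
exists (ArcFun (fun p => if pselect (ex p) is left e then
   state_sum (fun k => d ^+ k) (map Cap l) (LState (labels (s2val (cid2 e))) 0 0) else 0)).
move=> st _ sN /=; case: pselect => [e|]; last by case; exists st.
case: (cid2 e) => st' s' p' /=.
have [|||X [-> ->]] := @state_sum_caps l st (LState (labels st') 0 0) 0; rewrite ?sN //.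
by rewrite /= expr0 mul1r.
Qed.

Definition eigen n k := al ^+ (6 * k) * al^-1 ^+ ((n - k.*2) * (n - k.*2).-1).

(** The sequence [g] is annihilated by the product of the operators [shift - l], that is, it
    satisfies the linear recurrence with characteristic roots [ls]. *)
Fixpoint killed (ls : seq K) (g : nat -> K) : Prop :=
  if ls is l :: ls' then killed ls' (fun m => g m.+1 - l * g m) else forall m, g m = 0.

Lemma killedD ls c g c' g' : killed ls g -> killed ls g' -> killed ls (fun m => c * g m + c' * g' m).
Proof.
elim: ls g g' => [|l ls IH] g g' /= kg kg'; first by move=> m; rewrite kg kg' !mulr0 addr0.
have := IH _ _ kg kg'; congr killed; apply/funext => m.
rewrite [c * (_ - _)]mulrBr [c' * (_ - _)]mulrBr addrACA -opprD mulrDr.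
by congr (_ - (_ + _)); exact: mulrCA.
Qed.

Local Notation T n := (twist (scal al^-1) (scal al) hook_op 0 n).

(** Applying [shift - l] to the sequence of the [T ^+ m F] replaces [F] by [(T - l) F], because
    scalars commute with the twist. *)
Lemma killed_twist n r k (F : M) c p :
  twist_ann (scal al^-1) (scal al) hook_op n r k F = 0 ->
  killed [seq eigen n j | j <- iota k r] (fun m => c * (T n ^+ m) F p).
Proof.
elim: r k F => [|r IH] k F.
  move=> F0 m; have {F0} -> : F = 0 by [].
  by rewrite endo_zero mulr0.
rewrite [twist_ann _ _ _ _ _ _](_ : _ = twist_ann (scal al^-1) (scal al) hook_op n r k.+1 *
  (T n - twist_eigen (scal al^-1) (scal al) n k)) // mul_endoE => /IH; congr killed; apply/funext => m.
have scT : scal (eigen n k) * T n ^+ m = T n ^+ m * scal (eigen n k).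
  apply: commrX; have sc e : GRing.comm (scal (eigen n k)) (scal e).
    by rewrite /GRing.comm !scalM mulrC.
  by apply: comm_twist => // i _; exact: scal_hookC.
have -> : twist_eigen (scal al^-1) (scal al) n k = scal (eigen n k).
  by rewrite /twist_eigen !scalX scalM.
rewrite -mul_endoE mulrBr -exprSr -scT add_endoE opp_endoE mul_endoE ?arcfunE opE.
by rewrite mulrBr; congr (_ - _); exact: mulrCA.
Qed.

Lemma prod_flatten_nseq (B : pzRingType) (f : nat -> B) w m :
  \prod_(i <- flatten (nseq m w)) f i = (\prod_(i <- w) f i) ^+ m.
Proof.
elim: m => [|m IH]; first by rewrite big_nil.
by rewrite /= big_cat IH exprS.
Qed.

Lemma map_flatten_nseq (T U : Type) (f : T -> U) w m :
  map f (flatten (nseq m w)) = flatten (nseq m (map f w)).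
Proof. by rewrite map_flatten map_nseq. Qed.

Lemma fits_caps l k : fits (map Cap l) k 0 -> k = (size l).*2.
Proof. by elim: l k => [|i l IH] k /=; [move/eqP | case/andP=> ik /IH; lia]. Qed.

Hypothesis d0 : d != 0.

Lemma twisted_killed (w : seq layer) n : link_diagram (w ++ nested_caps n) ->
  killed [seq eigen n j | j <- iota 0 n./2.+1]
    (fun m => state_sum (fun k => d ^+ k.-1) (twisted w n m) (LState [::] 0 0)).
Proof.
move/fits_run/fits_cat => [N fw fcaps].
have fcaps' : fits (map Cap (rev (iota 0 n))) N 0 by [].
have NE := fits_caps fcaps'; rewrite size_rev size_iota in NE.
case: n NE => [|n] NE in fcaps fcaps' *.
  (* Without strands the family is constant, and the only root is [eigen 0 0 = 1]. *)
  move=> m /=; have W k : twisted w 0 k = w by rewrite /twisted; elim: k => [|k]; rewrite ?cats0.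
  by rewrite !W /eigen muln0 !expr0 !mul1r subrr.
pose v m := flatten (nseq m (flatten (nseq n.+1 (iota 0 n)))).
have WE m : twisted w n.+1 m = w ++ [seq Cross i true | i <- v m] ++ nested_caps n.+1.
  by rewrite /twisted /v !map_flatten_nseq.
have vN m : all (fun i => i.+1 < N)%N (v m).
  apply/allP => i /flattenP[x]; rewrite mem_nseq => /andP[_ /eqP->].
  by move/flattenP=> [y]; rewrite mem_nseq => /andP[_ /eqP->]; rewrite mem_iota NE; lia.
have fits_v m : fits [seq Cross i true | i <- v m] N N.
  by elim: (v m) (vN m) => [|i u IH] //= /andP[-> /IH].
have wf0 : wf (LState [::] 0 0) by [].
have lastE m : state_sum (fun k => d ^+ k.-1) (twisted w n.+1 m) (LState [::] 0 0) =
    d^-1 * state_sum (fun k => d ^+ k) (twisted w n.+1 m) (LState [::] 0 0).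
  have cE : nested_caps n.+1 = [seq Cap i | i <- rev (iota 1 n)] ++ [:: Cap 0].
    by rewrite /nested_caps /= rev_cons map_rcons cats1.
  rewrite WE cE !catA; apply: state_sum_last => //.
    by move=> k; rewrite exprS mulrA mulVf // mul1r.
  rewrite -catA; apply: (cat_fits fw); apply: (cat_fits (fits_v m)).
  move: fcaps; rewrite cE => /fits_cat[k' h /=]; case/andP => k'2.
  by move=> /eqP k'0; have k'E : k' = 2%N by [lia]; rewrite k'E in h.
have [Phi PhiE] := cap_functional fcaps'.
pose g m := state_sum (fun k => d ^+ k) (twisted w n.+1 m) (LState [::] 0 0).
suff Kg : killed [seq eigen n.+1 j | j <- iota 0 n.+1./2.+1] g.
  have := killedD d^-1 0 Kg Kg; congr killed; apply/funext => m.
  by rewrite lastE mul0r addr0.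
have -> : g = fun m => state_sum (fun k => d ^+ k)
    (w ++ [seq Cross i true | i <- v m] ++ nested_caps n.+1) (LState [::] 0 0).
  by apply/funext => m; rewrite /g WE.
apply: (@state_sum_closed (killed _) _ (fun m => [seq Cross i true | i <- v m] ++ nested_caps n.+1) N)
  => // [c h c' h'|st wfst sN]; first exact: killedD.
have ab : scal al^-1 * scal al = 1 by rewrite scalM mulVf // scal1.
have ba : scal al * scal al^-1 = 1 by rewrite scalM mulfV // scal1.
have TE : (\prod_(i <- iota 0 n) cross i) ^+ n.+1 = T n.+1.
  apply: (full_twistE ab ba (scal_hookC _) (scal_hookC _) hook_opU hook_op_up hook_op_down hook_opC n.+1).
have -> : (fun m => state_sum (fun k => d ^+ k) ([seq Cross i true | i <- v m] ++ nested_caps n.+1) st) =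
    (fun m => d ^+ nloops st * (T n.+1 ^+ m) Phi (pat st)).
  by apply/funext => m; rewrite (state_sum_cross PhiE) // prod_flatten_nseq prod_flatten_nseq TE.
apply: killed_twist.
by rewrite (twist_annihilated ab ba (scal_hookC _) (scal_hookC _) hook_opU hook_op_up hook_op_down hook_opC).
Qed.
End StateSum.

(** * The two-variable polynomial of a twist family *)

From mathcomp Require Import ring lra.

Lemma subr_div_identity (F : fieldType) (c x l y : F) : x - l != 0 ->
  c * y - c / (x - l) * (x * y) = - (l * (c / (x - l) * y)).
Proof. by move=> xl; field. Qed.

Section TwoVariables.
Local Notation K := {fraction {poly int}}.
Local Notation "x %:F" := (@FracField.tofrac _ x).
Local Notation al := ('X%:F : K).

Definition lval (f : lpoly) : K := f.1%:F / al ^+ f.2.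

Lemma al_neq0 : al != 0.
Proof. by rewrite tofrac_eq0 polyX_eq0. Qed.

Lemma alX_neq0 k : al ^+ k != 0.
Proof. by rewrite expf_neq0 // al_neq0. Qed.

Lemma lval_add f g : lval (ladd f g) = lval f + lval g.
Proof.
case: f g => [p k] [q l]; rewrite /lval /ladd /=.
have E u r s : (u <= s)%N -> (r * 'X^(s - u))%:F / al ^+ s = r%:F / al ^+ u.
  move=> us; rewrite rmorphM rmorphXn /= -[in al ^+ s](subnK us) exprD invfM mulrA.
  by rewrite mulfK // alX_neq0.
by rewrite rmorphD /= mulrDl !E // ?leq_maxl ?leq_maxr.
Qed.

Lemma lval_mul f g : lval (lmul f g) = lval f * lval g.
Proof. by rewrite /lval /lmul /= rmorphM /= exprD invfM mulrACA. Qed.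

Lemma lval_exp f n : lval (lexp f n) = lval f ^+ n.
Proof.
rewrite /lexp; elim: n => [|n IH]; first by rewrite /lval /= tofrac1 divr1.
by rewrite iterS lval_mul IH exprS.
Qed.

Let d := - al ^+ 2 - al ^- 2.

Lemma lval_loop : lval lloop = d.
Proof.
rewrite /lval /lloop /= rmorphB rmorphN rmorphXn rmorph1 /= /d mulrDl !mulNr mul1r; congr (_ - _).
by congr (- _); rewrite (exprD _ 2 2) mulfK // alX_neq0.
Qed.

Lemma loop_neq0 : d != 0.
Proof.
rewrite -lval_loop /lval mulf_neq0 ?invr_neq0 ?alX_neq0 // tofrac_eq0 /=.
rewrite -opprD oppr_eq0 -size_poly_eq0 size_polyDl ?size_polyXn //.
by rewrite size_poly1.
Qed.

Lemma lval_bracket w st a b : lval (bracket_aux w st a b) =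
  al ^+ a / al ^+ b * state_sum al (fun k => d ^+ k.-1) w st.
Proof.
elim: w st a b => [|l w IH] st a b /=.
  by rewrite lval_mul lval_exp lval_loop /lval /lmono /= rmorphXn.
case: l => [i o|i|i o]; [exact: IH|exact: IH|].
rewrite lval_add !IH mulrDr !exprSr invfM; congr (_ + _); rewrite !mulrA; congr (_ * _).
  by rewrite mulrAC.
Qed.

(** * Solving the recurrence with restricted denominators *)

Section Localization.
Variable UM : {poly int} -> Prop.
Hypothesis UM_neq0 : forall p, UM p -> p != 0.
Hypothesis UMM : forall p q, UM p -> UM q -> UM (p * q).
Hypothesis UMN1 : UM (-1).
Hypothesis UMX : UM 'X.
Hypothesis UMXn1 : forall b, (0 < b)%N -> UM ('X^b - 1).

Let UM1 : UM 1.
Proof. by rewrite -[1]opprK -mulN1r; apply: UMM. Qed.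

Lemma UM_exp p n : UM p -> UM (p ^+ n).
Proof. by move=> h; elim: n => [|n IH]; rewrite ?expr0 // exprS; apply: UMM. Qed.

(** [UM] stands for a multiplicative set of harmless denominators; in the end it consists of the
    nonzero polynomials of Mahler measure 1. *)
Definition localized (x : K) := exists2 D, UM D & exists p : {poly int}, x * D%:F = p%:F.

Lemma localizedD x y : localized x -> localized y -> localized (x + y).
Proof.
move=> [D hD [p hp]] [E hE [q hq]]; exists (D * E); first exact: UMM.
exists (p * E + q * D); rewrite rmorphD !rmorphM /= -hp -hq mulrDl; congr (_ + _).
  by rewrite mulrA.
by rewrite [D%:F * _]mulrC mulrA.
Qed.

Lemma localizedM x y : localized x -> localized y -> localized (x * y).
Proof.
move=> [D hD [p hp]] [E hE [q hq]]; exists (D * E); first exact: UMM.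
by exists (p * q); rewrite !rmorphM /= -hp -hq mulrACA.
Qed.

Lemma localized_poly p : localized p%:F.
Proof. by exists 1 => //; exists p; rewrite tofrac1 mulr1. Qed.

Lemma localizedN x : localized x -> localized (- x).
Proof. by rewrite -mulN1r -tofrac1 -rmorphN; apply/localizedM/localized_poly. Qed.

Lemma localizedV D : UM D -> localized D%:F^-1.
Proof.
move=> hD; exists D => //; exists 1; rewrite tofrac1 mulVf // tofrac_eq0.
exact: UM_neq0.
Qed.

Lemma localized_sum (I : Type) (r : seq I) (F : I -> K) :
  (forall i, localized (F i)) -> localized (\sum_(i <- r) F i).
Proof.
move=> h; elim: r => [|i r IH]; first by rewrite big_nil -tofrac0; exact: localized_poly.
by rewrite big_cons; apply: localizedD.
Qed.

Lemma lval_localized f : localized (lval f).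
Proof.
by apply: localizedM; [exact: localized_poly|rewrite -rmorphXn; apply/localizedV/UM_exp].
Qed.

(** For distinct roots the solution is a combination of geometric sequences. The coefficients stay
    localized because the only divisions are by differences of roots. *)
Lemma killed_solution (ls : seq K) g : uniq ls ->
  (forall l l', l \in ls -> l' \in ls -> l != l' -> localized (l - l')^-1) ->
  (forall l, l \in ls -> localized l) -> (forall m, localized (g m)) -> killed ls g ->
  exists2 c : K -> K, forall l, localized (c l) &
    forall m, g m = \sum_(l <- ls) c l * l ^+ m.
Proof.
elim: ls g => [|l ls IH] g /=.
  by exists (fun=> 0); [rewrite -tofrac0 => _; exact: localized_poly|move=> m; rewrite big_nil].
case/andP => lls uls hV hl hg kg.
have [|||c hc cE] := IH _ uls _ _ _ kg.
- by move=> x y xs ys; apply: hV; rewrite inE ?xs ?ys orbT.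
- by move=> x xs; apply: hl; rewrite inE xs orbT.
- move=> m; apply: localizedD => //; apply/localizedN/localizedM => //.
  by apply: hl; rewrite inE eqxx.
(* A term [c x * x ^+ m] of [g m.+1 - l * g m] comes from the term [c x / (x - l) * x ^+ m] of
   [g m]; what is left over is the geometric sequence [r * l ^+ m]. The default 0 keeps [e]
   localized outside [ls]. *)
pose e x := if x \in ls then c x / (x - l) else 0.
have he x : localized (e x).
  rewrite /e; case: ifP => xs; last by rewrite -tofrac0; exact: localized_poly.
  apply: localizedM => //; apply: hV; rewrite ?inE ?eqxx ?xs ?orbT //.
  by apply: contraNneq lls => <-.
pose r := g 0%N - \sum_(x <- ls) e x.
exists (fun x => if x == l then r else e x).
  move=> x; case: ifP => // _; apply: localizedD => //; apply/localizedN/localized_sum => //.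
have rE m : g m - \sum_(x <- ls) e x * x ^+ m = r * l ^+ m.
  elim: m => [|m IHm].
    by rewrite mulr1 /r; congr (_ - _); apply: eq_bigr => x _; rewrite mulr1.
  rewrite exprS mulrCA -IHm mulrBr mulr_sumr.
  have := cE m; move/(canRL (subrK _)) => ->; rewrite addrAC.
  rewrite [LHS]addrC; congr (_ + _); rewrite -sumrB.
  rewrite -sumrN; rewrite !big_seq; apply: eq_bigr => x xs; rewrite /e xs exprS.
  have xl : x - l != 0 by rewrite subr_eq0; apply: contraNneq lls => <-.
  exact: subr_div_identity.
move=> m; rewrite big_cons eqxx -rE [X in _ = _ + X](_ : _ = \sum_(x <- ls) e x * x ^+ m) ?subrK //.
rewrite !big_seq; apply: eq_bigr => x xs; rewrite ifN //.
by apply: contraNneq lls => <-.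
Qed.

(** The exponent of [eigen al n k] raised by [n * n], which makes it a natural number for every
    [k]. *)
Definition shifted_exponent n k := (n * n + 6 * k - (n - k.*2) * (n - k.*2).-1)%N.

Lemma shifted_exponentP n k : eigen al n k = al ^+ shifted_exponent n k / al ^+ (n * n).
Proof.
rewrite /eigen exprVn; have le : ((n - k.*2) * (n - k.*2).-1 <= n * n)%N by apply: leq_mul; lia.
apply: (mulIf (alX_neq0 ((n - k.*2) * (n - k.*2).-1))).
rewrite mulfVK ?alX_neq0 //; apply: (mulIf (alX_neq0 (n * n))).
rewrite mulrAC mulfVK ?alX_neq0 // -!exprD; congr (_ ^+ _).
by rewrite /shifted_exponent; lia.
Qed.

Lemma shifted_exponent_lt n j k : (j < k)%N -> (k.*2 <= n)%N ->
  (shifted_exponent n j < shifted_exponent n k)%N.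
Proof.
move=> jk kn; rewrite /shifted_exponent.
have h1 : ((n - j.*2) * (n - j.*2).-1 <= n * n)%N by apply: leq_mul; lia.
have h2 : ((n - k.*2) * (n - k.*2).-1 <= (n - j.*2) * (n - j.*2).-1)%N by apply: leq_mul; lia.
lia.
Qed.

Lemma eigen_sub_localized n j k : (j < k)%N -> (k.*2 <= n)%N ->
  eigen al n k != eigen al n j /\ localized (eigen al n k - eigen al n j)^-1.
Proof.
move=> jk kn; have lt := shifted_exponent_lt jk kn.
pose b := (shifted_exponent n k - shifted_exponent n j)%N.
have bpos : (0 < b)%N by rewrite subn_gt0.
have E : eigen al n k - eigen al n j =
    al ^+ shifted_exponent n j * ('X^b - 1)%:F / al ^+ (n * n).
  rewrite !shifted_exponentP -mulrBl; congr (_ / _).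
  rewrite rmorphB rmorph1 rmorphXn /= mulrBr mulr1 -exprD; congr (_ ^+ _ - _).
  by rewrite /b; lia.
split.
  rewrite -subr_eq0 E !mulf_neq0 ?invr_neq0 ?alX_neq0 // tofrac_eq0.
  exact/UM_neq0/UMXn1.
rewrite E !invfM invrK; do !apply: localizedM.
- by rewrite -rmorphXn; apply/localizedV/UM_exp.
- exact/localizedV/UMXn1.
- by rewrite -rmorphXn; exact: localized_poly.
Qed.

Theorem twisted_jones_factor w n : link_diagram (w ++ nested_caps n) ->
  exists Q : {poly {poly int}}, forall m, exists D1 D2, [/\ UM D1, UM D2 &
    (jones (twisted w n m)).1 * D1 = Q.['X^m] * D2].
Proof.
move=> /(twisted_killed al_neq0 loop_neq0).
set ls := [seq _ | _ <- _]; set g := fun m : nat => _ => kg.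
have gE m : g m = lval (kbracket (twisted w n m)).
  by rewrite /kbracket lval_bracket !expr0 divr1 mul1r.
have kn k : k \in iota 0 n./2.+1 -> (k.*2 <= n)%N.
  by rewrite mem_iota => /andP[_]; rewrite add0n ltnS => kn; rewrite -(odd_double_half n); lia.
have eigen_inj : {in iota 0 n./2.+1 &, injective (eigen al n)}.
  move=> i j /kn hi /kn hj e; have [ij|ij|//] := ltngtP i j.
    by have [] := eigen_sub_localized ij hj; rewrite e eqxx.
  by have [] := eigen_sub_localized ij hi; rewrite e eqxx.
have uls : uniq ls by rewrite map_inj_in_uniq ?iota_uniq.
have [|||c hc cE] := killed_solution uls _ _ _ kg.
- move=> _ _ /mapP[i ii ->] /mapP[j jj ->].
  have [ij|ij|->] := ltngtP i j; last by rewrite eqxx.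
    have [_ h] := eigen_sub_localized ij (kn _ jj).
    by move=> _; rewrite -opprB invrN; exact: localizedN.
  by have [_ h] := eigen_sub_localized ij (kn _ ii).
- move=> _ /mapP[i ii ->]; rewrite shifted_exponentP; apply: localizedM.
    by rewrite -rmorphXn; exact: localized_poly.
  by rewrite -rmorphXn; apply/localizedV/UM_exp.
- by move=> m; rewrite gE; exact: lval_localized.
(* A common denominator for the finitely many coefficients. *)
have [D hD [p pE]] : exists2 D, UM D & exists p : K -> {poly int},
    forall x, x \in ls -> c x * D%:F = (p x)%:F.
  elim: (ls) => [|x xs [D hD [p pE]]]; first by exists 1 => //; exists (fun=> 0).
  have [E hE [q qE]] := hc x; exists (D * E); first exact: UMM.
  exists (fun y => if y == x then q * D else p y * E) => y; rewrite inE rmorphM /=.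
  case: eqP => [->|_] /=; first by rewrite rmorphM /= -qE mulrAC mulrA.
  by move=> /pE h; rewrite rmorphM /= -h mulrA.
(* Up to the monomial [X^(n * n * m)], the power [eigen al n k ^+ m] is [y ^+ shifted_exponent n k]
   at [y = X^m]. *)
exists (\sum_(k <- iota 0 n./2.+1) (p (eigen al n k))%:P * 'X^(shifted_exponent n k)) => m.
(* The dependence on [m] other than through [y = X^m] goes into these factors: the shift of the
   exponents on the left, the writhe and the denominator of the bracket on the right. *)
exists (D * 'X^(n * n * m)), ((lwrithe (writhe (twisted w n m))).1 * 'X^((kbracket (twisted w n m)).2)).
split.
- by apply/UMM/UM_exp.
- apply: UMM; last exact: UM_exp.
  case: (writhe _) => k /=; first exact: UM_exp.
  by apply: UMM; exact: UM_exp.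
rewrite /jones /lmul [fst (_, _)]/= -mulrA [RHS]mulrCA; congr (_ * _).
apply/eqP; rewrite -tofrac_eq; apply/eqP; rewrite !rmorphM !rmorphXn /=.
have kE : (kbracket (twisted w n m)).1%:F = g m * al ^+ (kbracket (twisted w n m)).2.
  by rewrite gE /lval mulfVK ?alX_neq0.
rewrite kE mulrAC; congr (_ * _).
rewrite cE big_map horner_sum rmorph_sum mulr_suml /= !big_seq; apply: eq_bigr => k ki.
rewrite hornerM hornerC hornerXn rmorphM !rmorphXn /= -pE; last exact: map_f.
rewrite -[LHS]mulrA [RHS]mulrC [RHS]mulrCA; congr (_ * _).
rewrite mulrCA [RHS]mulrC; congr (_ * _).
by rewrite (exprM _ (n * n)) -exprMn shifted_exponentP mulfVK ?alX_neq0 // -!exprM mulnC.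
Qed.
End Localization.
End TwoVariables.

(** * Integrals of periodic functions *)

Local Open Scope classical_set_scope.
Local Open Scope ring_scope.

Section Integral.
Variable R : realType.
Local Notation mu := (@lebesgue_measure R).
Implicit Types (f g F : R -> R) (a b c s : R).

Lemma continuous_integrable f a b : continuous f -> mu.-integrable `[a, b] (EFin \o f).
Proof.
move=> cf; apply: continuous_compact_integrable; first exact: segment_compact.
exact: continuous_subspaceT.
Qed.

Lemma FTC2_continuous f F a b : a < b -> continuous f ->
  (forall x, a <= x <= b -> is_derive x 1 F (f x)) ->
  \int[mu]_(x in `[a, b]) f x = F b - F a.
Proof.
move=> ab cf dF; rewrite /Rintegral (@continuous_FTC2 _ f F a b ab) //.
- exact: continuous_subspaceT.
- have cF x : a <= x <= b -> {for x, continuous F}.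
    by move=> /dF h; apply: differentiable_continuous; apply/derivable1_diffP; case: h.
  split.
  + by move=> x; rewrite in_itv /= => /andP[ax xb]; have [] := dF x; rewrite ?ltW.
  + by apply: cvg_at_right_filter; apply: cF; rewrite lexx ltW.
  + by apply: cvg_at_left_filter; apply: cF; rewrite lexx ltW.
- by move=> x; rewrite in_itv /= => /andP[ax xb]; rewrite derive1E; have [] := dF x; rewrite ?ltW.
Qed.

Lemma ex_primitive f a : continuous f ->
  exists F, forall x, a < x -> is_derive x 1 F (f x).
Proof.
move=> cf; exists (fun x => \int[mu]_(t in `[a, x]) f t) => x ax.
have [|d e] := @continuous_FTC1_closed _ f a x (x + 1) _ (continuous_integrable _ _ cf) ax (cf x).
  by rewrite ltrDl.
by apply: DeriveDef => //; rewrite -derive1E.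
Qed.

Lemma derive0_eq F a x y : (forall x, a < x -> is_derive x 1 F 0) ->
  a < x -> a < y -> F x = F y.
Proof.
move=> dF; wlog xy : x y / x < y => [h|] ax ay.
  by have [xy|xy|->//] := ltgtP x y; [exact: h|apply/esym/h].
have c0 : continuous (fun _ : R => 0 : R) by move=> z; exact: cvg_cst.
have := FTC2_continuous xy c0; rewrite Rintegral_cst // mul0r => h.
apply/esym/eqP; rewrite -subr_eq0; apply/eqP/esym/h => z /andP[xz _].
by apply: dF; exact: lt_le_trans xz.
Qed.

Lemma integral_affine f F a c s : continuous f -> 0 < c -> a < s ->
  (forall x, a < x -> is_derive x 1 F (f x)) ->
  \int[mu]_(t in `[0, 1]) f (c * t + s) = (F (c + s) - F s) / c.
Proof.
move=> cf c0 as_ dF.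
have caff : continuous (fun t : R => c * t + s).
  by move=> t; apply: cvgD; [apply: cvgM; [exact: cvg_cst|exact: cvg_id]|exact: cvg_cst].
have := @FTC2_continuous (fun t => f (c * t + s)) (fun t => F (c * t + s) / c) 0 1 ltr01.
rewrite mulr1 mulr0 add0r -mulrBl; apply.
  by move=> t; apply: continuous_comp; [exact: caff|exact: cf].
move=> t /andP[t0 t1].
have d1 : is_derive t 1 (fun t : R => c * t + s) c.
  by apply: is_derive_eq; rewrite /GRing.scale /= mulr1 addr0.
have d2 : is_derive (c * t + s) 1 F (f (c * t + s)).
  by apply: dF; rewrite (lt_le_trans as_) // lerDr mulr_ge0 // ltW.
have := is_deriveZ c^-1 (@is_derive1_comp _ F (fun t => c * t + s) t _ _ d2 d1).
rewrite /GRing.scale /= [c^-1 * _]mulrC mulfK ?gt_eqF //.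
by congr is_derive; apply/funext => u; rewrite [LHS]/= [RHS]mulrC.
Qed.

(** For a primitive [F], periodicity makes [F (x + 1) - F x] constant, so the increment of [F] over
    an interval of length [n.+1] is [n.+1] times its increment over a period. *)
Lemma integral_periodic f (n : nat) s : continuous f -> (forall x, f (x + 1) = f x) ->
  \int[mu]_(t in `[0, 1]) f (n.+1%:R * t + s) = \int[mu]_(t in `[0, 1]) f t.
Proof.
(* [ex_primitive] controls the derivative only to the right of its base point, which must therefore
   lie below both [s] and 0. *)
move=> cf f1; pose a := Num.min s 0 - 1.
have as_ : a < s by rewrite /a; have := ge_min s s 0; rewrite lexx /= => h; lra.
have a0 : a < 0 by rewrite /a; have := ge_min 0 s 0; rewrite lexx orbT => h; lra.
have [F dF] := ex_primitive a cf.
rewrite (integral_affine cf _ as_ dF) ?ltr0n //.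
transitivity (\int[mu]_(t in `[0, 1]) f (1 * t + 0)); last first.
  by apply: eq_Rintegral => t _; rewrite mul1r addr0.
rewrite (integral_affine cf _ a0 dF) // addr0 divr1.
have dG x : a < x -> is_derive x 1 (fun x => F (x + 1) - F x) 0.
  move=> ax; have d1 : is_derive x 1 (fun x : R => x + 1) 1.
    by apply: is_derive_eq; rewrite addr0.
  have d2 : is_derive (x + 1) 1 F (f (x + 1)) by apply: dF; lra.
  have d3 := @is_derive1_comp _ F (fun x => x + 1) x _ _ d2 d1.
  by have := is_deriveB d3 (dF _ ax); rewrite mulr1 f1 subrr.
have G0 x : a < x -> F (x + 1) - F x = F 1 - F 0.
  by move=> ax; have := derive0_eq dG ax a0; rewrite add0r.
have S k : F (k%:R + s) - F s = k%:R * (F 1 - F 0).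
  elim: k => [|k IH]; first by rewrite add0r subrr mul0r.
  have := G0 (k%:R + s); rewrite addrAC -natr1 => h.
  have {}h : F (k%:R + 1 + s) - F (k%:R + s) = F 1 - F 0.
    by apply: h; rewrite (lt_le_trans as_) // lerDr.
  lra.
by rewrite S mulrAC mulfV ?mul1r // pnatr_eq0.
Qed.
End Integral.

(** * Fubini and equidistribution on the unit square *)

Section Square.
Variable R : realType.
Local Notation mu := (@lebesgue_measure R).
Local Notation mu2 := ((mu \x mu)%E).
Local Notation I01 := (`[0, 1]%classic : set R).
Local Notation sq := (I01 `*` I01).

Lemma measurable_square : measurable sq.
Proof. by apply: measurableX. Qed.

Lemma mu_I01 : mu I01 = 1%E.
Proof. by rewrite lebesgue_measure_itv /= lte_fin ltr01 oppr0 adde0. Qed.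

Lemma mu_I01_lty : (mu I01 < +oo)%E.
Proof. by rewrite mu_I01 ltry. Qed.

Lemma mu2_square : mu2 sq = 1%E.
Proof. by rewrite product_measure1E //= mu_I01 mule1. Qed.

Lemma bounded_integrable (d : measure_display) (T : measurableType d)
  (m : {measure set T -> \bar R}) (D : set T) (f : T -> R) C :
  measurable D -> (m D < +oo)%E -> measurable_fun D f -> (forall x, D x -> `|f x| <= C) ->
  m.-integrable D (EFin \o f).
Proof.
move=> mD finD mf fC; apply: measurable_bounded_integrable => //.
exists C; split; first exact: num_real.
by move=> M CM x Dx /=; apply: le_trans (fC _ Dx) (ltW CM).
Qed.

Section Fubini.
Variables (H : R * R -> R) (C : R).
Hypotheses (mH : measurable_fun setT H) (HC : forall z, `|H z| <= C).

Lemma square_integrable : mu2.-integrable sq (EFin \o H).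
Proof.
apply: (@bounded_integrable _ _ _ _ _ C) => //; first exact: measurable_square.
- by rewrite [X in (X < _)%E]mu2_square ltry.
- exact: measurable_funTS.
Qed.

Let Hi : mu2.-integrable setT ((EFin \o H) \_ sq).
Proof.
apply/integrable_restrict => //; first exact: measurable_square.
by rewrite setTI; exact: square_integrable.
Qed.

Let mH1 x : measurable_fun setT (fun y => H (x, y)).
Proof. by apply: (measurableT_comp mH (pair1_measurable x)). Qed.

Let mH2 y : measurable_fun setT (fun x => H (x, y)).
Proof. by apply: (measurableT_comp mH (pair2_measurable y)). Qed.

Lemma integral_square12 :
  \int[mu2]_(z in sq) H z = \int[mu]_(t in I01) \int[mu]_(s in I01) H (t, s).
Proof.
rewrite /Rintegral integral_mkcond -integral12_prod_meas1 //; congr fine.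
rewrite [RHS]integral_mkcond; apply: eq_integral => t _.
rewrite /fubini_F /patch; case: ifPn => tI.
  rewrite fineK; last first.
    apply: integrable_fin_num => //; apply: (@bounded_integrable _ _ _ _ _ C) => //.
      exact: mu_I01_lty.
    exact: (measurable_funTS (mH1 t)).
  rewrite [RHS]integral_mkcond; apply: eq_integral => s _; rewrite /patch.
  by rewrite in_setX /= tI.
rewrite integral0_eq // => s _; rewrite in_setX /=.
by rewrite (negPf tI).
Qed.

Lemma integral_square21 :
  \int[mu2]_(z in sq) H z = \int[mu]_(s in I01) \int[mu]_(t in I01) H (t, s).
Proof.
rewrite /Rintegral integral_mkcond -integral21_prod_meas1 //; congr fine.
rewrite [RHS]integral_mkcond; apply: eq_integral => s _.
rewrite /fubini_G /patch; case: ifPn => sI.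
  rewrite fineK; last first.
    apply: integrable_fin_num => //; apply: (@bounded_integrable _ _ _ _ _ C) => //.
      exact: mu_I01_lty.
    exact: (measurable_funTS (mH2 s)).
  rewrite [RHS]integral_mkcond; apply: eq_integral => t _; rewrite /patch.
  by rewrite in_setX /= sI andbT.
rewrite integral0_eq // => t _; rewrite in_setX /=.
by rewrite (negPf sI) andbF.
Qed.
End Fubini.

(* Averaging over the translations [t -> t + s / m] turns the integral along the
   closed geodesic into an integral over the torus, up to the Lipschitz error. *)
Lemma equidistribution (G : R * R -> R) (C L : R) (m : nat) :
  measurable_fun setT G -> continuous G -> (forall z, `|G z| <= C) ->
  (forall t y, G (t + 1, y) = G (t, y)) -> (forall t y, G (t, y + 1) = G (t, y)) ->
  (forall t h y, 0 <= h -> `|G (t + h, y) - G (t, y)| <= L * h) ->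
  `|\int[mu]_(t in I01) G (t, m.+1%:R * t) - \int[mu2]_(z in sq) G z| <= L / m.+1%:R.
Proof.
move=> mG cG GC G1 G2 GL; set M := m.+1%:R.
have M0 : 0 < M :> R by rewrite ltr0n.
have L0 : 0 <= L by have := GL 0 1 0 ler01; rewrite mulr1; apply: le_trans.
pose H z : R := G (z.1 + z.2 / M, M * z.1 + z.2).
pose H' z : R := G (z.1, M * z.1 + z.2).
have mH : measurable_fun setT H.
  apply: measurableT_comp mG _; apply/measurable_fun_pair => /=.
    by apply: measurable_funD => //; apply: measurable_funM.
  by apply: measurable_funD => //; apply: measurable_funM.
have mH' : measurable_fun setT H'.
  apply: measurableT_comp mG _; apply/measurable_fun_pair => //=.
  by apply: measurable_funD => //; apply: measurable_funM.
have HC z : `|H z| <= C by exact: GC.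
have HC' z : `|H' z| <= C by exact: GC.
have GN (k : nat) t y : G (t, y + k%:R) = G (t, y).
  elim: k y => [|k IH] y; first by rewrite addr0.
  by rewrite -natr1 addrA G2 IH.
pose f t := G (t, M * t).
have cf : continuous f.
  move=> t; apply: (@continuous_comp _ _ _ (fun t : R => (t, M * t)) G); last exact: cG.
  by apply: (@cvg_pair _ _ _ (nbhs t) (nbhs t) (nbhs (M * t))); [exact: cvg_id|apply: cvgM; [exact: cvg_cst|exact: cvg_id]].
have f1 t : f (t + 1) = f t by rewrite /f G1 mulrDr mulr1 GN.
have HE : \int[mu2]_(z in sq) H z = \int[mu]_(t in I01) f t.
  rewrite (integral_square21 mH HC).
  transitivity (\int[mu]_(s in I01) (cst (\int[mu]_(t in I01) f t)) s).
    apply: eq_Rintegral => s _; rewrite -(integral_periodic 0 (s / M) cf f1).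
    apply: eq_Rintegral => t _; rewrite /f /H /= mul1r mulrDr [M * (s / M)]mulrC.
    by rewrite mulfVK ?gt_eqF.
  by rewrite Rintegral_cst // [X in fine X]mu_I01 /= mulr1.
have HE' : \int[mu2]_(z in sq) H' z = \int[mu2]_(z in sq) G z.
  rewrite (integral_square12 mH' HC') (integral_square12 mG GC).
  apply: eq_Rintegral => t _.
  have cg : continuous (fun y => G (t, y)).
    move=> y; apply: (@continuous_comp _ _ _ (fun y : R => (t, y)) G); last exact: cG.
    by apply: (@cvg_pair _ _ _ (nbhs y) (nbhs t) (nbhs y)); [exact: cvg_cst|exact: cvg_id].
  rewrite -(integral_periodic 0 (M * t) cg (G2 t)).
  by apply: eq_Rintegral => s _; rewrite /H' /= mul1r addrC.
rewrite -HE -HE' -RintegralB; [|exact: measurable_square|exact: square_integrable HC|exact: square_integrable HC'].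
have HHi : mu2.-integrable sq (EFin \o (fun z => H z - H' z)).
  apply: (@bounded_integrable _ _ _ _ _ (C + C)).
  - exact: measurable_square.
  - by rewrite [X in (X < _)%E]mu2_square ltry.
  - by apply: measurable_funTS; apply: measurable_funB.
  - by move=> z _; apply: le_trans (ler_normB _ _) (lerD (HC z) (HC' z)).
apply: le_trans; first by apply: le_normr_Rintegral HHi; exact: measurable_square.
have -> : L / M = \int[mu2]_(z in sq) cst (L / M) z.
  by rewrite Rintegral_cst; [rewrite [X in fine X]mu2_square /= mulr1|exact: measurable_square].
apply: le_Rintegral.
- exact: measurable_square.
- by have := integrable_norm HHi.
- apply: (@bounded_integrable _ _ _ _ _ `|L / M|) => //.
  + exact: measurable_square.
  + by rewrite [X in (X < _)%E]mu2_square ltry.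
move=> [t s] [/= _]; rewrite in_itv /= => /andP[s0 s1]; rewrite /H /H' /=.
apply: le_trans (GL _ _ _ _) _; first by rewrite divr_ge0 // ltW.
by rewrite ler_wpM2l // ler_piMl // invr_ge0 ltW.
Qed.
End Square.

(** * Sparse trigonometric polynomials *)

Section Variation.
Variable R : realType.
Local Notation mu := (@lebesgue_measure R).

Lemma integral_chasles (f : R -> R) (a b c : R) : continuous f -> a < c -> c < b ->
  \int[mu]_(x in `[a, b]) f x = \int[mu]_(x in `[a, c]) f x + \int[mu]_(x in `[c, b]) f x.
Proof.
move=> cf ac cb; have [F dF] := ex_primitive (a - 1) cf.
have dF' x : a <= x -> is_derive x 1 F (f x) by move=> ax; apply: dF; lra.
have E u v : a <= u -> u < v -> \int[mu]_(x in `[u, v]) f x = F v - F u.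
  move=> au uv; apply: FTC2_continuous => // x /andP[ux _].
  by apply: dF'; exact: le_trans ux.
by rewrite !E ?lexx ?(ltW ac) // ?(lt_trans ac cb) //; ring.
Qed.

Variables (psi dpsi : R -> R) (S : R).
Hypotheses (dpsiE : forall x : R, is_derive x 1 psi (dpsi x)) (cdpsi : continuous dpsi).
Hypothesis psiS : forall x, `|psi x| <= S.

Definition few_zeros (a b : R) (N : nat) := forall s : seq R, uniq s ->
  (forall x, x \in s -> a < x < b /\ dpsi x = 0) -> (size s <= N)%N.

(** By the intermediate value theorem [dpsi] keeps its sign, so the integral is [|psi b - psi a|]. A
    change of sign would give a zero strictly inside the interval, its two witnesses not being zeros
    themselves. *)
Lemma constant_sign_variation a b : a < b -> few_zeros a b 0 ->
  \int[mu]_(x in `[a, b]) `|dpsi x| <= 2 * S.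
Proof.
move=> ab nz.
have nz1 x : a < x < b -> dpsi x != 0.
  move=> xab; apply/negP => /eqP x0; have /= := nz [:: x] isT; rewrite ltn0 => h.
  by apply: notF; apply: h => y; rewrite inE => /eqP ->.
have sgn : (forall x, a <= x <= b -> 0 <= dpsi x) \/ (forall x, a <= x <= b -> dpsi x <= 0).
  apply: contrapT => /not_orP[/existsNP[x /not_implyP[xab /negP x0]] /existsNP[y /not_implyP[yab /negP y0]]].
  rewrite -ltNge in x0; rewrite -ltNge in y0.
  have zero u v : a <= u -> u < v -> v <= b -> dpsi u != 0 -> dpsi v != 0 ->
      Num.min (dpsi u) (dpsi v) <= 0 <= Num.max (dpsi u) (dpsi v) -> False.
    move=> au uv vb u0 v0 /(IVT (ltW uv) (continuous_subspaceT cdpsi)) [c].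
    rewrite in_itv /= => /andP[uc cv] c0.
    have cu : c != u by apply: contra_eq_neq c0 => ->.
    have cv' : c != v by apply: contra_eq_neq c0 => ->.
    have : dpsi c != 0; last by rewrite c0 eqxx.
    apply: nz1; rewrite (le_lt_trans au) ?(lt_le_trans _ vb) // lt_neqAle.
      by rewrite cv' cv.
    by rewrite eq_sym cu uc.
  have x0' : dpsi x != 0 by rewrite lt_eqF.
  have y0' : dpsi y != 0 by rewrite gt_eqF.
  case/andP: xab => ax xb; case/andP: yab => ay yb.
  have [xy|yx|exy] := ltgtP x y.
  - by apply: (zero x y) => //; rewrite ge_min le_max (ltW x0) (ltW y0) /= orbT.
  - by apply: (zero y x) => //; rewrite ge_min le_max (ltW x0) (ltW y0) /= orbT.
  - by move: x0; rewrite exy ltNge (ltW y0).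
have bnd : `|psi b - psi a| <= 2 * S.
  by apply: le_trans (ler_normB _ _) _; have := psiS a; have := psiS b; lra.
have {sgn} [sgn|sgn] := sgn.
  rewrite (@eq_Rintegral _ _ _ mu _ dpsi); last by move=> x; rewrite inE /= in_itv => /sgn /ger0_norm.
  by rewrite (FTC2_continuous ab cdpsi (F := psi)) //; apply: le_trans (ler_norm _) bnd.
rewrite (@eq_Rintegral _ _ _ mu _ (fun x => - dpsi x)); last first.
  by move=> x; rewrite inE /= in_itv => /sgn /ler0_norm.
have cN : continuous (fun x => - dpsi x) by move=> x; apply: cvgN; exact: cdpsi.
rewrite (FTC2_continuous ab cN (F := fun x => - psi x)) //.
by apply: le_trans (ler_norm _) _; rewrite opprK addrC distrC.
Qed.

(** At most [N] zeros cut the interval into at most [N.+1] monotone pieces, each of variation at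
    most [2 * S]. The induction cuts at an arbitrary zero. *)
Lemma variation_bound a b N : a < b -> few_zeros a b N ->
  \int[mu]_(x in `[a, b]) `|dpsi x| <= 2 * S * N.+1%:R.
Proof.
have S0 : 0 <= S by apply: le_trans (psiS 0).
elim/ltn_ind: N a b => N IH a b ab fz.
have [[c [acb c0]]|nc] := pselect (exists c, a < c < b /\ dpsi c = 0); last first.
  have fz0 : few_zeros a b 0.
    move=> [|x s] // _ xs; exfalso; apply: nc; exists x.
    by apply: xs; rewrite inE eqxx.
  apply: le_trans (constant_sign_variation ab fz0) _.
  by rewrite ler_peMr ?mulr_ge0 // ler1n.
case/andP: acb => ac cb.
(* [N1] will be the largest number of zeros to the left of [c]. As [c] is itself a zero, at most
   [N - N1.+1] remain on the right. *)
pose P k := `[< exists s : seq R, [/\ uniq s,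
  (forall x, x \in s -> a < x < c /\ dpsi x = 0) & size s = k] >].
have exP : exists k, P k by exists 0%N; apply/asboolP; exists [::].
have leP k : P k -> (k <= N)%N.
  move=> /asboolP[s [us sE <-]]; apply: fz => // x /sE [/andP[ax xc] x0].
  by rewrite ax (lt_trans xc).
case: (ex_maxnP exP leP) => N1 /asboolP[s1 [us1 s1E sz1]] maxN1.
have fz1 : few_zeros a c N1.
  by move=> s us sE; apply: maxN1; apply/asboolP; exists s.
have cat2 s : uniq s -> (forall x, x \in s -> c < x < b /\ dpsi x = 0) -> (N1 + size s < N)%N.
  move=> us sE; have := fz (c :: s1 ++ s); rewrite /= size_cat sz1; apply.
    rewrite cat_uniq us1 us /= andbT mem_cat negb_or -andbA; apply/and3P; split.
    - by apply/negP => /s1E [/andP[_]]; rewrite ltxx.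
    - by apply/negP => /sE [/andP[]]; rewrite ltxx.
    - apply/hasPn => x /sE [/andP[cx _] _]; apply/negP => /s1E [/andP[_ xc] _].
      by move: (lt_trans cx xc); rewrite ltxx.
  move=> x; rewrite inE mem_cat => /orP[/eqP ->|/orP[/s1E[/andP[ax xc] ->]|/sE[/andP[cx xb] ->]]].
  - by rewrite ac cb.
  - by rewrite ax (lt_trans xc cb).
  - by rewrite xb (lt_trans ac cx).
have N1N : (N1 < N)%N by have := cat2 [::] isT; rewrite addn0; apply.
have fz2 : few_zeros c b (N - N1.+1) by move=> s us sE; rewrite leq_subRL // addSn cat2.
have cn : continuous (fun x => `|dpsi x|).
  by move=> x; apply: cvg_norm; exact: cdpsi.
rewrite (integral_chasles cn ac cb).
apply: le_trans (lerD (IH _ N1N _ _ ac fz1) (IH _ _ _ _ cb fz2)) _; first by lia.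
by rewrite -mulrDr -natrD ler_wpM2l ?mulr_ge0 // ler_nat; lia.
Qed.
End Variation.

(** * Polynomials on the unit circle and their zeros *)

Section Circle.
Variable R : realType.
Local Notation C := (R[i]).
Local Notation toC := (real_complex R).
Local Notation Re := (@complex.Re R).
Local Notation Im := (@complex.Im R).

Definition expi (t : R) : C := Complex (cos (2 * pi * t)) (sin (2 * pi * t)).

Lemma expi0 : expi 0 = 1.
Proof. by rewrite /expi mulr0 cos0 sin0. Qed.

Lemma expiD s t : expi (s + t) = expi s * expi t.
Proof. by rewrite /expi mulrDr cosD sinD; apply/eqP; rewrite eq_complex /= eqxx addrC [_ * cos _]mulrC eqxx. Qed.

Lemma expiX t k : expi t ^+ k = expi (k%:R * t).
Proof.
elim: k => [|k IH]; first by rewrite mul0r expi0.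
by rewrite exprS IH -expiD -natr1 mulrDl mul1r addrC.
Qed.

Lemma expi1 : expi 1 = 1.
Proof. by rewrite /expi mulr1 mulrC mulr_natr cos2pi sin2pi. Qed.

Lemma expiS t : expi (t + 1) = expi t.
Proof. by rewrite expiD expi1 mulr1. Qed.

Lemma expi_conj t : (expi t)^* %C * expi t = 1.
Proof.
have h := cos2Dsin2 (2 * pi * t); apply/eqP; rewrite eq_complex /=.
by rewrite mulNr opprK -!expr2 h eqxx mulNr mulrC subrr eqxx.
Qed.

Lemma expi_neq0 t : expi t != 0.
Proof.
by apply/eqP => h; have := expi_conj t; rewrite h mulr0 => /esym/eqP; rewrite oner_eq0.
Qed.

Lemma expi_inj s t : 0 < s < 1 -> 0 < t < 1 -> expi s = expi t -> s = t.
Proof.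
wlog st : s t / s < t => [h|] s01 t01 e.
  by have [st|ts|//] := ltgtP s t; [exact: h|apply/esym/h].
have : expi (t - s) = 1.
  by apply: (mulfI (expi_neq0 s)); rewrite -expiD mulr1 addrC subrK.
rewrite /expi => -[c _]; exfalso; move: c.
have -> : 2 * pi * (t - s) = pi * (t - s) + pi * (t - s) by ring.
rewrite cosD -!expr2 => c; have := cos2Dsin2 (pi * (t - s)) => h.
have : sin (pi * (t - s)) ^+ 2 = 0 by lra.
move/eqP; rewrite expf_eq0 /= => /eqP s0.
have : 0 < sin (pi * (t - s)).
  apply: sin_gt0_pi; rewrite mulr_gt0 ?pi_gt0 ?subr_gt0 //=.
  by rewrite gtr_pMr ?pi_gt0 //; lra.
by rewrite s0 ltxx.
Qed.

Definition nsq (z : C) : R := Re z ^+ 2 + Im z ^+ 2.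

Lemma nsqM z w : nsq (z * w) = nsq z * nsq w.
Proof. by case: z w => [a b] [c e]; rewrite /nsq /=; ring. Qed.

Lemma nsq_expi t : nsq (expi t) = 1.
Proof. exact: cos2Dsin2. Qed.

Lemma nsq_ge0 z : 0 <= nsq z.
Proof. by rewrite addr_ge0 ?sqr_ge0. Qed.

Lemma ReD (z w : C) : Re (z + w) = Re z + Re w. Proof. by case: z w => [? ?] [? ?]. Qed.
Lemma ImD (z w : C) : Im (z + w) = Im z + Im w. Proof. by case: z w => [? ?] [? ?]. Qed.
Lemma Re_sum (I : Type) (r : seq I) (F : I -> C) : Re (\sum_(i <- r) F i) = \sum_(i <- r) Re (F i).
Proof. by elim: r => [|i r IH]; rewrite ?big_nil // !big_cons ReD IH. Qed.
Lemma Im_sum (I : Type) (r : seq I) (F : I -> C) : Im (\sum_(i <- r) F i) = \sum_(i <- r) Im (F i).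
Proof. by elim: r => [|i r IH]; rewrite ?big_nil // !big_cons ImD IH. Qed.

Definition circ (p : {poly R}) (t : R) : C := (map_poly toC p).[expi t].

Lemma circE N (p : {poly R}) t : (size p <= N)%N -> circ p t = \sum_(k < N) (p`_k)%:C%C * expi (k%:R * t).
Proof.
move=> pN; rewrite /circ (horner_coef_wide _ (leq_trans (size_poly _ _) pN)).
by apply: eq_bigr => k _; rewrite coef_map expiX.
Qed.

Lemma Re_circ N (p : {poly R}) t : (size p <= N)%N ->
  Re (circ p t) = \sum_(k < N) p`_k * cos (2 * pi * k%:R * t).
Proof.
move=> pN; rewrite (circE _ pN) Re_sum; apply: eq_bigr => k _.
by rewrite /= mul0r subr0 !mulrA.
Qed.

Lemma Im_circ N (p : {poly R}) t : (size p <= N)%N ->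
  Im (circ p t) = \sum_(k < N) p`_k * sin (2 * pi * k%:R * t).
Proof.
move=> pN; rewrite (circE _ pN) Im_sum; apply: eq_bigr => k _.
by rewrite /= mul0r addr0 !mulrA.
Qed.

(* On the unit circle [2 Re h = z^-n H] for the polynomial [H = X^n h + rev h]
   of degree at most [2n]. *)
Lemma circ_zeros (h : {poly R}) (n : nat) (sgn : bool) : (size h <= n.+1)%N ->
  let A t := if sgn then Re (circ h t) else Im (circ h t) in
  (forall t, A t = 0) \/
  (forall s : seq R, uniq s -> (forall x, x \in s -> 0 < x < 1 /\ A x = 0) -> (size s <= 2 * n)%N).
Proof.
move=> hn A.
pose e : C := if sgn then 1 else -1.
pose rh := \poly_(i < n.+1) (toC h`_(n - i)).
pose H := 'X^n * map_poly toC h + e *: rh.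
have rhE t : rh.[expi t] = expi t ^+ n * (circ h t)^*%C.
  rewrite horner_poly (circE _ hn) (rmorph_sum (conjc : {rmorphism C -> C})) mulr_sumr (reindex_inj rev_ord_inj).
  apply: eq_bigr => k _; have kn : (k <= n)%N by rewrite -ltnS.
  rewrite [nat_of_ord (rev_ord k)]/= subSS subKn //.
  rewrite [X in _ = _ * X](rmorphM (conjc : {rmorphism C -> C})) [X in _ = _ * (X * _)]conjc_real mulrCA; congr (_ * _).
  apply: (mulIf (expi_neq0 (k%:R * t))); rewrite -[RHS]mulrA expi_conj mulr1.
  by rewrite -expiX -exprD subnK.
have HE t : H.[expi t] = expi t ^+ n * (circ h t + e * (circ h t)^*%C).
  rewrite hornerD hornerM hornerXn hornerZ -/(circ h t) rhE mulrDr.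
  by congr (_ + _); exact: mulrCA.
have HA t : H.[expi t] = expi t ^+ n * (if sgn then 2%:R * (A t)%:C%C else 2%:R * (A t)%:C%C * 'i%C).
  rewrite HE /A /e; case: (sgn); first by rewrite mul1r addcJ.
  by rewrite mulN1r subcJ.
have A0 t : (A t == 0) = (H.[expi t] == 0).
  have ei : 'i%C != 0 :> C by rewrite eq_complex /= oner_eq0 andbF.
  have e2 : 2%:R != 0 :> C by rewrite pnatr_eq0.
  rewrite HA mulf_eq0 (negPf (expf_neq0 _ (expi_neq0 t))) /=.
  case: (sgn); rewrite ?mulf_eq0 ?(negPf e2) ?(negPf ei) ?orbF /=;
    by rewrite eq_complex /= eqxx andbT.
have [H0|Hn0] := eqVneq H 0; first by left => t; apply/eqP; rewrite A0 H0 horner0.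
right=> s us sE; rewrite -(size_map expi) -ltnS.
have Hsz : (size H <= (2 * n).+1)%N.
  apply: leq_trans (size_polyD _ _) _; rewrite geq_max; apply/andP; split.
    apply: leq_trans (size_polyMleq _ _) _; rewrite size_polyXn addSn /=.
    by rewrite mul2n -addnn -addnS leq_add2l; apply: leq_trans hn; exact: size_poly.
  apply: leq_trans (size_scale_leq _ _) _; apply: leq_trans (size_poly _ _) _.
  by rewrite ltnS mul2n -addnn leq_addr.
apply: leq_trans Hsz; apply: max_poly_roots => //.
  apply/allP => y /mapP[x xs ->]; apply/rootP/eqP; rewrite -A0.
  by have [_ ->] := sE x xs.
rewrite map_inj_in_uniq // => x y /sE[x01 _] /sE[y01 _]; exact: expi_inj.
Qed.

End Circle.

(** * A weight that dominates the logarithm *)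

Section Weight.
Variable R : realType.
Local Notation mu := (@lebesgue_measure R).
Implicit Types (eta s u v : R).

(** The power [(eta + s ^+ 2)^(-1/4)]: large enough near 0 to dominate squared logarithms, yet with
    a primitive in [s] that is bounded on bounded sets uniformly in [eta]. *)
Definition weight eta s : R := expR (- (ln (eta + s ^+ 2) / 4)).

Lemma weight_gt0 eta s : 0 < weight eta s.
Proof. exact: expR_gt0. Qed.

(** Compares the logarithm at a value [phi + i psi] with the one at its normalised derivative
    [u + i v]. Up to a constant factor, [v] is the derivative of [phi] and [u] that of [psi], so the
    products with the weights integrate to variations. *)
Lemma log_inequality eta D (phi psi u v : R) : 0 < eta <= 1 -> phi ^+ 2 + psi ^+ 2 <= D ->
  ln (phi ^+ 2 + psi ^+ 2 + eta) ^+ 2 <= ln (D + 1) ^+ 2 +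
    128 * (1 + weight eta phi * `|v| + weight eta psi * `|u|) +
    8 * ln (u ^+ 2 + v ^+ 2 + eta) ^+ 2.
Proof.
move=> /andP[e0 e1] hD; have hp := sqr_ge0 phi; have hq := sqr_ge0 psi; set rho := _ + eta; set kap := u ^+ 2 + v ^+ 2 + eta.
have rho0 : eta <= rho by rewrite lerDr addr_ge0 ?sqr_ge0.
have kap0 : eta <= kap by rewrite lerDr addr_ge0 ?sqr_ge0.
have rhop : 0 < rho by lra.
have kapp : 0 < kap by lra.
have w1 := weight_gt0 eta phi; have w2 := weight_gt0 eta psi.
have a1 : 0 <= weight eta phi * `|v| by rewrite mulr_ge0 // ltW.
have a2 : 0 <= weight eta psi * `|u| by rewrite mulr_ge0 // ltW.
(* Where [rho >= 1] the logarithm is at most [ln (D + 1)]; the weights serve for the small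
   values. *)
have [r1|r1] := leP 1 rho.
  have l0 : 0 <= ln rho by exact: ln_ge0.
  have l1 : ln rho <= ln (D + 1) by rewrite ler_ln ?posrE /rho; lra.
  have : ln rho ^+ 2 <= ln (D + 1) ^+ 2 by rewrite !expr2 ler_pM.
  have := sqr_ge0 (ln kap); lra.
(* Thus [expR y = rho^(-1/4) * kap^(1/2)], and [- ln rho = 4 * y - 2 * ln kap]. With
   [E = expR (y / 2)] one has [y <= 2 * E], and the square of [8 * E + 2 * |ln kap|] is at most
   [128 * E ^+ 2 + 8 * (ln kap) ^+ 2], which is the origin of the constants. *)
pose y := - (ln rho / 4) + ln kap / 2.
pose r := expR (- (ln rho / 4)); pose a := expR (ln kap / 2); pose g := expR (ln eta / 2).
have r0 : 0 < r by exact: expR_gt0.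
have a0 : 0 < a by exact: expR_gt0.
have g0 : 0 < g by exact: expR_gt0.
have a2E : a ^+ 2 = kap by rewrite expr2 -expRD -splitr lnK ?posrE.
have g2E : g ^+ 2 = eta by rewrite expr2 -expRD -splitr lnK ?posrE.
have aug : a <= `|u| + `|v| + g.
  have a0' := ltW a0; have g0' := ltW g0.
  rewrite -ler_sqr ?nnegrE ?addr_ge0 // a2E /kap -g2E.
  have -> : u ^+ 2 = `|u| ^+ 2 by rewrite real_normK ?num_real.
  have -> : v ^+ 2 = `|v| ^+ 2 by rewrite real_normK ?num_real.
  have U0 := normr_ge0 u; have V0 := normr_ge0 v; have G0 := ltW g0.
  rewrite (_ : (`|u| + `|v| + g) ^+ 2 = `|u| ^+ 2 + `|v| ^+ 2 + g ^+ 2 +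
    2 * (`|u| * `|v| + `|u| * g + `|v| * g)); last by ring.
  by rewrite lerDl mulr_ge0 ?addr_ge0 ?mulr_ge0.
have rle z : z ^+ 2 + eta <= rho -> r <= weight eta z.
  move=> zr; rewrite /r /weight ler_expR lerN2 ler_pM2r ?invr_gt0 //.
  by rewrite ler_ln ?posrE // addrC // ltr_pwDr // sqr_ge0.
have r_phi : r <= weight eta phi by apply: rle; rewrite /rho; have := sqr_ge0 psi; lra.
have r_psi : r <= weight eta psi by apply: rle; rewrite /rho; have := sqr_ge0 phi; lra.
have rg : r * g <= 1.
  rewrite /r /g -expRD -[X in _ <= X]expR0 ler_expR.
  have h : ln eta <= ln rho by rewrite ler_ln ?posrE.
  have h1 : ln rho <= 0 by apply: ln_le0; exact: ltW.
  have h2 : ln eta <= 0 by apply: ln_le0.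
  lra.
have X_le : r * a <= 1 + weight eta phi * `|v| + weight eta psi * `|u|.
  apply: (@le_trans _ _ (r * (`|u| + `|v| + g))); first by rewrite ler_wpM2l // ltW.
  have h1 : r * `|v| <= weight eta phi * `|v| by rewrite ler_wpM2r.
  have h2 : r * `|u| <= weight eta psi * `|u| by rewrite ler_wpM2r.
  rewrite !mulrDr; lra.
pose E := expR (y / 2).
have E0 : 0 < E by exact: expR_gt0.
have E2 : E ^+ 2 = r * a by rewrite expr2 -expRD -splitr /y expRD.
have yE : y <= 2 * E.
  by have := expR_ge1Dx (y / 2); rewrite -/E; lra.
have lr : - ln rho = 4 * y - 2 * ln kap by rewrite /y; lra.
have lr0 : ln rho <= 0 by apply: ln_le0; exact: ltW.
have lk : - ln kap <= `|ln kap| by rewrite -normrN ler_norm.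
have lk2 : ln kap ^+ 2 = `|ln kap| ^+ 2 by rewrite real_normK ?num_real.
have b1 : - ln rho <= 8 * E + 2 * `|ln kap| by lra.
have b2 : ln rho ^+ 2 <= (8 * E + 2 * `|ln kap|) ^+ 2.
  by rewrite -[ln rho ^+ 2]sqrrN !expr2 ler_pM //; lra.
have b3 : (8 * E + 2 * `|ln kap|) ^+ 2 <= 128 * E ^+ 2 + 8 * `|ln kap| ^+ 2.
  have := sqr_ge0 (8 * E - 2 * `|ln kap|); rewrite !expr2; nra.
have := sqr_ge0 (ln (D + 1)); rewrite lk2 E2 in b3 *; lra.
Qed.

(** An increasing substitute for a primitive of the weight: its derivative is at least half the
    weight, and it grows at most like [|s|^(1/2)] whatever [eta] is. *)
Definition wprim eta s : R := s * weight eta s.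
Definition dwprim eta s : R := weight eta s * (1 - s ^+ 2 / (2 * (eta + s ^+ 2))).

Lemma is_derive_wprim eta s : 0 < eta -> is_derive s 1 (wprim eta) (dwprim eta s).
Proof.
move=> e0; have p : 0 < eta + s ^+ 2 by rewrite ltr_pwDl // sqr_ge0.
have d1 : is_derive s 1 (fun s : R => eta + s ^+ 2) (2 * s).
  by apply: is_derive_eq; rewrite /GRing.scale /=; ring.
have d2 := @is_derive1_comp _ _ (fun s : R => eta + s ^+ 2) s _ _ (is_derive1_ln p) d1.
have d3 := is_deriveZ (- 4^-1) d2.
have d4 := @is_derive1_comp _ _ _ s _ _ (is_derive_expR _) d3.
have d5 := is_deriveM (is_derive_id s 1) d4.
have wE u : expR (- 4^-1 * ln (eta + u ^+ 2)) = weight eta u.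
  by rewrite /weight mulNr mulrC.
have -> : wprim eta = id * (expR \o - 4^-1 \*: (@ln R \o (fun s0 => eta + s0 ^+ 2))).
  by apply/funext => u; rewrite /wprim -wE.
apply: is_derive_eq; rewrite /GRing.scale /= /GRing.scale /= !wE /dwprim.
by field; rewrite gt_eqF.
Qed.

Lemma dwprim_ge eta s : 0 < eta -> weight eta s <= 2 * dwprim eta s.
Proof.
move=> e0; have p : 0 < eta + s ^+ 2 by rewrite ltr_pwDl // sqr_ge0.
rewrite /dwprim mulrCA ler_pMr ?weight_gt0 //.
have -> : 2 * (1 - s ^+ 2 / (2 * (eta + s ^+ 2))) = 1 + eta / (eta + s ^+ 2).
  by field; rewrite gt_eqF.
by rewrite lerDl divr_ge0 // ltW.
Qed.

Lemma dwprim_gt0 eta s : 0 < eta -> 0 < dwprim eta s.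
Proof. by move=> e0; have := dwprim_ge s e0; have := weight_gt0 eta s; lra. Qed.

Lemma wprim_bound eta s : 0 < eta -> `|wprim eta s| <= 1 + `|s|.
Proof.
move=> e0; rewrite /wprim normrM (gtr0_norm (weight_gt0 _ _)).
have p : 0 < eta + s ^+ 2 by rewrite ltr_pwDl // sqr_ge0.
have [->|s0] := eqVneq s 0; first by rewrite normr0 mul0r addr0.
have sp : 0 < `|s| by rewrite normr_gt0.
have s2 : s ^+ 2 = `|s| ^+ 2 by rewrite real_normK ?num_real.
have h : ln (`|s| ^+ 2) <= ln (eta + s ^+ 2).
  by rewrite ler_ln ?posrE ?exprn_gt0 // s2 lerDr ltW.
rewrite lnXn // mulr2n in h.
have [s1|s1] := leP `|s| 1.
  have l0 : ln `|s| <= 0 by exact: ln_le0.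
  apply: (@le_trans _ _ 1); last by rewrite lerDl.
  rewrite -{1}(lnK (x := `|s|)) ?posrE // /weight -expRD -[leRHS]expR0 ler_expR; lra.
have l0 : 0 <= ln `|s| by apply: ln_ge0; exact: ltW.
apply: (@le_trans _ _ (`|s| * 1)); last by rewrite mulr1 lerDr.
rewrite ler_wpM2l // /weight -[leRHS]expR0 ler_expR; lra.
Qed.

Lemma continuous_weight eta : 0 < eta -> continuous (weight eta).
Proof.
move=> e0 s; have p : 0 < eta + s ^+ 2 by rewrite ltr_pwDl // sqr_ge0.
rewrite /weight; apply: continuous_comp; last exact: continuous_expR.
apply: cvgN; apply: cvgM; last exact: cvg_cst.
apply: continuous_comp; last exact: continuous_ln.
apply: cvgD; first exact: cvg_cst.
exact: exprn_continuous.
Qed.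

Lemma continuous_dwprim eta : 0 < eta -> continuous (dwprim eta).
Proof.
move=> e0 s; have p : 0 < eta + s ^+ 2 by rewrite ltr_pwDl // sqr_ge0.
apply: cvgM; first exact: continuous_weight.
apply: cvgB; first exact: cvg_cst.
apply: cvgM; first exact: exprn_continuous.
apply: cvgV; first by rewrite mulf_neq0 // gt_eqF.
apply: cvgM; first exact: cvg_cst.
apply: cvgD; first exact: cvg_cst.
exact: exprn_continuous.
Qed.

(** The integrand is at most twice [|(wprim eta \o phi)'|]. This composite is bounded by [1 + B] and
    has the same critical points as [phi], so [variation_bound] applies uniformly in [eta]. *)
Lemma weighted_variation eta (phi dphi : R -> R) B n : 0 < eta ->
  (forall x : R, is_derive x 1 phi (dphi x)) -> continuous dphi ->
  (forall x, `|phi x| <= B) ->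
  (forall x, dphi x = 0) \/ few_zeros dphi 0 1 n ->
  \int[mu]_(t in `[0, 1]) (weight eta (phi t) * `|dphi t|) <= 4 * (1 + B) * n.+1%:R.
Proof.
move=> e0 dphiE cdphi phiB; have B0 : 0 <= B by apply: le_trans (phiB 0).
case=> [z|fz].
  rewrite (@eq_Rintegral _ _ _ mu _ (cst 0)); last by move=> t _; rewrite z normr0 mulr0.
  by rewrite Rintegral_cst // mul0r mulr_ge0 // mulr_ge0 // addr_ge0.
have cphi : continuous phi.
  by move=> x; apply: differentiable_continuous; apply/derivable1_diffP; have [] := dphiE x.
pose dpsi t := dwprim eta (phi t) * dphi t.
have dpsiE (x : R) : is_derive x 1 (wprim eta \o phi) (dpsi x).
  by apply: is_derive1_comp; exact: is_derive_wprim.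
have cdpsi : continuous dpsi.
  move=> x; apply: cvgM; last exact: cdphi.
  by apply: continuous_comp; [exact: cphi|exact: continuous_dwprim].
have psiS x : `|(wprim eta \o phi) x| <= 1 + B.
  by apply: le_trans (wprim_bound _ e0) _; rewrite lerD2l.
have fz' : few_zeros dpsi 0 1 n.
  move=> s us sE; apply: fz => // x /sE [x01 /eqP]; rewrite mulf_eq0.
  by rewrite gt_eqF ?dwprim_gt0 //= => /eqP.
have V := variation_bound dpsiE cdpsi psiS ltr01 fz'.
apply: (@le_trans _ _ (\int[mu]_(t in `[0, 1]) (2 * `|dpsi t|))).
  apply: le_Rintegral => //.
  - apply: continuous_integrable => x; apply: cvgM; last by apply: cvg_norm; exact: cdphi.
    by apply: continuous_comp; [exact: cphi|exact: continuous_weight].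
  - apply: continuous_integrable => x; apply: cvgM; first exact: cvg_cst.
    by apply: cvg_norm; exact: cdpsi.
  - move=> t _; rewrite normrM (gtr0_norm (dwprim_gt0 _ e0)) mulrA ler_wpM2r //.
    exact: dwprim_ge.
rewrite RintegralZl //; first by lra.
by apply: continuous_integrable => x; apply: cvg_norm; exact: cdpsi.
Qed.
End Weight.

(** * A uniform bound on logarithms of sparse polynomials *)

Section Lawton.
Variable R : realType.
Local Notation mu := (@lebesgue_measure R).
Local Notation Re := (@complex.Re R).
Local Notation Im := (@complex.Im R).
Implicit Types (p q h : {poly R}) (t eta : R).

Lemma circM p q t : circ (p * q) t = circ p t * circ q t.
Proof. by rewrite /circ rmorphM hornerM. Qed.

Lemma circXn k t : circ 'X^k t = expi (k%:R * t).
Proof. by rewrite /circ map_polyXn hornerXn expiX. Qed.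

(** The Euler operator [z d/dz] divided by the degree. It drops the constant term, keeps the leading
    coefficient and does not increase the [l1norm]. *)
Definition euler p : {poly R} := (size p).-1%:R^-1 *: ('X * p^`()).

Lemma coef_euler p k : (euler p)`_k = k%:R * p`_k / (size p).-1%:R.
Proof.
rewrite coefZ coefXM; case: k => [|k] /=; first by rewrite mul0r mulr0 mul0r.
by rewrite coef_deriv -[p`_k.+1 *+ _]mulr_natl mulrC.
Qed.

Lemma size_euler_le p : (size (euler p) <= size p)%N.
Proof.
apply/leq_sizeP => k pk; rewrite coef_euler.
by rewrite (leq_sizeP _ _ (leqnn (size p))) // mulr0 mul0r.
Qed.

Lemma is_derive_Re_circ p t : (1 < size p)%N ->
  is_derive t 1 (fun t => Re (circ p t)) (- (2 * pi * (size p).-1%:R) * Im (circ (euler p) t)).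
Proof.
move=> sp; have n0 : (size p).-1%:R != 0 :> R by rewrite pnatr_eq0; case: (size p) sp => [|[]].
have -> : (fun t => Re (circ p t)) =
    \sum_(k < size p) (fun t => p`_k * cos (2 * pi * k%:R * t)).
  by apply/funext => u; rewrite (Re_circ _ (leqnn _)) fct_sumE.
rewrite (Im_circ _ (size_euler_le p)) mulr_sumr.
apply: is_derive_sum => k.
have d1 : is_derive t 1 (fun t : R => 2 * pi * k%:R * t) (2 * pi * k%:R).
  by apply: is_derive_eq; rewrite /GRing.scale /= mulr1.
have d2 := @is_derive1_comp _ (@cos R) (fun t : R => 2 * pi * k%:R * t) t _ _ (is_derive_cos _) d1.
have d3 := is_deriveZ p`_k d2.
apply: is_derive_eq; rewrite coef_euler /GRing.scale /=.
by field.
Qed.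

Lemma is_derive_Im_circ p t : (1 < size p)%N ->
  is_derive t 1 (fun t => Im (circ p t)) (2 * pi * (size p).-1%:R * Re (circ (euler p) t)).
Proof.
move=> sp; have n0 : (size p).-1%:R != 0 :> R by rewrite pnatr_eq0; case: (size p) sp => [|[]].
have -> : (fun t => Im (circ p t)) =
    \sum_(k < size p) (fun t => p`_k * sin (2 * pi * k%:R * t)).
  by apply/funext => u; rewrite (Im_circ _ (leqnn _)) fct_sumE.
rewrite (Re_circ _ (size_euler_le p)) mulr_sumr.
apply: is_derive_sum => k.
have d1 : is_derive t 1 (fun t : R => 2 * pi * k%:R * t) (2 * pi * k%:R).
  by apply: is_derive_eq; rewrite /GRing.scale /= mulr1.
have d2 := @is_derive1_comp _ (@sin R) (fun t : R => 2 * pi * k%:R * t) t _ _ (is_derive_sin _) d1.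
have d3 := is_deriveZ p`_k d2.
apply: is_derive_eq; rewrite coef_euler /GRing.scale /=.
by field.
Qed.

Lemma continuous_sumr (T : topologicalType) (I : Type) (r : seq I) (F : I -> T -> R) :
  (forall i, continuous (F i)) -> continuous (fun x => \sum_(i <- r) F i x).
Proof.
move=> cF; elim: r => [|i r IH].
  by under eq_fun do rewrite big_nil; move=> x; exact: cvg_cst.
under eq_fun do rewrite big_cons.
by move=> x; apply: cvgD; [exact: cF|exact: IH].
Qed.

Lemma continuous_Re_circ p : continuous (fun t => Re (circ p t)).
Proof.
move=> t; have -> : (fun t => Re (circ p t)) =
    (fun t => \sum_(k < size p) p`_k * cos (2 * pi * k%:R * t)).
  by apply/funext => u; rewrite (Re_circ _ (leqnn _)).
apply: continuous_sumr => k {}t; apply: cvgM; first exact: cvg_cst.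
apply: continuous_comp; last exact: continuous_cos.
by apply: cvgM; [exact: cvg_cst|exact: cvg_id].
Qed.

Lemma continuous_Im_circ p : continuous (fun t => Im (circ p t)).
Proof.
move=> t; have -> : (fun t => Im (circ p t)) =
    (fun t => \sum_(k < size p) p`_k * sin (2 * pi * k%:R * t)).
  by apply/funext => u; rewrite (Im_circ _ (leqnn _)).
apply: continuous_sumr => k {}t; apply: cvgM; first exact: cvg_cst.
apply: continuous_comp; last exact: continuous_sin.
by apply: cvgM; [exact: cvg_cst|exact: cvg_id].
Qed.

Definition l1norm p : R := \sum_(k < size p) `|p`_k|.

Lemma Re_circ_bound p t : `|Re (circ p t)| <= l1norm p.
Proof.
rewrite (Re_circ _ (leqnn _)); apply: le_trans (ler_norm_sum _ _ _) _.
apply: ler_sum => k _; rewrite normrM ler_piMr // ler_norml.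
by rewrite cos_geN1 cos_le1.
Qed.

Lemma Im_circ_bound p t : `|Im (circ p t)| <= l1norm p.
Proof.
rewrite (Im_circ _ (leqnn _)); apply: le_trans (ler_norm_sum _ _ _) _.
apply: ler_sum => k _; rewrite normrM ler_piMr // ler_norml.
by rewrite sin_geN1 sin_le1.
Qed.

Lemma nsq_circ_bound p t : nsq (circ p t) <= 2 * l1norm p ^+ 2.
Proof.
rewrite /nsq.
have h1 : Re (circ p t) ^+ 2 <= l1norm p ^+ 2.
  by rewrite -(real_normK (num_real (Re _))) !expr2 ler_pM // Re_circ_bound.
have h2 : Im (circ p t) ^+ 2 <= l1norm p ^+ 2.
  by rewrite -(real_normK (num_real (Im _))) !expr2 ler_pM // Im_circ_bound.
lra.
Qed.

Lemma continuous_nsq_circ p : continuous (fun t => nsq (circ p t)).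
Proof.
move=> t; apply: cvgD.
  by apply: (@continuous_comp _ _ _ _ (fun x : R => x ^+ 2));
    [exact: continuous_Re_circ|exact: exprn_continuous].
by apply: (@continuous_comp _ _ _ _ (fun x : R => x ^+ 2));
  [exact: continuous_Im_circ|exact: exprn_continuous].
Qed.

Lemma continuous_ln_sqr (T : topologicalType) (g : T -> R) eta : 0 < eta -> (forall x, 0 <= g x) -> continuous g ->
  continuous (fun x => ln (g x + eta) ^+ 2).
Proof.
move=> e0 g0 cg x.
apply: (@continuous_comp _ _ _ (fun x => ln (g x + eta)) (fun y : R => y ^+ 2));
  last exact: exprn_continuous.
apply: (@continuous_comp _ _ _ (fun x => g x + eta)); last by apply: continuous_ln; rewrite ltr_wpDl.
by apply: cvgD; [exact: cg|exact: cvg_cst].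
Qed.

Lemma integral_affine_comb (M a b c : R) (f g k : R -> R) :
  continuous f -> continuous g -> continuous k ->
  \int[mu]_(t in `[0, 1]) (M + a * f t + b * g t + c * k t) =
  M + a * \int[mu]_(t in `[0, 1]) f t + b * \int[mu]_(t in `[0, 1]) g t +
  c * \int[mu]_(t in `[0, 1]) k t.
Proof.
move=> cf cg ck.
have cZ (e : R) (u : R -> R) : continuous u -> continuous (fun t => e * u t).
  by move=> cu t; apply: cvgM; [exact: cvg_cst|exact: cu].
have cD (u v : R -> R) : continuous u -> continuous v -> continuous (fun t => u t + v t).
  by move=> cu cv t; apply: cvgD; [exact: cu|exact: cv].
have cM : continuous (fun _ : R => M) by move=> t; exact: cvg_cst.
have c1 := cZ a f cf; have c2 := cZ b g cg; have c3 := cZ c k ck.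
have c4 := cD _ _ cM c1; have c5 := cD _ _ c4 c2.
have I (u : R -> R) : continuous u -> mu.-integrable `[0, 1] (EFin \o u).
  exact: continuous_integrable.
rewrite (RintegralD _ (I _ c5) (I _ c3)) // (RintegralD _ (I _ c4) (I _ c2)) //.
rewrite (RintegralD _ (I _ cM) (I _ c1)) //.
rewrite !RintegralZl //; try exact: continuous_integrable.
by rewrite Rintegral_cst // [X in fine X]mu_I01 /= mulr1.
Qed.

Lemma l1norm_ge0 p : 0 <= l1norm p.
Proof. by apply: sumr_ge0. Qed.

Lemma l1norm_euler p : l1norm (euler p) <= l1norm p.
Proof.
have wide : l1norm (euler p) = \sum_(k < size p) `|(euler p)`_k|.
  rewrite /l1norm (big_ord_widen _ (fun k => `|(euler p)`_k|) (size_euler_le p)) big_mkcond.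
  apply: eq_bigr => k _; case: ltnP => // pk.
  by rewrite (leq_sizeP _ _ (leqnn _)) ?normr0.
rewrite wide; apply: ler_sum => k _; rewrite coef_euler !normrM mulrAC ler_piMl //.
rewrite normfV !normr_nat; have [->|n0] := posnP (size p).-1; first by rewrite invr0 mulr0.
rewrite ler_pdivrMr ?ltr0n // mul1r ler_nat.
by case: (size p) k n0 => [|m] k //= _; rewrite -ltnS.
Qed.

Lemma lead_coef_euler p : (1 < size p)%N -> lead_coef (euler p) = lead_coef p.
Proof.
move=> sp; have n0 : (size p).-1%:R != 0 :> R by rewrite pnatr_eq0; case: (size p) sp => [|[]].
have p0 : p != 0 by rewrite -size_poly_gt0 ltnW.
have cE : (euler p)`_(size p).-1 = lead_coef p by rewrite coef_euler mulrAC mulfV // mul1r.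
have sE : size (euler p) = size p.
  apply/eqP; rewrite eqn_leq size_euler_le /=.
  have : ((size p).-1 < size (euler p))%N.
    by rewrite ltnNge; apply/negP => /leq_sizeP/(_ _ (leqnn _)); rewrite cE => /eqP; rewrite lead_coef_eq0 (negPf p0).
  by case: (size p) sp.
by rewrite lead_coefE sE.
Qed.

Lemma ln_sqr_ge1 (x D eta : R) : 1 <= x <= D -> 0 < eta <= 1 -> ln (x + eta) ^+ 2 <= ln (D + 1) ^+ 2.
Proof.
move=> /andP[x1 xD] /andP[e0 e1].
have l0 : 0 <= ln (x + eta) by apply: ln_ge0; lra.
have l1 : ln (x + eta) <= ln (D + 1) by rewrite ler_ln ?posrE; lra.
by rewrite !expr2 ler_pM.
Qed.

(** Integrates [log_inequality] along the circle. The derivatives of the real and imaginary parts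
    carry the factor [c = 2 * pi * n] and have at most [2 * n] zeros, so the degree cancels from the
    bound. *)
Lemma ln_sqr_derivative_step q eta (B : R) : (1 < size q)%N -> 0 < eta <= 1 -> l1norm q <= B ->
  \int[mu]_(t in `[0, 1]) ln (nsq (circ q t) + eta) ^+ 2 <=
  ln (2 * B ^+ 2 + 1) ^+ 2 + 128 + 3072 * (1 + B) +
  8 * \int[mu]_(t in `[0, 1]) ln (nsq (circ (euler q) t) + eta) ^+ 2.
Proof.
move=> sq /andP[e0 e1] qB; set n := (size q).-1.
have n0 : (0 < n)%N by rewrite /n; case: (size q) sq => [|[]].
have B0 : 0 <= B := le_trans (l1norm_ge0 q) qB.
pose c : R := 2 * pi * n%:R.
have c0 : 0 < c by rewrite mulr_gt0 ?ltr0n // mulr_gt0 // pi_gt0.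
pose phi t := Re (circ q t); pose psi t := Im (circ q t).
pose dphi t := - c * Im (circ (euler q) t); pose dpsi t := c * Re (circ (euler q) t).
have dphiE (t : R) : is_derive t 1 phi (dphi t) by exact: is_derive_Re_circ.
have dpsiE (t : R) : is_derive t 1 psi (dpsi t) by exact: is_derive_Im_circ.
have cdphi : continuous dphi.
  by move=> t; apply: cvgM; [exact: cvg_cst|exact: continuous_Im_circ].
have cdpsi : continuous dpsi.
  by move=> t; apply: cvgM; [exact: cvg_cst|exact: continuous_Re_circ].
have phiB t : `|phi t| <= B by apply: le_trans (Re_circ_bound _ _) qB.
have psiB t : `|psi t| <= B by apply: le_trans (Im_circ_bound _ _) qB.
have sE : (size (euler q) <= n.+1)%N.
  by apply: leq_trans (size_euler_le q) _; rewrite /n; case: (size q) sq.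
have cN : - c != 0 by rewrite oppr_eq0 gt_eqF.
have zphi : (forall t, dphi t = 0) \/ few_zeros dphi 0 1 (2 * n).
  have [z|z] := circ_zeros false sE; [left => t|right => s us h].
    by rewrite /dphi z mulr0.
  apply: z => // x /h [x01 /eqP]; rewrite mulf_eq0 (negPf cN) => /eqP; done.
have zpsi : (forall t, dpsi t = 0) \/ few_zeros dpsi 0 1 (2 * n).
  have [z|z] := circ_zeros true sE; [left => t|right => s us h].
    by rewrite /dpsi z mulr0.
  apply: z => // x /h [x01 /eqP]; rewrite mulf_eq0 gt_eqF // => /eqP; done.
have Vphi := weighted_variation e0 dphiE cdphi phiB zphi.
have Vpsi := weighted_variation e0 dpsiE cdpsi psiB zpsi.
have cphi : continuous phi by exact: continuous_Re_circ.
have cpsi : continuous psi by exact: continuous_Im_circ.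
pose f t := weight eta (phi t) * `|dphi t|; pose g t := weight eta (psi t) * `|dpsi t|.
pose k t := ln (nsq (circ (euler q) t) + eta) ^+ 2.
have cf : continuous f.
  move=> t; apply: cvgM; last by apply: cvg_norm; exact: cdphi.
  by apply: continuous_comp; [exact: cphi|exact: continuous_weight].
have cg : continuous g.
  move=> t; apply: cvgM; last by apply: cvg_norm; exact: cdpsi.
  by apply: continuous_comp; [exact: cpsi|exact: continuous_weight].
have ck : continuous k.
  by apply: continuous_ln_sqr => //; [move=> t; exact: nsq_ge0|exact: continuous_nsq_circ].
apply: (@le_trans _ _ (\int[mu]_(t in `[0, 1])
    (ln (2 * B ^+ 2 + 1) ^+ 2 + 128 + 128 / c * f t + 128 / c * g t + 8 * k t))).
  apply: le_Rintegral => //.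
  - apply: continuous_integrable; apply: continuous_ln_sqr => //.
      by move=> t; exact: nsq_ge0.
    exact: continuous_nsq_circ.
  - apply: continuous_integrable => t; apply: cvgD; last by apply: cvgM; [exact: cvg_cst|exact: ck].
    apply: cvgD; last by apply: cvgM; [exact: cvg_cst|exact: cg].
    by apply: cvgD; [exact: cvg_cst|apply: cvgM; [exact: cvg_cst|exact: cf]].
  move=> t _.
  have hD : phi t ^+ 2 + psi t ^+ 2 <= 2 * B ^+ 2.
    apply: le_trans (nsq_circ_bound q t) _; rewrite ler_pM2l // !expr2 ler_pM ?l1norm_ge0 //.
  have e01 : 0 < eta <= 1 by rewrite e0.
  apply: le_trans (log_inequality (Re (circ (euler q) t)) (Im (circ (euler q) t)) e01 hD) _.
  have nc x : `|c * x| = c * `|x| by rewrite normrM gtr0_norm.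
  have nNc x : `|- c * x| = c * `|x| by rewrite mulNr normrN nc.
  rewrite /f /g /k /dphi /dpsi nc nNc /nsq.
  have E (x y : R) : 128 / c * (x * (c * y)) = 128 * (x * y) by field; rewrite gt_eqF.
  by rewrite !E !mulrDr mulr1 !addrA.
rewrite integral_affine_comb //.
(* Here [(2 * n).+1 <= 3 * n <= 3 * c] and [128 * 4 * 3 = 1536]; the real and the imaginary part
   together give 3072. *)
have h3 : 128 / c * (4 * (1 + B) * (2 * n).+1%:R) <= 1536 * (1 + B).
  rewrite mulrAC ler_pdivrMr //.
  have p1 : 1 <= pi :> R by have := @pi_ge2 R; lra.
  have n1 : (2 * n).+1%:R <= 3 * n%:R :> R.
    by rewrite -natrM ler_nat (mulnDl 2 1) mul1n -addn1 leq_add2l.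
  have nn : 0 <= n%:R :> R by [].
  have -> : 1536 * (1 + B) * c = 512 * (1 + B) * (6 * pi * n%:R) by rewrite /c; ring.
  have -> : 128 * (4 * (1 + B) * (2 * n).+1%:R) = 512 * (1 + B) * (2 * n).+1%:R by ring.
  rewrite ler_wpM2l ?mulr_ge0 ?addr_ge0 //; apply: le_trans n1 _.
  by rewrite ler_wpM2r //; lra.
have cc : 0 <= 128 / c by rewrite divr_ge0 // ltW.
have h1 : 128 / c * \int[mu]_(t in `[0, 1]) f t <= 1536 * (1 + B).
  by apply: le_trans h3; rewrite ler_wpM2l.
have h2 : 128 / c * \int[mu]_(t in `[0, 1]) g t <= 1536 * (1 + B).
  by apply: le_trans h3; rewrite ler_wpM2l.
lra.
Qed.

(** The factor [X^n] has modulus 1 on the circle, and the nonzero constant term of the quotient is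
    the monomial that [euler] removes. *)
Lemma low_order_factor p : p != 0 -> exists n, [/\ p = drop_poly n p * 'X^n,
  (drop_poly n p)`_0 != 0, l1norm (drop_poly n p) <= l1norm p &
  lead_coef (drop_poly n p) = lead_coef p].
Proof.
move=> p0; have exn : exists n, p`_n != 0 by exists (size p).-1; rewrite -lead_coefE lead_coef_eq0.
case: (ex_minnP exn) => n pn minn; exists n.
have np : (n < size p)%N by rewrite ltnNge; apply: contraNN pn => /leq_sizeP ->.
have low i : (i < n)%N -> p`_i = 0.
  by move=> lt; apply/eqP; apply: contraTT lt => /minn; rewrite -leqNgt.
have sE : size p = (n + size (drop_poly n p))%N by rewrite size_drop_poly subnKC // ltnW.
have take0 : take_poly n p = 0.
  by apply/polyP => i; rewrite coef_take_poly coef0; case: ifP => // /low.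
split.
- by rewrite -{1}(poly_take_drop n p) take0 add0r.
- by rewrite coef_drop_poly add0n.
- rewrite /l1norm [in leRHS]sE big_split_ord /= -[leLHS]add0r; apply: lerD; first exact: sumr_ge0.
  by apply: ler_sum => i _; rewrite coef_drop_poly addnC.
- rewrite !lead_coefE coef_drop_poly size_drop_poly; congr (_`_ _).
  by case: (size p) np => // m; rewrite ltnS => nm; rewrite subSn //= subnK.
Qed.

(* The derivative of a sum of [k + 1] monomials, after factoring out the lowest
   one, is a sum of [k] monomials with the same leading coefficient; the bound
   does not depend on the exponents. *)
Theorem ln_sqr_sparse_bound (k : nat) (B : R) : exists C : R,
  forall (p : {poly R}) (s : seq nat), (size s <= k)%N -> (forall i, p`_i != 0 -> i \in s) ->
  l1norm p <= B -> 1 <= `|lead_coef p| -> forall eta, 0 < eta <= 1 ->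
  \int[mu]_(t in `[0, 1]) ln (nsq (circ p t) + eta) ^+ 2 <= C.
Proof.
elim: k => [|k [C IH]].
  exists 0 => p s; rewrite leqn0 size_eq0 => /eqP -> ps _ lp; exfalso.
  have : lead_coef p != 0 by rewrite -normr_gt0 (lt_le_trans ltr01 lp).
  by rewrite lead_coefE => /ps.
exists (ln (2 * B ^+ 2 + 1) ^+ 2 + 128 + 3072 * (1 + `|B|) + 8 * `|C|) => p s ss ps pB lp eta e01.
have p0 : p != 0 by rewrite -lead_coef_eq0 -normr_gt0 (lt_le_trans ltr01 lp).
have [n [pE q0 qB lq]] := low_order_factor p0.
move: (drop_poly n p) pE q0 qB lq => q pE q0 qB lq.
have pqt t : nsq (circ p t) = nsq (circ q t) by rewrite pE circM circXn nsqM nsq_expi mulr1.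
under eq_Rintegral do rewrite pqt.
have {}qB := le_trans qB pB; rewrite -lq in lp.
have B0 : 0 <= B := le_trans (l1norm_ge0 q) qB.
have [sq|sq] := leqP (size q) 1.
  have [c cE] : exists c, q = c%:P by exists q`_0; exact: size1_polyC.
  have nE t : nsq (circ q t) = c ^+ 2.
    by rewrite cE /circ map_polyC hornerC /nsq /= expr0n addr0.
  under eq_Rintegral do rewrite nE.
  rewrite Rintegral_cst // [X in fine X]mu_I01 mulr1.
  rewrite cE lead_coefC in lp.
  have c1 : 1 <= c ^+ 2 by rewrite -(real_normK (num_real c)) expr2 -[1]mulr1 ler_pM.
  have cB : c ^+ 2 <= 2 * B ^+ 2.
    rewrite -(nE 0); apply: le_trans (nsq_circ_bound q 0) _.
    by rewrite ler_pM2l // !expr2 ler_pM ?l1norm_ge0.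
  apply: le_trans (@ln_sqr_ge1 _ (2 * B ^+ 2) _ _ e01) _; first by rewrite c1.
  have := normr_ge0 B; have := normr_ge0 C; lra.
apply: le_trans (ln_sqr_derivative_step sq e01 qB) _.
have : \int[mu]_(t in `[0, 1]) ln (nsq (circ (euler q) t) + eta) ^+ 2 <= C.
  apply: (IH _ [seq (i - n)%N | i <- s & i != n]) => //.
  - rewrite size_map size_filter -ltnS; apply: leq_trans ss.
    rewrite -(count_predC (pred1 n) s) -[X in (X < _)%N]add0n ltn_add2r.
    rewrite -has_count has_pred1; apply: ps.
    by rewrite pE coefMXn ltnn subnn.
  - move=> i; rewrite coef_euler => hi.
    have qi : q`_i != 0 by apply: contraNneq hi => ->; rewrite mulr0 mul0r.
    have i0 : i != 0%N by apply: contraNneq hi => ->; rewrite mul0r mul0r.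
    apply/mapP; exists (i + n)%N; last by rewrite addnK.
    rewrite mem_filter; apply/andP; split; first by rewrite -[X in _ != X]add0n eqn_add2r.
    by apply: ps; rewrite pE coefMXn ltnNge leq_addl /= addnK.
  - exact: le_trans (l1norm_euler q) qB.
  - by rewrite lead_coef_euler.
have := ler_norm C; rewrite (ger0_norm B0); lra.
Qed.

End Lawton.

(** * Removing the cut-off of the logarithm *)

Section Cutoff.
Context (d : measure_display) (T : measurableType d) (R : realType).
Variables (m : {measure set T -> \bar R}) (D : set T) (g : T -> R) (G C : R).
Hypotheses (mD : measurable D) (D1 : m D = 1%E).
Hypotheses (mg : measurable_fun setT g) (g0 : forall x, 0 <= g x) (gG : forall x, g x <= G).
Hypothesis gC : forall eta, 0 < eta <= 1 -> \int[m]_(x in D) (ln (g x + eta) ^+ 2) <= C.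

(** For [x >= del] the ratio of the arguments is at most [1 + del]. For [x < del] the first
    logarithm is at most 0 and [- ln (x + eta)] is at least [- ln (del + del ^+ 2)], so it is
    bounded by its square divided by that number. *)
Lemma cutoff_pointwise (del eta x : R) : 0 <= x -> 0 < del <= 2^-1 -> 0 < eta <= del ^+ 2 ->
  0 <= ln (x + del ^+ 2) - ln (x + eta) <= del + ln (x + eta) ^+ 2 / (- ln (del + del ^+ 2)).
Proof.
move=> x0 /andP[d0 d1] /andP[e0 e1].
have d2 : del ^+ 2 <= del / 2 by rewrite expr2 ler_pM2l.
have xe : 0 < x + eta by lra.
have xd : 0 < x + del ^+ 2 by lra.
have L0 : 0 < - ln (del + del ^+ 2).
  by rewrite oppr_gt0; apply: ln_lt0; rewrite addr_gt0 ?exprn_gt0 //=; lra.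
apply/andP; split; first by rewrite subr_ge0 ler_ln ?posrE //; lra.
have [dx|xd'] := leP del x.
  have h : ln (x + del ^+ 2) - ln (x + eta) <= del.
    rewrite -ln_div ?posrE //.
    have -> : (x + del ^+ 2) / (x + eta) = 1 + (del ^+ 2 - eta) / (x + eta).
      by field; rewrite gt_eqF.
    have y0 : 0 <= (del ^+ 2 - eta) / (x + eta) by rewrite divr_ge0 //; lra.
    apply: le_trans (le_ln1Dx _) _; first by lra.
    rewrite ler_pdivrMr // mulrDr.
    have := mulr_gt0 d0 e0; have : del ^+ 2 <= del * x by rewrite expr2 ler_pM2l.
    lra.
  by apply: le_trans h _; rewrite lerDl divr_ge0 ?sqr_ge0 // ltW.
have l1 : ln (x + del ^+ 2) <= 0 by apply: ln_le0; lra.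
have l2 : ln (x + eta) <= ln (del + del ^+ 2) by rewrite ler_ln ?posrE //; lra.
apply: (@le_trans _ _ (- ln (x + eta))); first by lra.
suff : - ln (x + eta) <= ln (x + eta) ^+ 2 / - ln (del + del ^+ 2) by lra.
rewrite ler_pdivlMr //; move: (ln (x + eta)) (ln (del + del ^+ 2)) L0 l2 => u v L0 l2.
by rewrite -sqrrN expr2 ler_wpM2l //; lra.
Qed.

Let mgD (e : R) : measurable_fun setT (fun x => ln (g x + e)).
Proof.
by apply: (measurableT_comp (@measurable_ln R)); apply: measurable_funD => //; exact: measurable_cst.
Qed.

Let bound (e : R) x : 0 < e -> `|ln (g x + e)| <= `|ln e| + `|ln (G + e)|.
Proof.
move=> e0; have h0 := g0 x; have h1 := gG x.
have l1 : ln e <= ln (g x + e) by rewrite ler_ln ?posrE; lra.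
have l2 : ln (g x + e) <= ln (G + e) by rewrite ler_ln ?posrE; lra.
have [lp|ln0] := leP 0 (ln (g x + e)).
  by rewrite ger0_norm //; have := ler_norm (ln (G + e)); have := normr_ge0 (ln e); lra.
rewrite ltr0_norm //; have := ler_norm (- ln e); rewrite normrN; have := normr_ge0 (ln (G + e)); lra.
Qed.

Let finD : (m D < +oo)%E. Proof. by rewrite D1 ltry. Qed.

Lemma ln_shift_integrable (e : R) : 0 < e -> m.-integrable D (EFin \o (fun x => ln (g x + e))).
Proof.
move=> e0; apply: (@bounded_integrable _ _ _ _ _ _ (`|ln e| + `|ln (G + e)|)) => //.
  exact: measurable_funTS.
by move=> x _; exact: bound.
Qed.

Let ln_sqr_integrable (e : R) : 0 < e -> m.-integrable D (EFin \o (fun x => ln (g x + e) ^+ 2)).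
Proof.
move=> e0; apply: (@bounded_integrable _ _ _ _ _ _ ((`|ln e| + `|ln (G + e)|) ^+ 2)) => //.
  by apply: measurable_funTS; apply: measurable_funX.
by move=> x _; rewrite normrX !expr2 ler_pM // bound.
Qed.

Let Z := g @^-1` [set 0].
Let P := g @^-1` `]0, +oo[.

Let mZ : measurable Z. Proof. by rewrite -[Z]setTI; exact: mg. Qed.
Let mP : measurable P. Proof. by rewrite -[P]setTI; apply: mg => //; exact: measurable_itv. Qed.

(** On the zero set the squared logarithm at [eta = expR (- k)] equals [k ^+ 2], so [k ^+ 2] times
    the measure stays below [C] for every [k]. *)
Lemma zero_set_null : m (Z `&` D) = 0%E.
Proof.
have mZD : measurable (Z `&` D) by exact: measurableI.
have fZ : (m (Z `&` D) < +oo)%E by apply: le_lt_trans finD; apply: le_measure; rewrite ?inE //; exact: subIsetr.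
have bnd (k : nat) : k%:R ^+ 2 * fine (m (Z `&` D)) <= C.
  pose eta : R := expR (- k%:R).
  have e01 : 0 < eta <= 1 by rewrite expR_gt0 /= -[leRHS]expR0 ler_expR oppr_le0.
  apply: le_trans (gC e01).
  have -> : k%:R ^+ 2 * fine (m (Z `&` D)) = \int[m]_(x in D) (k%:R ^+ 2 * \1_Z x).
    rewrite RintegralZl // /Rintegral ?integral_indic //.
    apply: (@bounded_integrable _ _ _ _ _ _ 1) => // x _.
    by rewrite indicE; case: (_ \in _); rewrite ?normr1 ?normr0.
  apply: le_Rintegral => //.
  - apply: (@bounded_integrable _ _ _ _ _ _ (k%:R ^+ 2)) => //.
      by apply: measurable_funM => //; exact: measurable_indic.
    move=> x _; rewrite indicE normrM [`|k%:R ^+ 2|]ger0_norm ?sqr_ge0 //.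
    by case: (_ \in _); rewrite ?normr1 ?normr0 ?mulr1 ?mulr0 // sqr_ge0.
  - by apply: ln_sqr_integrable; case/andP: e01.
  move=> x _; rewrite indicE; have [|_] := boolP (x \in Z).
    by rewrite inE /Z /= => ->; rewrite mulr1 add0r expRK sqrrN.
  by rewrite mulr0 sqr_ge0.
have m0 : 0 <= fine (m (Z `&` D)) by exact: fine_ge0.
have fz : fine (m (Z `&` D)) = 0.
  apply/eqP; rewrite eq_le m0 andbT leNgt; apply/negP => mp.
  pose k := (Num.bound (C / fine (m (Z `&` D)))).+1.
  have := bnd k; apply/negP; rewrite -ltNge -ltr_pdivrMr //.
  apply: lt_le_trans (archi_boundP _) _.
    by rewrite divr_ge0 //; apply: le_trans (bnd 0%N); rewrite expr0n mul0r.
  apply: (@le_trans _ _ k%:R); first by rewrite ler_nat /k.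
  by rewrite expr2 ler_peMr // ler1n.
by rewrite -[LHS]fineK ?fz // ge0_fin_numE.
Qed.

Section Limit.
Variable del : R.
Hypothesis d01 : 0 < del <= 2^-1.
Let e := del ^+ 2.
Let e0 : 0 < e. Proof. by case/andP: d01 => h _; rewrite exprn_gt0. Qed.
Let tau := del + C / (- ln (del + del ^+ 2)).
(** The indicator removes the zeros of [g]: there the regularised logarithms diverge, while
    [ln 0 = 0] by convention. With it, [fn] increases to [f] everywhere. *)
Let f x := \1_P x * (ln (g x + e) - ln (g x)).
Let fn (n : nat) x := \1_P x * (ln (g x + e) - ln (g x + e / n.+1%:R)).
Let en n : 0 < e / n.+1%:R <= e.
Proof. by rewrite divr_gt0 //= ler_pdivrMr // ler_peMr ?ler1n // ltW. Qed.

Let fn_bound n x : 0 <= fn n x <= del + ln (g x + e / n.+1%:R) ^+ 2 / (- ln (del + del ^+ 2)).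
Proof.
have /andP[h1 h2] := cutoff_pointwise (g0 x) d01 (en n).
rewrite /fn indicE; case: (_ \in _); first by rewrite mul1r h1.
by rewrite mul0r lexx (le_trans h1 h2).
Qed.

Let mfn n : measurable_fun setT (fn n).
Proof.
by apply: measurable_funM; [exact: measurable_indic|apply: measurable_funB].
Qed.

Let integral_fn n : (\int[m]_(x in D) (fn n x)%:E <= tau%:E)%E.
Proof.
have eta01 : 0 < e / n.+1%:R <= 1.
  case/andP: (en n) => -> h /=; apply: le_trans h _; case/andP: d01 => h1 h2.
  by rewrite /e expr2 -[leRHS]mulr1 ler_pM //; lra.
have L0 : 0 < - ln (del + del ^+ 2).
  case/andP: d01 => h1 h2; rewrite oppr_gt0; apply: ln_lt0.
  have : del ^+ 2 <= del / 2 by rewrite expr2 ler_pM2l.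
  by rewrite addr_gt0 ?exprn_gt0 //=; lra.
case/andP: (eta01) => et0 et1; pose h x := ln (g x + e / n.+1%:R) ^+ 2.
have ih := ln_sqr_integrable et0.
have ic : m.-integrable D (EFin \o (fun=> del)) by apply: (@bounded_integrable _ _ _ _ _ _ `|del|).
pose L := - ln (del + del ^+ 2).
have mh : measurable_fun setT h by apply: measurable_funX.
have ihZ : m.-integrable D (EFin \o (fun x => h x / L)).
  apply: (@bounded_integrable _ _ _ _ _ _ ((`|ln (e / n.+1%:R)| + `|ln (G + e / n.+1%:R)|) ^+ 2 / L)) => //.
    by apply: measurable_funTS; apply: measurable_funM.
  move=> x _; rewrite normrM [`|L^-1|]gtr0_norm ?invr_gt0 // ler_pM2r ?invr_gt0 //.
  by rewrite normrX !expr2 ler_pM // bound.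
have ihD : m.-integrable D (EFin \o (fun x => del + h x / L)).
  by have := integrableD mD ic ihZ; congr integrable.
have ifn : m.-integrable D (EFin \o fn n).
  apply: le_integrable ihD => //; first by apply/measurable_EFinP; exact: (measurable_funTS (mfn n)).
  move=> x _; case/andP: (fn_bound n x) => h1 h2; rewrite /= lee_fin ger0_norm //.
  by apply: le_trans (ler_norm _).
rewrite -[leLHS]fineK; last exact: integrable_fin_num.
rewrite lee_fin; apply: (@le_trans _ _ (\int[m]_(x in D) (del + h x / L))).
  by apply: le_Rintegral => // x _; case/andP: (fn_bound n x).
rewrite RintegralD // RintegralZr // Rintegral_cst // D1 /= mulr1 lerD2l.
by rewrite ler_pM2r ?invr_gt0 //; exact: gC.
Qed.

Let fn_nd x : nondecreasing_seq (fn ^~ x).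
Proof.
move=> a b ab; rewrite /fn indicE; have [xP|_] := boolP (x \in P); last by rewrite !mul0r.
rewrite !mul1r lerD2l lerN2 ler_ln ?posrE; last 2 first.
- by rewrite ltr_wpDl // divr_gt0.
- by rewrite ltr_wpDl // divr_gt0.
by rewrite lerD2l ler_pM2l // lef_pV2 ?posrE // ler_nat.
Qed.

Let fn_cvg x : fn n x @[n --> \oo] --> f x.
Proof.
rewrite /fn /f indicE; have [xP|_] := boolP (x \in P); last first.
  by under eq_fun do rewrite mul0r; rewrite mul0r; exact: cvg_cst.
have gp : 0 < g x by move: xP; rewrite inE /P /= in_itv /= andbT.
apply: cvgM; first exact: cvg_cst.
apply: cvgB; first exact: cvg_cst.
have : ln (g x + y) @[y --> (0 : R)] --> ln (g x + 0).
  apply: (@continuous_comp _ _ _ (fun y : R => g x + y)); last by apply: continuous_ln; rewrite addr0.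
  by apply: cvgD; [exact: cvg_cst|exact: cvg_id].
rewrite addr0 => h.
have h' : e * harmonic n @[n --> \oo] --> e * 0.
  by apply: cvgM; [exact: cvg_cst|exact: cvg_harmonic].
rewrite mulr0 in h'; exact: (cvg_comp _ _ h' h).
Qed.

Let f_ge0 x : 0 <= f x.
Proof.
rewrite /f indicE; have [xP|_] := boolP (x \in P); last by rewrite mul0r.
have gp : 0 < g x by move: xP; rewrite inE /P /= in_itv /= andbT.
by rewrite mul1r subr_ge0 ler_ln ?posrE ?addr_gt0 // lerDl ltW.
Qed.

Let mf : measurable_fun setT f.
Proof.
apply: measurable_funM; first exact: measurable_indic.
by apply: measurable_funB => //; exact: (measurableT_comp (@measurable_ln R)).
Qed.

Let integral_f : (\int[m]_(x in D) (f x)%:E <= tau%:E)%E.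
Proof.
have fE x : (f x)%:E = limn (fun n => (fn n x)%:E).
  by apply/esym/cvg_lim => //; apply: cvg_EFin; [exact/nearW|exact: fn_cvg].
under eq_integral do rewrite fE.
rewrite monotone_convergence //.
- apply: lime_le; last by exact/nearW/integral_fn.
  apply: ereal_nondecreasing_is_cvgn => a b ab; apply: ge0_le_integral => //.
  + by move=> x _; rewrite lee_fin; case/andP: (fn_bound a x).
  + by apply/measurable_EFinP; exact: (measurable_funTS (mfn a)).
  + by apply/measurable_EFinP; exact: (measurable_funTS (mfn b)).
  + by move=> x _; rewrite lee_fin; exact: fn_nd.
- by move=> n; apply/measurable_EFinP; exact: (measurable_funTS (mfn n)).
- by move=> n x _; rewrite lee_fin; case/andP: (fn_bound n x).
- by move=> x _ a b ab; rewrite lee_fin; exact: fn_nd.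
Qed.

Let if_ : m.-integrable D (EFin \o f).
Proof.
have mfD : measurable_fun D (EFin \o f) by apply/measurable_EFinP; exact: (measurable_funTS mf).
apply/integrableP; split => //.
apply: le_lt_trans (ltry tau); apply: le_trans integral_f.
by rewrite le_eqVlt; apply/orP; left; apply/eqP; apply: eq_integral => x _; rewrite /= ger0_norm.
Qed.

Lemma ln_integrable : m.-integrable D (EFin \o (fun x => ln (g x))).
Proof.
have := integrableD mD (integrable_norm (ln_shift_integrable e0)) if_.
apply: le_integrable => //.
  by apply/measurable_EFinP; apply: measurable_funTS; exact: (measurableT_comp (@measurable_ln R)).
move=> x _; rewrite /= lee_fin [leRHS]ger0_norm ?addr_ge0 //.
have [xP|xP] := boolP (x \in P).
  rewrite /f indicE xP mul1r.
  have : 0 <= f x by []; rewrite /f indicE xP mul1r.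
  have := ler_norm (ln (g x + e)); have := ler_norm (- ln (g x + e)); rewrite normrN.
  by have [b0|b0] := leP 0 (ln (g x)); [rewrite (ger0_norm b0)|rewrite (ltr0_norm b0)]; lra.
have gx0 : g x = 0.
  apply/eqP; rewrite eq_le g0 andbT leNgt; apply: contra xP => gp.
  by rewrite inE /P /= in_itv /= gp.
by rewrite gx0 ln0 // normr0 addr_ge0.
Qed.

Theorem log_cutoff :
  0 <= \int[m]_(x in D) ln (g x + del ^+ 2) - \int[m]_(x in D) ln (g x) <=
  del + C / (- ln (del + del ^+ 2)).
Proof.
rewrite -/e -RintegralB //; [|exact: ln_shift_integrable|exact: ln_integrable].
have i1 : m.-integrable D (EFin \o (fun x => ln e * \1_Z x)).
  apply: (@bounded_integrable _ _ _ _ _ _ `|ln e|) => //.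
    by apply: measurable_funTS; apply: measurable_funM => //; exact: measurable_indic.
  move=> x _; rewrite indicE normrM; case: (_ \in _); rewrite ?normr1 ?normr0 ?mulr1 ?mulr0 //.
(* At the zeros of [g] the convention [ln 0 = 0] leaves the value [ln e], which the second term
   supplies and which integrates to 0. *)
have -> : \int[m]_(x in D) (ln (g x + e) - ln (g x)) = \int[m]_(x in D) (f x + ln e * \1_Z x).
  apply: eq_Rintegral => x _; rewrite /f !indicE.
  have [xP|xP] := boolP (x \in P); have [xZ|xZ] := boolP (x \in Z); rewrite ?mul1r ?mulr1 ?mulr0 ?mul0r ?addr0 ?add0r //.
  - by exfalso; move: xP xZ; rewrite !inE /P /Z /= in_itv /= andbT => h h'; rewrite h' ltxx in h.
  - by move: xZ; rewrite inE /Z /= => ->; rewrite add0r (ln0 (lexx 0)) subr0.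
  - exfalso; have := g0 x; rewrite le_eqVlt => /orP[/eqP h|h].
      by move/negP: xZ; apply; rewrite inE /Z /= -h.
    by move/negP: xP; apply; rewrite inE /P /= in_itv /= h.
rewrite RintegralD // RintegralZl //; last first.
  apply: (@bounded_integrable _ _ _ _ _ _ 1) => //.
  by move=> x _; rewrite indicE; case: (_ \in _); rewrite ?normr1 ?normr0.
rewrite [X in ln e * X](_ : _ = 0); last by rewrite /Rintegral integral_indic // zero_set_null.
rewrite mulr0 addr0; apply/andP; split; first by apply: Rintegral_ge0.
rewrite -lee_fin /Rintegral fineK; first exact: integral_f.
exact: integrable_fin_num.
Qed.
End Limit.
End Cutoff.

(** * Mahler measures in one variable *)

Section LogMahler.
Variable R : realType.
Local Notation mu := (@lebesgue_measure R).
Local Notation I01 := (`[0, 1]%classic : set R).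
Implicit Types (p q : {poly R}).

Lemma cutoff_small (C : R) (eps : R) : 0 < eps ->
  exists2 del : R, 0 < del <= 2^-1 & del + C / (- ln (del + del ^+ 2)) < eps.
Proof.
(* With [del = expR (- K) / 2] both [del <= 1 / K] and [- ln (del + del ^+ 2) >= K] hold, so the sum
   is at most [(1 + |C|) / K < eps]. *)
move=> e0; pose K : R := (1 + `|C|) / eps + 1.
have c0 : 0 <= (1 + `|C|) / eps by rewrite divr_ge0 ?addr_ge0 // ltW.
have K0 : 0 < K by rewrite /K; lra.
pose del := expR (- K) / 2.
have x0 := expR_gt0 (- K).
have xK : expR (- K) <= K^-1.
  rewrite expRN lef_pV2 ?posrE ?expR_gt0 //.
  by have := expR_ge1Dx K; lra.
have x1 : expR (- K) <= 1 by rewrite -[leRHS]expR0 ler_expR oppr_le0 ltW.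
have d0 : 0 < del by rewrite divr_gt0.
have d1 : del <= 2^-1 by rewrite /del; lra.
exists del; first by rewrite d0.
have d2 : del ^+ 2 <= del by rewrite expr2 ler_piMl ?ltW //; lra.
have L : K <= - ln (del + del ^+ 2).
  rewrite lerNr -[leRHS]expRK ler_ln ?posrE ?addr_gt0 ?exprn_gt0 ?expR_gt0 //.
  by rewrite /del in d2 *; lra.
apply: (@le_lt_trans _ _ (K^-1 + `|C| / K)).
  apply: lerD; first by rewrite /del; lra.
  apply: (@le_trans _ _ (`|C| / (- ln (del + del ^+ 2)))).
    by rewrite ler_pM2r ?ler_norm // invr_gt0 (lt_le_trans K0 L).
  by rewrite ler_wpM2l // lef_pV2 ?posrE // (lt_le_trans K0 L).
have -> : K^-1 + `|C| / K = (1 + `|C|) / K by rewrite mulrDl mul1r.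
rewrite ltr_pdivrMr // mulrC -ltr_pdivrMr // /K.
lra.
Qed.

(** Twice the logarithm of the Mahler measure, since [nsq] is the squared modulus. *)
Definition log_mahler p : R := \int[mu]_(t in I01) ln (nsq (circ p t)).

Lemma measurable_continuous (f : R -> R) : continuous f -> measurable_fun setT f.
Proof. exact: continuous_measurable_fun. Qed.

Lemma ex_log_bound p : 1 <= `|lead_coef p| -> exists C : R, forall eta, 0 < eta <= 1 ->
  \int[mu]_(t in I01) ln (nsq (circ p t) + eta) ^+ 2 <= C.
Proof.
move=> lp; have [C hC] := ln_sqr_sparse_bound (size p) (l1norm p).
exists C; apply: (hC p (iota 0 (size p))) => //; first by rewrite size_iota.
move=> i; rewrite mem_iota /= add0n; apply: contraNT; rewrite -leqNgt.
by move=> h; rewrite nth_default.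
Qed.

Section OnePolynomial.
Variable p : {poly R}.
Let g t := nsq (circ p t).
Let mg : measurable_fun setT g.
Proof. by apply: measurable_continuous; exact: continuous_nsq_circ. Qed.
Let g0 t : 0 <= g t. Proof. exact: nsq_ge0. Qed.
Let gG t : g t <= 2 * l1norm p ^+ 2. Proof. exact: nsq_circ_bound. Qed.

Lemma circ_log_cutoff (C del : R) : (forall eta, 0 < eta <= 1 ->
    \int[mu]_(t in I01) ln (nsq (circ p t) + eta) ^+ 2 <= C) -> 0 < del <= 2^-1 ->
  0 <= \int[mu]_(t in I01) ln (nsq (circ p t) + del ^+ 2) - log_mahler p <=
  del + C / (- ln (del + del ^+ 2)).
Proof.
by move=> hC hd; apply: (@log_cutoff _ _ R mu I01 g _ C _ _ mg g0 gG hC del hd) => //; exact: mu_I01.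
Qed.

Lemma circ_ln_integrable : 1 <= `|lead_coef p| ->
  mu.-integrable I01 (EFin \o (fun t => ln (nsq (circ p t)))).
Proof.
move=> /ex_log_bound [C hC]; pose del : R := 2^-1.
have hd : 0 < del <= 2^-1 by rewrite lexx andbT invr_gt0.
by apply: (@ln_integrable _ _ R mu I01 g _ C _ _ mg g0 gG hC _ hd) => //; exact: mu_I01.
Qed.

Lemma circ_zero_null : 1 <= `|lead_coef p| -> mu ((g @^-1` [set 0]) `&` I01) = 0%E.
Proof.
by move=> /ex_log_bound [C hC]; apply: (@zero_set_null _ _ R mu I01 g _ C _ _ mg g0 gG hC) => //; exact: mu_I01.
Qed.
End OnePolynomial.

(** The logarithm of the product splits off the zeros of [p] and [q]. At those points the convention
    [ln 0 = 0] can break the identity, but they form a null set. *)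
Lemma log_mahlerM p q : 1 <= `|lead_coef p| -> 1 <= `|lead_coef q| ->
  log_mahler (p * q) = log_mahler p + log_mahler q.
Proof.
move=> lp lq; have lpq : 1 <= `|lead_coef (p * q)|.
  by rewrite lead_coefM normrM -[1]mulr1 ler_pM.
rewrite /log_mahler -RintegralD //; try exact: circ_ln_integrable.
rewrite /Rintegral; congr fine; apply: ae_eq_integral => //.
- by have /integrableP[] := circ_ln_integrable lpq.
- apply/measurable_EFinP; apply: measurable_funD.
    by have /integrableP[/measurable_EFinP] := circ_ln_integrable lp.
  by have /integrableP[/measurable_EFinP] := circ_ln_integrable lq.
pose N r := ((fun t => nsq (circ r t)) @^-1` [set 0]) `&` I01.
have mN r : measurable (N r : set (measurableTypeR R)).
  apply: measurableI => //; rewrite -[X in measurable X]setTI.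
  by apply: measurable_continuous => //; exact: continuous_nsq_circ.
exists (N p `|` N q); split.
- by apply: measurableU; exact: mN.
- apply/eqP; rewrite eq_le measure_ge0 andbT.
  apply: le_trans (measureU2 _ _ _) _ => //.
  by rewrite [X in (X + _ <= _)%E](circ_zero_null lp) [X in (_ + X <= _)%E](circ_zero_null lq) adde0.
move=> t /= /not_implyP[tI ne]; apply: contrapT => nN; apply: ne.
have pos r : ~ N r t -> 0 < nsq (circ r t).
  by move=> h; rewrite lt_neqAle nsq_ge0 andbT eq_sym; apply/eqP => e0; apply: h; split.
have p0 : 0 < nsq (circ p t) by apply: pos => h; apply: nN; left.
have q0 : 0 < nsq (circ q t) by apply: pos => h; apply: nN; right.
by rewrite circM nsqM lnM ?posrE.
Qed.

(** The substitution rule [integral_periodic] is for continuous functions, so it is applied to the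
    logarithms cut off at [del]; the error on both sides is then made smaller than any supposed
    difference. *)
Lemma log_mahler_affine p q (n : nat) (s : R) : 1 <= `|lead_coef p| -> 1 <= `|lead_coef q| ->
  (forall t, nsq (circ p t) = nsq (circ q (n.+1%:R * t + s))) ->
  log_mahler p = log_mahler q.
Proof.
move=> /ex_log_bound[C hC] /ex_log_bound[C' hC'] pq; apply/eqP; rewrite -subr_eq0.
apply/negPn/negP => ne; have e0 : 0 < `|log_mahler p - log_mahler q| by rewrite normr_gt0.
have [del hd] := cutoff_small (Num.max C C') e0.
have L0 : 0 < - ln (del + del ^+ 2).
  case/andP: hd => h1 h2; rewrite oppr_gt0; apply: ln_lt0.
  have : del ^+ 2 <= del / 2 by rewrite expr2 ler_pM2l.
  by rewrite addr_gt0 ?exprn_gt0 //=; lra.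
set tau := _ + _ => tau_lt.
have tauC (c : R) : c <= Num.max C C' -> del + c / (- ln (del + del ^+ 2)) <= tau.
  by move=> h; rewrite lerD2l ler_pM2r ?invr_gt0.
have /andP[a1 a2] := circ_log_cutoff hC hd; have /andP[b1 b2] := circ_log_cutoff hC' hd.
have := tauC C; rewrite le_max lexx => /(_ isT) t1.
have := tauC C'; rewrite le_max lexx orbT => /(_ isT) t2.
have E : \int[mu]_(t in I01) ln (nsq (circ p t) + del ^+ 2) =
         \int[mu]_(t in I01) ln (nsq (circ q t) + del ^+ 2).
  under eq_Rintegral do rewrite pq.
  apply: (@integral_periodic _ (fun t => ln (nsq (circ q t) + del ^+ 2))).
    move=> t; apply: (@continuous_comp _ _ _ (fun t => nsq (circ q t) + del ^+ 2)).
      by apply: cvgD; [exact: continuous_nsq_circ|exact: cvg_cst].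
    by apply: continuous_ln; rewrite ltr_wpDl ?nsq_ge0 ?exprn_gt0 //; case/andP: hd.
  by move=> t; rewrite /circ expiS.
move: tau_lt; apply/negP; rewrite -leNgt ler_norml; rewrite E in a1 a2.
apply/andP; split; lra.
Qed.

(** Dilations of the circle give every [X^k - 1] the value of [X - 1], and a half turn gives it to
    [X + 1]. The factorisation of [X^2 - 1] then says that this value is twice itself. *)
Lemma log_mahlerXn1 b : log_mahler ('X^(b.+1) - 1) = 0.
Proof.
have lead (c : R) k : `|c| = 1 -> `|lead_coef ('X^(k.+1) + c%:P)| = 1.
  by move=> _; rewrite lead_coefDl ?lead_coefXn ?normr1 // size_polyXn size_polyC; case: (c != 0).
have l1 k : 1 <= `|lead_coef ('X^(k.+1) - 1 : {poly R})|.
  by rewrite -polyC1 -polyCN lead ?lexx // normrN normr1.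
have l2 : 1 <= `|lead_coef ('X^1 + 1 : {poly R})| by rewrite -polyC1 lead ?lexx // normr1.
have c1 k t : circ ('X^(k.+1) - 1 : {poly R}) t = expi (k.+1%:R * t) - 1.
  by rewrite /circ rmorphB rmorph1 /= map_polyXn hornerD hornerN hornerC hornerXn expiX.
have scale k : log_mahler ('X^(k.+1) - 1) = log_mahler ('X^1 - 1).
  by apply: (@log_mahler_affine _ _ k 0) => // t; rewrite !c1 addr0 mul1r.
have shift : log_mahler ('X^1 + 1) = log_mahler ('X^1 - 1).
  apply: (@log_mahler_affine _ _ 0%N 2^-1) => // t.
  rewrite c1 /circ rmorphD rmorph1 /= map_polyX !hornerE expiD.
  have -> : expi (2^-1 : R) = -1.
    by rewrite /expi (_ : 2 * pi * 2^-1 = pi) ?cospi ?sinpi ?(complexr0, rmorphN1) //; field.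
  have nsqN (z : R[i]) : nsq (- z) = nsq z by case: z => x y; rewrite /nsq /= !sqrrN.
  by rewrite mulrN1 -opprD nsqN.
have : log_mahler ('X^2 - 1) = log_mahler ('X^1 - 1) + log_mahler ('X^1 + 1).
  by rewrite -log_mahlerM //; congr log_mahler; ring.
rewrite scale shift => h; rewrite scale; lra.
Qed.

End LogMahler.

(** * Functions on the torus *)

Section Torus.
Variable R : realType.
Local Notation mu := (@lebesgue_measure R).
Local Notation mu2 := ((mu \x mu)%E).
Local Notation I01 := (`[0, 1]%classic : set R).
Local Notation sq := (I01 `*` I01).
Implicit Types f g : R * R -> R.

(** The Lipschitz condition concerns the first variable, because [equidistribution] compares values
    at points that differ only there. *)
Record torus_fun f : Prop := TorusFun {
  torus_measurable : measurable_fun setT f;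
  torus_continuous : continuous f;
  torus_bounded : exists C, forall z, `|f z| <= C;
  torus_lipschitz : exists L, forall t h y, 0 <= h -> `|f (t + h, y) - f (t, y)| <= L * h;
  torus_period1 : forall t y, f (t + 1, y) = f (t, y);
  torus_period2 : forall t y, f (t, y + 1) = f (t, y) }.

Lemma torus_cst c : torus_fun (fun=> c).
Proof.
split => //.
- by move=> z; exact: cvg_cst.
- by exists `|c|.
- by exists 0 => *; rewrite subrr normr0 mul0r.
Qed.

Lemma torusD f g : torus_fun f -> torus_fun g -> torus_fun (fun z => f z + g z).
Proof.
move=> [mf cf [C fC] [L fL] f1 f2] [mg cg [C' gC] [L' gL] g1 g2]; split.
- exact: measurable_funD.
- by move=> z; apply: cvgD; [exact: cf|exact: cg].
- by exists (C + C') => z; apply: le_trans (ler_normD _ _) (lerD (fC z) (gC z)).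
- exists (L + L') => t h y h0; rewrite opprD addrACA mulrDl.
  by apply: le_trans (ler_normD _ _) (lerD (fL _ _ _ h0) (gL _ _ _ h0)).
- by move=> t y; rewrite f1 g1.
- by move=> t y; rewrite f2 g2.
Qed.

Lemma torusM f g : torus_fun f -> torus_fun g -> torus_fun (fun z => f z * g z).
Proof.
move=> [mf cf [C fC] [L fL] f1 f2] [mg cg [C' gC] [L' gL] g1 g2]; split.
- exact: measurable_funM.
- by move=> z; apply: cvgM; [exact: cf|exact: cg].
- by exists (C * C') => z; rewrite normrM ler_pM.
- exists (C * L' + L * C') => t h y h0.
  have -> : f (t + h, y) * g (t + h, y) - f (t, y) * g (t, y) =
    f (t + h, y) * (g (t + h, y) - g (t, y)) + (f (t + h, y) - f (t, y)) * g (t, y) by ring.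
  apply: (le_trans (ler_normD _ _)); rewrite [leRHS]mulrDl; apply: lerD; rewrite normrM.
    by rewrite -mulrA ler_pM // gL.
  by rewrite mulrAC ler_pM // fL.
- by move=> t y; rewrite f1 g1.
- by move=> t y; rewrite f2 g2.
Qed.

Lemma torus_sum (I : Type) (r : seq I) (F : I -> R * R -> R) :
  (forall i, torus_fun (F i)) -> torus_fun (fun z => \sum_(i <- r) F i z).
Proof.
move=> tF; elim: r => [|i r IH].
  by under eq_fun do rewrite big_nil; exact: torus_cst.
by under eq_fun do rewrite big_cons; exact: torusD.
Qed.

Lemma lipschitz_of_derive (u du : R -> R) : (forall x : R, is_derive x 1 u (du x)) ->
  (forall x, `|du x| <= 1) -> forall x y, `|u x - u y| <= `|x - y|.
Proof.
move=> dudx du1 x y; wlog xy : x y / y < x => [h|].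
  have [xy|xy|->] := ltgtP x y; [|exact: h|by rewrite !subrr].
  by rewrite distrC [`|x - y|]distrC; exact: h.
have [c _ ->] := MVT xy (fun z _ => dudx z)
  (continuous_subspaceT (fun z => differentiable_continuous (iffLR (derivable1_diffP _ _) (@ex_derive _ _ _ _ _ _ _ (dudx z))))).
by rewrite normrM ler_piMl.
Qed.

Lemma torus_wave (u du : R -> R) (k j : nat) : (forall x : R, is_derive x 1 u (du x)) ->
  (forall x, `|du x| <= 1) -> (forall x, `|u x| <= 1) -> (forall x, u (x + 2 * pi) = u x) ->
  torus_fun (fun z => u (2 * pi * (k%:R * z.1 + j%:R * z.2))).
Proof.
move=> dudx du1 u1 u2pi.
have cu : continuous u.
  by move=> x; apply: differentiable_continuous; apply/derivable1_diffP; have [] := dudx x.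
have uN (n : nat) x : u (x + 2 * pi * n%:R) = u x.
  elim: n => [|n IH]; first by rewrite mulr0 addr0.
  by rewrite -[n.+1%:R]natr1 mulrDr mulr1 addrA u2pi.
have pi0 := @pi_gt0 R; split.
- apply: (measurableT_comp (measurable_continuous cu)).
  apply: measurable_funM => //; apply: measurable_funD; apply: measurable_funM => //.
- move=> z; apply: (@continuous_comp _ _ _ (fun z : R * R => 2 * pi * (k%:R * z.1 + j%:R * z.2)) u); last exact: cu.
  apply: cvgM; first exact: cvg_cst.
  by apply: cvgD; (apply: cvgM; first exact: cvg_cst); [exact: cvg_fst|exact: cvg_snd].
- by exists 1.
- exists (2 * pi * k%:R) => t h y h0 /=.
  apply: le_trans (lipschitz_of_derive dudx du1 _ _) _.
  rewrite (_ : _ - _ = 2 * pi * k%:R * h); last by ring.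
  by rewrite ger0_norm // !mulr_ge0 // ltW.
- by move=> t y /=; rewrite -[RHS](uN k); congr u; ring.
- by move=> t y /=; rewrite -[RHS](uN j); congr u; ring.
Qed.

(** On arguments at least [eps] the logarithm is Lipschitz with constant [1 / eps]. *)
Lemma torus_ln f eps : 0 < eps -> (forall z, 0 <= f z) -> torus_fun f ->
  torus_fun (fun z => ln (f z + eps)).
Proof.
move=> e0 f0 [mf cf [C fC] [L fL] f1 f2].
have p z : 0 < f z + eps by rewrite ltr_wpDl.
split.
- by apply: (measurableT_comp (@measurable_ln R)); exact: measurable_funD.
- move=> z; apply: (@continuous_comp _ _ _ (fun z => f z + eps)); last exact: continuous_ln.
  by apply: cvgD; [exact: cf|exact: cvg_cst].
- exists (`|ln eps| + `|ln (C + eps)|) => z.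
  have fz : f z <= C by apply: le_trans (ler_norm _) (fC z).
  have fz0 := f0 z.
  have l1 : ln eps <= ln (f z + eps) by rewrite ler_ln ?posrE; lra.
  have l2 : ln (f z + eps) <= ln (C + eps) by rewrite ler_ln ?posrE; lra.
  have := ler_norm (ln (C + eps)); have := ler_norm (- ln eps); rewrite normrN.
  have := normr_ge0 (ln eps); have := normr_ge0 (ln (C + eps)).
  by have [b0|b0] := leP 0 (ln (f z + eps)); [rewrite (ger0_norm b0)|rewrite (ltr0_norm b0)]; lra.
- exists (L / eps) => t h y h0.
  have lnL (a b : R) : 0 <= a -> 0 <= b -> ln (a + eps) - ln (b + eps) <= `|a - b| / eps.
    move=> a0 b0; rewrite -ln_div ?posrE; [|lra..].
    have -> : (a + eps) / (b + eps) = 1 + (a - b) / (b + eps) by field; rewrite gt_eqF //; lra.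
    have bp : 0 < b + eps by lra.
    apply: le_trans (le_ln1Dx _) _.
      by rewrite ltr_pdivlMr //; lra.
    apply: (@le_trans _ _ (`|a - b| / (b + eps))).
      by rewrite ler_pM2r ?invr_gt0 // ler_norm.
    by rewrite ler_wpM2l // lef_pV2 ?posrE //; lra.
  have fh := fL t h y h0.
  have lip : `|ln (f (t + h, y) + eps) - ln (f (t, y) + eps)| <= `|f (t + h, y) - f (t, y)| / eps.
    by rewrite ler_norml lerNl opprB distrC lnL // distrC lnL.
  by apply: le_trans lip _; rewrite mulrAC ler_pM2r ?invr_gt0.
- by move=> t y; rewrite f1.
- by move=> t y; rewrite f2.
Qed.

Lemma torus_equidistribution f : torus_fun f -> exists L : R, forall m : nat,
  `|\int[mu]_(t in I01) f (t, m.+1%:R * t) - \int[mu2]_(z in sq) f z| <= L / m.+1%:R.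
Proof.
move=> [mf cf [C fC] [L fL] f1 f2]; exists L => m.
exact: equidistribution fL.
Qed.

End Torus.

(** * The limit of logarithmic integrals along closed geodesics *)

Section TorusLimit.
Variable R : realType.
Local Notation mu := (@lebesgue_measure R).
Local Notation mu2 := ((mu \x mu)%E).
Local Notation I01 := (`[0, 1]%classic : set R).
Local Notation sq := (I01 `*` I01).

Section LogLimit.
Variables (f : R * R -> R) (C : R) (M0 : nat).
Hypotheses (tf : torus_fun f) (f0 : forall z, 0 <= f z).
Hypothesis fC : forall m, (M0 <= m)%N -> forall eta : R, 0 < eta <= 1 ->
  \int[mu]_(t in I01) ln (f (t, m%:R * t) + eta) ^+ 2 <= C.

Lemma torus_line_measurable (m : nat) : measurable_fun setT (fun t : R => f (t, m%:R * t)).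
Proof.
apply: measurable_continuous => t.
apply: (@continuous_comp _ _ _ (fun t : R => (t, m%:R * t)) f); last exact: torus_continuous.
apply: (@cvg_pair _ _ _ (nbhs t) (nbhs t) (nbhs (m%:R * t))); first exact: cvg_id.
by apply: cvgM; [exact: cvg_cst|exact: cvg_id].
Qed.

(** For fixed [eta] the squared logarithm is itself a [torus_fun], so its integral over the torus is
    a limit of integrals along lines and inherits their bound [C]. *)
Lemma torus_ln_sqr_bound (eta : R) : 0 < eta <= 1 -> \int[mu2]_(z in sq) ln (f z + eta) ^+ 2 <= C.
Proof.
move=> he; have e0 : 0 < eta by case/andP: he.
have tl := torus_ln e0 f0 tf; have [L hL] := torus_equidistribution (torusM tl tl).
apply/ler_addgt0Pr => eps eps0.
have LE : 0 <= `|L| / eps by rewrite divr_ge0 // ltW.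
have := archi_boundP LE; set k := Num.bound _ => hk.
have := hL (maxn M0 k); rewrite ler_norml => /andP[+ _].
have := fC (leqW (leq_maxl M0 k)) he.
under [X in _ <= _ - X -> _]eq_Rintegral do rewrite -expr2.
under [X in _ <= X - _ -> _]eq_Rintegral do rewrite -expr2.
move=> h1 h2.
have lin (a b c l : R) : a <= c -> - l <= a - b -> l <= eps -> b <= c + eps by lra.
apply: (lin _ _ _ _ h1 h2).
rewrite ler_pdivrMr ?ltr0n //; apply: (le_trans (ler_norm _)).
rewrite mulrC -ler_pdivrMr //; apply: (le_trans (ltW hk)).
by rewrite ler_nat leqW // leq_maxr.
Qed.

Let ex_bound : exists G, forall z, f z <= G.
Proof.
by have [G hG] := torus_bounded tf; exists G => z; exact: le_trans (ler_norm _) (hG z).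
Qed.

Lemma torus_ln_integrable : mu2.-integrable sq (EFin \o (fun z => ln (f z))).
Proof.
have [G fG] := ex_bound; pose del : R := 2^-1.
have hd : 0 < del <= 2^-1 by rewrite lexx andbT invr_gt0.
by apply: (@ln_integrable _ _ R mu2 sq f _ C _ _ (torus_measurable tf) f0 fG torus_ln_sqr_bound _ hd);
  [exact: measurable_square|exact: mu2_square].
Qed.

Lemma torus_log_limit :
  (fun m : nat => \int[mu]_(t in I01) ln (f (t, m%:R * t))) @ \oo -->
  \int[mu2]_(z in sq) ln (f z).
Proof.
have [G fG] := ex_bound.
apply/cvgrPdist_le => eps eps0.
(* One third each for the cut-off on the torus, the cut-off on the line, and equidistribution of the
   cut-off logarithm. *)
have e3 : 0 < eps / 3 by lra.
have [del hd hdel] := cutoff_small C e3.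
have d0 : 0 < del ^+ 2 by rewrite exprn_gt0 //; case/andP: hd.
have [L hL] := torus_equidistribution (torus_ln d0 f0 tf).
have LE : 0 <= `|L| / (eps / 3) by rewrite divr_ge0 // ltW.
have := archi_boundP LE; set k := Num.bound _ => hk.
exists (maxn M0 k).+1 => // m /= hm.
have mM : (M0 <= m)%N by apply: leq_trans (leqW (leq_maxl M0 k)) hm.
have mk : (k <= m)%N by apply: leq_trans (leqW (leq_maxr M0 k)) hm.
have m0 : (0 < m)%N by case: m hm {mM mk}.
have /andP[a1 a2] : 0 <= \int[mu2]_(z in sq) ln (f z + del ^+ 2) - \int[mu2]_(z in sq) ln (f z) <=
    del + C / (- ln (del + del ^+ 2)).
  by apply: (@log_cutoff _ _ R mu2 sq f _ C _ _ (torus_measurable tf) f0 fG torus_ln_sqr_bound del hd);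
    [exact: measurable_square|exact: mu2_square].
have /andP[b1 b2] : 0 <= \int[mu]_(t in I01) ln (f (t, m%:R * t) + del ^+ 2) -
    \int[mu]_(t in I01) ln (f (t, m%:R * t)) <= del + C / (- ln (del + del ^+ 2)).
  by apply: (@log_cutoff _ _ R mu I01 (fun t => f (t, m%:R * t)) _ C _ _
    (torus_line_measurable m) (fun t => f0 _) (fun t => fG _) (fC mM) del hd) => //; exact: mu_I01.
have := hL m.-1; rewrite prednK // => hLm.
have Lm : L / m%:R <= eps / 3.
  rewrite ler_pdivrMr ?ltr0n //; apply: (le_trans (ler_norm _)).
  rewrite mulrC -ler_pdivrMr //; apply: (le_trans (ltW hk)).
  by rewrite ler_nat.
have lin (a a' b b' l u e : R) : 0 <= a' - a -> a' - a <= u -> 0 <= b' - b -> b' - b <= u ->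
    `|b' - a'| <= l -> u < e / 3 -> l <= e / 3 -> `|a - b| <= e.
  by rewrite !ler_norml => ? ? ? ? /andP[? ?] ? ?; apply/andP; split; lra.
exact: (lin _ _ _ _ _ _ _ a1 a2 b1 b2 hLm hdel Lm).
Qed.
End LogLimit.
End TorusLimit.

(** * Mahler measures of integer polynomials *)

Section Substitution.
Variable A : idomainType.
Implicit Type Q : {poly {poly A}}.

Definition max_size Q : nat := \max_(j < size Q) size (Q`_j)%R.

Lemma size_coef_le Q j : (size (Q`_j)%R <= max_size Q)%N.
Proof.
have [jQ|jQ] := ltnP j (size Q); last by rewrite nth_default // size_poly0.
exact: (@leq_bigmax _ (fun j : 'I_(size Q) => size Q`_j) (Ordinal jQ)).
Qed.

Lemma substXn_sum Q m : Q.['X^m] = \sum_(j < size Q) Q`_j * 'X^(m * j).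
Proof. by rewrite horner_coef; apply: eq_bigr => j _; rewrite exprM. Qed.

(** Once [m] exceeds every degree in the first variable, the blocks [Q_j(X) X^(m j)] occupy disjoint
    ranges of exponents. *)
Lemma coef_substXn Q m j k : (max_size Q <= m)%N -> (k < m)%N ->
  Q.['X^m]`_(m * j + k) = Q`_j`_k.
Proof.
move=> Qm km; rewrite substXn_sum coef_sum.
have other (i : nat) : i != j -> (Q`_i * 'X^(m * i))`_(m * j + k) = 0.
  rewrite coefMXn neq_ltn => /orP[ij|ji].
    have h : (m * i + m <= m * j)%N by rewrite addnC -mulnS leq_mul2l ij orbT.
    rewrite ltnNge (leq_trans _ (leq_addr _ _)) ?(leq_trans _ h) ?leq_addr //=.
    rewrite nth_default // (leq_trans (size_coef_le Q i)) // (leq_trans Qm) //.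
    by rewrite leq_subRL ?(leq_trans h) ?leq_addr // (leq_trans _ (leq_trans h (leq_addr _ _))) ?leq_addr.
  by rewrite ifT // (leq_trans (n := (m * j.+1)%N)) ?leq_mul2l ?ji ?orbT // mulnS addnC ltn_add2r.
have [jQ|jQ] := ltnP j (size Q); last first.
  rewrite [Q`_j]nth_default // coef0 big1 // => i _; apply: other.
  by rewrite neq_ltn (leq_trans (ltn_ord i) jQ).
rewrite (bigD1 (Ordinal jQ)) //= coefMXn ltnNge leq_addr /= addKn big1 ?addr0 // => i ij.
exact: other.
Qed.

Lemma substXn_neq0 Q m : Q != 0 -> (max_size Q <= m)%N -> Q.['X^m] != 0.
Proof.
move=> Q0 Qm; have Q'0 : Q`_(size Q).-1 != 0 by rewrite -/(lead_coef Q) lead_coef_eq0.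
set q := Q`_(size Q).-1 in Q'0; have q0 : q`_(size q).-1 != 0 by rewrite -/(lead_coef q) lead_coef_eq0.
apply: contraNneq q0 => P0; rewrite -(coef_substXn _ Qm) ?P0 ?coef0 //.
by rewrite (leq_trans _ Qm) // (leq_trans _ (size_coef_le Q (size Q).-1)) // prednK // size_poly_gt0.
Qed.

(** The length of this list of exponents does not depend on [m]; it is the number of monomials given
    to [ln_sqr_sparse_bound]. *)
Definition substXn_support Q m : seq nat :=
  [seq (m * j + k)%N | j <- iota 0 (size Q), k <- iota 0 (max_size Q)].

Lemma substXn_supportP Q m i : (0 < m)%N -> (max_size Q <= m)%N ->
  Q.['X^m]`_i != 0 -> i \in substXn_support Q m.
Proof.
move=> m0 Qm; rewrite {1}(divn_eq i m) mulnC coef_substXn ?ltn_mod // => nz.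
rewrite [i in i \in _](divn_eq i m) mulnC; apply: allpairs_f; rewrite mem_iota /= add0n.
  by rewrite ltnNge; apply: contra nz => h; rewrite [Q`_ _]nth_default ?coef0.
by apply: leq_trans (size_coef_le Q (i %/ m)); rewrite ltnNge; apply: contra nz => h; rewrite nth_default.
Qed.
End Substitution.

Section L1norm.
Variable R : realType.
Implicit Types p q : {poly R}.

Lemma l1norm_wide p N : (size p <= N)%N -> l1norm p = \sum_(k < N) `|p`_k|.
Proof.
move=> pN; rewrite /l1norm (big_ord_widen _ (fun k => `|p`_k|) pN) big_mkcond.
by apply: eq_bigr => k _; case: ltnP => // h; rewrite nth_default ?normr0.
Qed.

Lemma l1normD p q : l1norm (p + q) <= l1norm p + l1norm q.
Proof.
rewrite (l1norm_wide (size_polyD p q)) (l1norm_wide (leq_maxl _ (size q))).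
rewrite (l1norm_wide (leq_maxr (size p) _)) -big_split /=.
by apply: ler_sum => k _; rewrite coefD ler_normD.
Qed.

Lemma l1norm_sum (I : Type) (r : seq I) (F : I -> {poly R}) :
  l1norm (\sum_(i <- r) F i) <= \sum_(i <- r) l1norm (F i).
Proof.
elim: r => [|i r IH]; first by rewrite !big_nil /l1norm size_poly0 big_ord0.
by rewrite !big_cons; apply: le_trans (l1normD _ _) _; rewrite lerD2l.
Qed.

Lemma l1normMXn p n : l1norm (p * 'X^n) = l1norm p.
Proof.
rewrite (@l1norm_wide _ (n + size p)); last first.
  by apply: leq_trans (size_polyMleq _ _) _; rewrite size_polyXn addnS /= addnC.
rewrite big_split_ord /= big1 ?add0r => [|k _]; last by rewrite coefMXn ltn_ord normr0.
by apply: eq_bigr => k _; rewrite coefMXn ltnNge leq_addr /= addKn.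
Qed.
End L1norm.

From mathcomp Require Import Rstruct Rstruct_topology.

Section IntegerPolynomials.
Local Notation R := Rdefinitions.R.
Local Notation mu := (@lebesgue_measure R).
Local Notation mu2 := ((mu \x mu)%E).
Local Notation I01 := (`[0, 1]%classic : set R).
Local Notation sq := (I01 `*` I01).
Local Notation toR := (map_poly (intr : int -> R)).
Implicit Types (p q : {poly int}) (Q : {poly {poly int}}).

Lemma size_toR p : size (toR p) = size p.
Proof. by rewrite size_map_inj_poly //; exact: intr_inj. Qed.

(** Integrality enters here, as the lower bound on leading coefficients that the logarithmic
    estimates start from. *)
Lemma lead_toR p : p != 0 -> 1 <= `|lead_coef (toR p)|.
Proof.
move=> p0; rewrite lead_coef_map_inj //; last exact: intr_inj.
by rewrite -intr_norm -[1]/(1%:~R) ler_int -gtz0_ge1 normr_gt0 lead_coef_eq0.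
Qed.

Lemma abs2_1E p t : abs2_1 p t = nsq (circ (toR p) t).
Proof.
have sp : (size (toR p) <= size p)%N by rewrite size_toR.
rewrite /abs2_1 /nsq (Re_circ _ sp) (Im_circ _ sp).
by congr (_ ^+ 2 + _ ^+ 2); apply: eq_bigr => k _; rewrite coef_map.
Qed.

Lemma mahler1E p : p != 0 -> mahler1 p = expR (log_mahler (toR p) / 2).
Proof.
move=> p0; rewrite /mahler1 (negPf p0); congr expR.
under eq_Rintegral do rewrite abs2_1E.
by rewrite RintegralZr //; exact/circ_ln_integrable/lead_toR.
Qed.

Lemma mahler1M p q : mahler1 (p * q) = mahler1 p * mahler1 q.
Proof.
have [->|p0] := eqVneq p 0; first by rewrite mul0r {1 2}/mahler1 eqxx mul0r.
have [->|q0] := eqVneq q 0; first by rewrite mulr0 {1 3}/mahler1 eqxx mulr0.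
rewrite !mahler1E ?mulf_neq0 // -exp.expRD rmorphM log_mahlerM ?lead_toR //.
by rewrite mulrDl.
Qed.

Lemma mahler1_unit_circle p : p != 0 -> (forall t : R, nsq (circ (toR p) t) = 1) -> mahler1 p = 1.
Proof.
move=> p0 h; rewrite mahler1E // /log_mahler.
under eq_Rintegral do rewrite h ln1.
by rewrite Rintegral_cst // mul0r mul0r exp.expR0.
Qed.

Lemma mahler1N1 : mahler1 (-1) = 1.
Proof.
apply: mahler1_unit_circle => [|t]; first by rewrite oppr_eq0 oner_eq0.
by rewrite rmorphN1 /circ rmorphN1 hornerN hornerC /nsq /= oppr0 sqrrN expr0n addr0 expr1n.
Qed.

Lemma mahler1X : mahler1 'X = 1.
Proof.
apply: mahler1_unit_circle => [|t]; first by rewrite polyX_eq0.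
by rewrite map_polyX -['X]expr1 circXn nsq_expi.
Qed.

Lemma Xn_sub1_neq0 b : (0 < b)%N -> 'X^b - 1 != 0 :> {poly int}.
Proof. by move=> b0; rewrite monic_neq0 // monicXnsubC. Qed.

Lemma mahler1_Xn_sub1 b : (0 < b)%N -> mahler1 ('X^b - 1) = 1.
Proof.
move=> b0; rewrite mahler1E ?Xn_sub1_neq0 // rmorphB rmorph1 /= map_polyXn.
by case: b b0 => // b _; rewrite log_mahlerXn1 mul0r exp.expR0.
Qed.

Definition circ2 Q (z : R * R) : R[i] :=
  \sum_(j < size Q) circ (toR Q`_j) z.1 * expi (j%:R * z.2).

Lemma abs2_2E Q z : abs2_2 Q z = nsq (circ2 Q z).
Proof.
have E j : circ (toR Q`_j) z.1 * expi (j%:R * z.2) =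
    \sum_(k < size Q`_j) ((toR Q`_j)`_k)%:C%C * expi (k%:R * z.1 + j%:R * z.2).
  rewrite (@circE _ (size Q`_j)) ?size_toR // mulr_suml.
  by apply: eq_bigr => k _; rewrite expiD mulrA.
rewrite /circ2; under eq_bigr do rewrite E.
rewrite /abs2_2 /nsq Re_sum Im_sum.
congr (_ ^+ 2 + _ ^+ 2); apply: eq_bigr => j _; rewrite (Re_sum, Im_sum);
  by apply: eq_bigr => k _; rewrite coef_map /= mul0r ?subr0 ?addr0.
Qed.

Lemma circ2_line Q m t : circ2 Q (t, m%:R * t) = circ (toR Q.['X^m]) t.
Proof.
rewrite substXn_sum rmorph_sum /circ2 /circ rmorph_sum /= horner_sum.
apply: eq_bigr => j _; rewrite !rmorphM /= hornerM; congr (_ * _).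
by rewrite !map_polyXn hornerXn expiX natrM mulrCA mulrA.
Qed.

Lemma torus_abs2_2 Q : torus_fun (abs2_2 Q).
Proof.
have c2 (x : R) : cos (x + 2 * pi) = cos x by rewrite [2 * pi]mulr_natl cosD2pi.
have s2 (x : R) : sin (x + 2 * pi) = sin x by rewrite [2 * pi]mulr_natl sinD2pi.
have tc k j := torus_wave k j (@is_derive_cos R) (fun x => ltac:(by rewrite normrN sin_max)) (@cos_max R) c2.
have ts k j := torus_wave k j (@is_derive_sin R) (@cos_max R) (@sin_max R) s2.
rewrite /abs2_2.
by apply: torusD; apply: torusM; apply: torus_sum => j; apply: torus_sum => k;
  apply: torusM; [exact: torus_cst| |exact: torus_cst| |exact: torus_cst| |exact: torus_cst| ].
Qed.

Lemma substXn_log_bound Q : Q != 0 -> exists C : R, forall m, ((max_size Q).+1 <= m)%N ->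
  forall eta : R, 0 < eta <= 1 ->
  \int[mu]_(t in I01) ln (abs2_2 Q (t, m%:R * t) + eta) ^+ 2 <= C.
Proof.
move=> Q0; pose B := \sum_(j < size Q) l1norm (toR Q`_j).
have [C hC] := ln_sqr_sparse_bound (size Q * max_size Q) B.
exists C => m Qm eta he; have Qm' := ltnW Qm.
under eq_Rintegral do rewrite abs2_2E circ2_line.
apply: (hC _ (substXn_support Q m)) he.
- by rewrite size_allpairs !size_iota.
- move=> i; rewrite coef_map /= intr_eq0; apply: substXn_supportP => //.
  exact: leq_trans Qm.
- rewrite substXn_sum rmorph_sum /=; apply: le_trans (l1norm_sum _ _) _.
  by apply: ler_sum => j _; rewrite rmorphM /= map_polyXn l1normMXn.
- by apply: lead_toR; exact: substXn_neq0.
Qed.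

Lemma mahler_substXn_cvg Q : (fun m : nat => mahler1 Q.['X^m]) @ \oo --> mahler2 Q.
Proof.
have [->|Q0] := eqVneq Q 0.
  rewrite /mahler2 eqxx; under eq_fun do rewrite horner0 /mahler1 eqxx.
  exact: cvg_cst.
have [C hC] := substXn_log_bound Q0; have tQ := torus_abs2_2 Q.
have f0 z : 0 <= abs2_2 Q z by rewrite abs2_2E nsq_ge0.
rewrite /mahler2 (negPf Q0) RintegralZr //; last 2 first.
- exact: measurable_square.
- exact: torus_ln_integrable tQ f0 hC.
have lim := torus_log_limit tQ f0 hC.
apply: (@cvg_trans _ ((fun m : nat => expR ((\int[mu]_(t in I01) ln (abs2_2 Q (t, m%:R * t))) / 2)) @ \oo)).
  apply: near_eq_cvg; exists (max_size Q) => // m /= Qm.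
  rewrite mahler1E ?substXn_neq0 // /log_mahler; congr (expR (_ / 2)).
  by apply: eq_Rintegral => t _; rewrite abs2_2E circ2_line.
have lim2 := cvgM lim (cvg_cst (2^-1 : R)).
have ce := @continuous_expR R ((\int[mu2]_(z in sq) ln (abs2_2 Q z)) * 2^-1).
have lim3 := cvg_comp _ _ (lim2 _ _) ce.
exact: lim3.
Qed.
End IntegerPolynomials.

Theorem theorem2p3 (n : nat) (L'' : seq layer) :
  link_diagram (L'' ++ nested_caps n) ->
  exists P : {poly {poly int}},
    (fun m : nat => lmahler (jones (twisted L'' n m))) @ \oo --> mahler2 P.
Proof.
(* Signs, monomials and the denominators [X^b - 1] all lie in this multiplicative set, so
   multiplicativity of [mahler1] removes [D1] and [D2]. *)
pose UM (p : {poly int}) := p != 0 /\ mahler1 p = 1.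
move=> link; have [|||||Q hQ] := @twisted_jones_factor UM _ _ _ _ _ L'' n link.
- by move=> p [].
- by move=> p q [p0 p1] [q0 q1]; split; [exact: mulf_neq0|rewrite mahler1M p1 q1 mulr1].
- by split; [rewrite oppr_eq0 oner_eq0|exact: mahler1N1].
- by split; [rewrite polyX_eq0|exact: mahler1X].
- by move=> b b0; split; [exact: Xn_sub1_neq0|exact: mahler1_Xn_sub1].
exists Q; rewrite (_ : (fun m => _) = (fun m => mahler1 Q.['X^m])); first exact: mahler_substXn_cvg.
apply/funext => m; rewrite /lmahler; have [D1 [D2 [[_ h1] [_ h2] e]]] := hQ m.
by have := congr1 mahler1 e; rewrite !mahler1M h1 h2 !mulr1.
Qed.
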